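(* Let $d,m\ge2$, let $\Omega=(-a_1,a_1)\times\cdots\times(-a_d,a_d)\subset\mathbb{R}^d$ be a cuboid ($a_1,\dots,a_d>0$), and let $\Omega_a=(-a,a)^m\subset\mathbb{R}^m$ be the cube with side lengths $2a>0$. If $\Omega$ and $\Omega_a$ are Steklov isospectral, then $d=m$ and $\Omega=\Omega_a$.
   Context: The Steklov eigenvalues of a bounded Lipschitz domain $\Omega\subset\mathbb{R}^d$ ($d\ge2$) are the real numbers $\sigma$ for which there is a nonzero harmonic function $u$ on $\Omega$ with $\partial_n u=\sigma u$ (a.e.) on $\partial\Omega$, where $\partial_n$ is the outward normal derivative. They form a discrete sequence $0=\sigma_0<\sigma_1\le\sigma_2\le\cdots\nearrow\infty$, repeated according to multiplicity. Two domains are Steklov isospectral if these sequences (with multiplicities) coincide. *)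

(* Defs.v *)
From HB Require Import structures.
From mathcomp Require Import all_boot all_order all_algebra.
From mathcomp Require Import all_classical all_reals all_analysis.

Set Implicit Arguments.
Unset Strict Implicit.
Unset Printing Implicit Defensive.

Import Order.TTheory GRing.Theory Num.Theory.
Import numFieldNormedType.Exports.

Local Open Scope classical_set_scope.
Local Open Scope ring_scope.

(* [insert i c y] is the point with [i]-th coordinate [c] and the remaining
   coordinates, in order, those of [y]. *)
Definition insert (R : Type) (d : nat) (i : 'I_d) (c : R) (y : 'rV[R]_d.-1) :
    'rV[R]_d :=
  \row_j oapp (y ord0) c (unlift i j).

Section measurable_row.
Context (R : realType) (n : nat).

Let coord (i : 'I_n) (x : 'rV[R]_n) : R := x ord0 i.

Let row_set0 : g_sigma_preimage coord set0.
Proof. exact: sigma_algebra0. Qed.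

Let row_setC A : g_sigma_preimage coord A -> g_sigma_preimage coord (~` A).
Proof. exact: sigma_algebraC. Qed.

Let row_bigcup (F : _^nat) : (forall i, g_sigma_preimage coord (F i)) ->
  g_sigma_preimage coord (\bigcup_i (F i)).
Proof. exact: sigma_algebra_bigcup. Qed.

(* The product sigma-algebra, which is the Borel sigma-algebra of R^n. *)
HB.instance Definition _ := @isMeasurable.Build
  (measure_tuple_display default_measure_display)
  'rV[R]_n (g_sigma_preimage coord) row_set0 row_setC row_bigcup.

Lemma measurable_coord (i : 'I_n) :
  measurable_fun [set: 'rV[R]_n] (fun x : 'rV[R]_n => x ord0 i : R).
Proof.
move=> _ Y mY; rewrite setTI; apply: sub_sigma_algebra => /=.
rewrite -bigcup_seq/=; exists i => /=; first by rewrite mem_index_enum.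
by exists Y => //; rewrite setTI.
Qed.

Lemma measurable_fun_row d (T : measurableType d) (f : T -> 'rV[R]_n) :
  (forall i, measurable_fun [set: T] (fun t => f t ord0 i : R)) ->
  measurable_fun [set: T] f.
Proof.
move=> mf.
suff sub : g_sigma_preimage (fun i t => f t ord0 i : R) `<=` measurable.
  have := g_sigma_preimage_comp coord f => /= E.
  move: sub; rewrite (_ : (fun i t => _) = (fun i => coord i \o f)) // E => sub.
  by move=> _ A mA; apply: sub; exists A.
apply: smallest_sub; first exact: sigma_algebra_measurable.
case: n f mf => [|m] f mf; first by rewrite big_ord0.
rewrite -bigcup_mkord_ord; apply: bigcup_sub => i Ii.
by move=> A [B mB <-]; exact: mf.
Qed.

End measurable_row.

Section lebesgue_step.
Context (R : realType) (n : nat).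
Variable mu : {sigma_finite_measure set 'rV[R]_n -> \bar R}.

Let glue (p : measurableTypeR R * 'rV[R]_n) : 'rV[R]_n.+1 :=
  insert (ord0 : 'I_n.+1) (p.1 : R) p.2.

Lemma measurable_insert (i : 'I_n.+1) (c : R) :
  measurable_fun [set: 'rV[R]_n] (fun y : 'rV[R]_n => insert i c y).
Proof.
apply: measurable_fun_row => j; rewrite /insert.
under eq_fun do rewrite mxE.
case: unliftP => [k _|_] /=; first exact: measurable_coord.
exact: measurable_cst.
Qed.

Let measurable_glue : measurable_fun setT glue.
Proof.
apply: measurable_fun_row => j; rewrite /glue /insert.
under eq_fun do rewrite mxE.
case: unliftP => [k _|_] /=; last exact: measurable_fst.
exact: (measurableT_comp (@measurable_coord R n k) measurable_snd).
Qed.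

Definition lebesgue_succ : set 'rV[R]_n.+1 -> \bar R :=
  pushforward (@lebesgue_measure R \x mu)%E glue.

Let lebesgue_succ0 : lebesgue_succ set0 = 0%E.
Proof. by rewrite /lebesgue_succ /pushforward preimage_set0 measure0. Qed.

Let lebesgue_succ_ge0 A : (0 <= lebesgue_succ A)%E.
Proof. exact: measure_ge0. Qed.

Let lebesgue_succ_sigma_additive : semi_sigma_additive lebesgue_succ.
Proof.
move=> F mF tF mUF; rewrite /lebesgue_succ /pushforward preimage_bigcup.
apply: measure_semi_sigma_additive.
- by move=> k; rewrite -[X in measurable X]setTI; exact: measurable_glue.
- apply/trivIsetP => /= i j _ _ ij; rewrite -preimage_setI.
  by move/trivIsetP : tF => /(_ _ _ _ _ ij) ->//; rewrite preimage_set0.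
- by rewrite -preimage_bigcup -[X in measurable X]setTI; exact: measurable_glue.
Qed.

HB.instance Definition _ := isMeasure.Build _ _ _ lebesgue_succ
  lebesgue_succ0 lebesgue_succ_ge0 lebesgue_succ_sigma_additive.

Let split (x : 'rV[R]_n.+1) : measurableTypeR R * 'rV[R]_n :=
  (x ord0 ord0, \row_j x ord0 (lift ord0 j)).

Let measurable_split : measurable_fun setT split.
Proof.
apply/measurable_fun_pairP; split; first exact: measurable_coord.
apply: measurable_fun_row => j.
under eq_fun do rewrite /= mxE.
exact: measurable_coord.
Qed.

Let glueK : cancel glue split.
Proof.
move=> [c y]; rewrite /split /glue /insert; congr pair.
  by rewrite mxE unlift_none.
by apply/rowP => j; rewrite !mxE liftK.
Qed.

Let lebesgue_succ_sigma_finite : sigma_finite setT lebesgue_succ.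
Proof.
have /sigma_finiteP[F [TF ndF Foo]] := sigma_finiteT (@lebesgue_measure R).
have /sigma_finiteP[G [TG ndG Goo]] := sigma_finiteT mu.
exists (fun k => split @^-1` (F k `*` G k)).
  apply/seteqP; split=> // x _.
  have [k _ Fk] : (\bigcup_k F k) (split x).1 by rewrite -TF.
  have [l _ Gl] : (\bigcup_k G k) (split x).2 by rewrite -TG.
  exists (maxn k l) => //; split.
  - by move: (split x).1 Fk; exact/subsetPset/ndF/leq_maxl.
  - by move: (split x).2 Gl; exact/subsetPset/ndG/leq_maxr.
move=> k; have [mF Fk] := Foo k; have [mG Gk] := Goo k.
have mFG : measurable (F k `*` G k) by exact: measurableX.
split.
  by rewrite -[X in measurable X]setTI; exact: measurable_split.
rewrite /lebesgue_succ /pushforward (_ : glue @^-1` _ = F k `*` G k).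
  by rewrite product_measure1E// lte_mul_pinfty// ge0_fin_numE.
rewrite -comp_preimage (_ : split \o glue = id)//.
by apply/funext => p; exact: glueK.
Qed.

HB.instance Definition _ := Measure_isSigmaFinite.Build _ _ _ lebesgue_succ
  lebesgue_succ_sigma_finite.

End lebesgue_step.

Section dirac_row0.
Context (R : realType).

Definition lebesgue_zero : set 'rV[R]_0 -> \bar R := \d_(0 : 'rV[R]_0).

HB.instance Definition _ := Measure.on lebesgue_zero.

Let lebesgue_zero_sigma_finite : sigma_finite setT lebesgue_zero.
Proof.
apply: fin_num_fun_sigma_finite; first by rewrite /lebesgue_zero dirac0.
by move=> A _; rewrite /lebesgue_zero diracE.
Qed.

HB.instance Definition _ := Measure_isSigmaFinite.Build _ _ _ lebesgue_zero
  lebesgue_zero_sigma_finite.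

End dirac_row0.

(* n-dimensional Lebesgue measure on R^n. *)
Fixpoint lebesgue_row (R : realType) (n : nat) :
    {sigma_finite_measure set 'rV[R]_n -> \bar R} :=
  match n with
  | 0 => @lebesgue_zero R
  | k.+1 => lebesgue_succ (lebesgue_row R k)
  end.

Definition cuboid (R : realType) (d : nat) (b : 'I_d -> R) : set 'rV[R]_d :=
  [set x | forall i, - b i < x ord0 i < b i].

Lemma measurable_cuboid (R : realType) (d : nat) (b : 'I_d -> R) :
  measurable (cuboid b).
Proof.
rewrite (_ : cuboid b = \bigcap_(i in [set: 'I_d])
    ([set: 'rV[R]_d] `&` (fun x : 'rV[R]_d => x ord0 i : R) @^-1` `]- b i, b i[)).
  apply: fin_bigcap_measurable; first exact: finite_finset.
  by move=> i _; apply: measurable_coord.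
apply/seteqP; split=> x /= xb i; first by split=> //=; rewrite in_itv/= xb.
by have [] := xb i I; rewrite /= in_itv.
Qed.

(* The (d-1)-dimensional measure carried by the face
   {x_i = c, |x_j| < b_j for j <> i}. *)
Definition face_measure (R : realType) (d : nat) (b : 'I_d -> R) (i : 'I_d)
    (c : R) : set 'rV[R]_d -> \bar R :=
  pushforward
    (mrestr (lebesgue_row R d.-1)
       (measurable_cuboid (fun j : 'I_d.-1 => b (lift i j))))
    (insert i c).

(* Surface measure of the boundary of the cuboid: the 2d open faces carry it,
   the edges being null. *)
Definition cuboid_surface (R : realType) (d : nat) (b : 'I_d -> R) :
    set 'rV[R]_d -> \bar R :=
  fun A => (\sum_(i < d) (face_measure b i (b i) A +
                          face_measure b i (- b i) A))%E.

Section cuboid_surface_measure.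
Context (R : realType) (d : nat) (b : 'I_d -> R).

Let surface0 : cuboid_surface b set0 = 0%E.
Proof.
rewrite /cuboid_surface big1// => i _.
by rewrite /face_measure /pushforward preimage_set0 measure0 adde0.
Qed.

Let face_ge0 i c A : (0 <= face_measure b i c A)%E.
Proof. by rewrite /face_measure /pushforward; exact: measure_ge0. Qed.

Let surface_ge0 A : (0 <= cuboid_surface b A)%E.
Proof. by apply: sume_ge0 => i _; rewrite adde_ge0. Qed.

Let face_sigma_additive i c : semi_sigma_additive (face_measure b i c).
Proof.
have mi : measurable_fun setT (insert i c).
  by case: d i => [[] //|n] i; exact: measurable_insert.
move=> F mF tF mUF; rewrite /face_measure /pushforward preimage_bigcup.
apply: measure_semi_sigma_additive.
- by move=> k; rewrite -[X in measurable X]setTI; exact: mi.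
- apply/trivIsetP => /= j k _ _ jk; rewrite -preimage_setI.
  by move/trivIsetP : tF => /(_ _ _ _ _ jk) ->//; rewrite preimage_set0.
- by rewrite -preimage_bigcup -[X in measurable X]setTI; exact: mi.
Qed.

Let face_eq i c F : (forall k, measurable (F k)) -> trivIset setT F ->
  measurable (\bigcup_k F k) ->
  face_measure b i c (\bigcup_k F k) =
  (\sum_(0 <= k <oo) face_measure b i c (F k))%E.
Proof.
by move=> mF tF mUF; apply/esym/cvg_lim => //; exact: face_sigma_additive.
Qed.

Let surface_sigma_additive : semi_sigma_additive (cuboid_surface b).
Proof.
move=> F mF tF mUF; rewrite [X in _ --> X](_ : _ =
    lim ((fun n => (\sum_(0 <= i < n) cuboid_surface b (F i))%E) @ \oo)).
  by apply: is_cvg_ereal_nneg_natsum => k _; exact: surface_ge0.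
rewrite nneseries_sum//; last by move=> *; rewrite adde_ge0.
apply: eq_bigr => /= i _.
by rewrite nneseriesD// !face_eq.
Qed.

HB.instance Definition _ := isMeasure.Build _ _ _ (cuboid_surface b)
  surface0 surface_ge0 surface_sigma_additive.

End cuboid_surface_measure.

Definition partial (R : realType) (d : nat) (i : 'I_d) (u : 'rV[R]_d -> R) :
    'rV[R]_d -> R :=
  fun x => 'D_(delta_mx ord0 i) u x.

(* u is of class C^k on the open set D. *)
Fixpoint class_C (R : realType) (d k : nat) (D : set 'rV[R]_d)
    (u : 'rV[R]_d -> R) : Prop :=
  (forall x, D x -> {for x, continuous u}) /\
  match k with
  | 0 => True
  | k'.+1 => forall i : 'I_d,
      (forall x, D x -> derivable u x (delta_mx ord0 i)) /\
      class_C k' D (partial i u)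
  end.

Definition harmonic (R : realType) (d : nat) (D : set 'rV[R]_d)
    (u : 'rV[R]_d -> R) : Prop :=
  class_C 2 D u /\
  forall x, D x -> \sum_(i < d) partial i (partial i u) x = 0.

Definition square_integrable (disp : measure_display)
    (T : measurableType disp) (R : realType) (mu : {measure set T -> \bar R})
    (D : set T) (f : T -> R) : Prop :=
  measurable_fun D f /\ mu.-integrable D (fun x => (f x ^+ 2)%:E).

(* An open set together with the surface measure of its boundary and its
   (almost everywhere defined) outward unit normal. *)
Record domain (R : realType) (d : nat) := Domain {
  dom : set 'rV[R]_d ;
  surface : {measure set 'rV[R]_d -> \bar R} ;
  normal : 'rV[R]_d -> 'rV[R]_d }.

(* On the open face {x_i = b_i} (resp. {x_i = - b_i}) the normal is e_i (resp.
   - e_i); the value on the edges is irrelevant. *)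
Definition cuboid_domain (R : realType) (d : nat) (b : 'I_d -> R) :
    domain R d :=
  @Domain R d (cuboid b) (cuboid_surface b)
    (fun x => \row_i (if `|x ord0 i| == b i then Num.sg (x ord0 i) else 0)).

Section steklov.
Context (R : realType) (d : nat) (Omega : domain R d).
Implicit Types (u v f g : 'rV[R]_d -> R) (sigma : R).

Local Notation D := (dom Omega).
Local Notation leb := (lebesgue_row R d).
Local Notation dS := (surface Omega).

(* Membership in the Sobolev space H^1(Omega), for a function of class C^1 in
   Omega: its weak gradient is then its classical one. *)
Definition in_H1 u : Prop :=
  square_integrable leb D u /\
  forall i : 'I_d, square_integrable leb D (partial i u).

(* f in L^2(boundary) is the trace of u in H^1(Omega). The trace is determined
   by the divergence theorem for the fields v u e_i; the test functions v, of
   class C^1 up to the boundary, are dense in H^1(Omega). *)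
Definition is_trace u f : Prop :=
  square_integrable dS setT f /\
  forall v, class_C 1 setT v -> forall i : 'I_d,
    \int[leb]_(x in D) (partial i u x * v x + u x * partial i v x) =
    \int[dS]_x (f x * v x * normal Omega x ord0 i).

(* g in L^2(boundary) is the outward normal derivative of the harmonic function
   u in H^1(Omega), in the sense of Green's formula. *)
Definition is_normal_derivative u g : Prop :=
  square_integrable dS setT g /\
  forall v, class_C 1 setT v ->
    \int[leb]_(x in D) (\sum_(i < d) partial i u x * partial i v x) =
    \int[dS]_x (g x * v x).

(* The Steklov problem, zero solution included. *)
Definition steklov_solution sigma u : Prop :=
  [/\ harmonic D u, in_H1 u &
    exists f g, [/\ is_trace u f, is_normal_derivative u g &
      {ae dS, forall x, g x = sigma * f x}]].

(* The space of solutions, as functions on Omega, has dimension k; sigma is a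
   Steklov eigenvalue when k > 0, and k is then its multiplicity. *)
Definition steklov_multiplicity sigma (k : nat) : Prop :=
  exists u : 'I_k -> 'rV[R]_d -> R,
    [/\ forall j, steklov_solution sigma (u j),
        forall c : 'I_k -> R,
          (forall x, D x -> \sum_(j < k) c j * u j x = 0) ->
          forall j, c j = 0
      & forall w, steklov_solution sigma w ->
          exists c : 'I_k -> R,
            forall x, D x -> w x = \sum_(j < k) c j * u j x].

(* s lists the Steklov eigenvalues, repeated according to multiplicity. *)
Definition steklov_spectrum (s : nat -> R) : Prop :=
  [/\ nondecreasing_seq s, s n @[n --> \oo] --> +oo &
    forall sigma, exists k : nat,
      ([set n | s n = sigma] #= `I_k)%card /\ steklov_multiplicity sigma k].

End steklov.

Definition steklov_isospectral (R : realType) (d m : nat)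
    (Omega : domain R d) (Omega' : domain R m) : Prop :=
  exists s : nat -> R, steklov_spectrum Omega s /\ steklov_spectrum Omega' s.

(* Main.v *)
(* Let K(sigma) be the set of k in N^d with sum_i robin_lam (b i) sigma (k i) = 0,
   where robin_lam a sigma 0 < robin_lam a sigma 1 < ... are the eigenvalues of
   - v'' = lambda v on [-a, a] with outward derivative sigma v at the ends. Products of
   Robin eigenfunctions indexed by K(sigma) are Steklov eigenfunctions for sigma, and
   by Green's formula every solution is orthogonal to the other products; as the
   products are total in L^2, the multiplicity of sigma > 0 is #K(sigma).
   Dimension: robin_lam a sigma k >= 0 for k >= 2, so k in K(sigma) has a coordinate at
   most 1, and the others are O(sigma); hence the number of eigenvalues up to sigma has
   order sigma^(d - 1), and d = m.
   Shape: let sigma be the first positive eigenvalue of the cube, which comes from the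
   d unit vectors. For the cuboid nothing lies below sigma, so only unit vectors can
   lie in K(sigma), and the multiplicity d forces all of them to do so. Then
   robin_lam (b i) sigma 1 - robin_lam (b i) sigma 0 does not depend on i; it is
   strictly decreasing in b i, so the cuboid is a cube, whose side is given by sigma. *)

Require Import Defs.
From HB Require Import structures.
From mathcomp Require Import all_boot all_order all_algebra.
From mathcomp Require Import ring lra zify.
From mathcomp Require Import all_classical all_reals all_analysis measurable_realfun.
Set Implicit Arguments.
Unset Strict Implicit.
Unset Printing Implicit Defensive.
Import Order.TTheory GRing.Theory Num.Theory.
Import numFieldNormedType.Exports.
Local Open Scope classical_set_scope.
Local Open Scope ring_scope.

(** The isospectrality hypothesis supplies finite multiplicities, so the proof compares dimension
    counts one [sigma] at a time. The main obstacle is totality. The boundary term of the Robin form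
    has the wrong sign, so this form is indefinite, and a Steklov solution is known only through its
    H^1 norm and weak boundary formulas. Totality is used in one form: a square-integrable function,
    continuous on the cuboid and orthogonal to all products, vanishes there. It comes from
    approximation in one variable, carried out coordinate by coordinate, followed by a test against
    C^1 bumps. The Robin levels solve transcendental equations. Parametrized by frequency, they make
    the boundary parameter an explicit function of the level; strict monotonicity then gives
    uniqueness, and openness of the range gives continuity. Hence [robin_sum] is continuous and
    strictly decreasing in [sigma]: an index lies in K(sigma) for at most one [sigma], and the
    intermediate value theorem finds that [sigma]. Counting eigenvalues becomes counting indices,
    compared fibre by fibre over [sigma]. *)

Section RealCalculus.
Context {R : realType}.
Implicit Types (f g df dg : R -> R) (x y a b c : R).

(** * Calculus of one real variable *)

Lemma is_derive1M f g x a b : is_derive x 1 f a -> is_derive x 1 g b ->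
  is_derive x 1 (fun y => f y * g y) (a * g x + f x * b).
Proof.
move=> fa gb; apply: (@is_derive_eq R R R (f * g)).
by rewrite addrC; congr (_ + _); exact: mulrC.
Qed.

Lemma is_derive1D f g x a b : is_derive x 1 f a -> is_derive x 1 g b ->
  is_derive x 1 (fun y => f y + g y) (a + b).
Proof. by move=> fa gb; apply: (@is_derive_eq R R R (f + g)). Qed.

Lemma is_derive1B f g x a b : is_derive x 1 f a -> is_derive x 1 g b ->
  is_derive x 1 (fun y => f y - g y) (a - b).
Proof. by move=> fa gb; apply: (@is_derive_eq R R R (f - g)). Qed.

Lemma is_derive1N f x a : is_derive x 1 f a ->
  is_derive x 1 (fun y => - f y) (- a).
Proof. by move=> fa; apply: (@is_derive_eq R R R (- f)). Qed.

Lemma is_derive1_id x : is_derive x 1 (fun y : R => y) (1 : R).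
Proof. exact: is_derive_id. Qed.

Lemma is_derive1Zl f x a c : is_derive x 1 f a ->
  is_derive x 1 (fun y => c * f y) (c * a).
Proof.
move=> fa; apply: is_derive_eq (is_derive1M (is_derive_cst c x 1) fa) _.
by rewrite mul0r add0r.
Qed.

Lemma is_derive1_linear f x a c e : is_derive (c * x + e) 1 f a ->
  is_derive x 1 (fun y => f (c * y + e)) (c * a).
Proof.
move=> fa; rewrite mulrC.
have ga : is_derive x 1 (fun y => c * y + e) c.
  have h := is_derive1D (is_derive1Zl c (is_derive_id x (1 : R)))
    (is_derive_cst e x (1 : R)).
  by apply: is_derive_eq h _; rewrite mulr1 addr0.
exact: (@is_derive1_comp R f (fun y => c * y + e)).
Qed.

Lemma is_derive1_continuous f x a : is_derive x 1 f a -> {for x, continuous f}.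
Proof. by move=> fa; apply/differentiable_continuous/derivable1_diffP; case: fa. Qed.

Lemma continuous_segment f x y : continuous f -> {within `[x, y], continuous f}.
Proof. exact: continuous_subspaceT. Qed.

Lemma continuous_mul f g : continuous f -> continuous g ->
  continuous (fun x => f x * g x).
Proof. by move=> cf cg x; apply: cvgM; [exact: cf|exact: cg]. Qed.

Lemma continuous_sub f g : continuous f -> continuous g ->
  continuous (fun x => f x - g x).
Proof. by move=> cf cg x; apply: cvgB; [exact: cf|exact: cg]. Qed.

Lemma continuous_add f g : continuous f -> continuous g ->
  continuous (fun x => f x + g x).
Proof. by move=> cf cg x; apply: cvgD; [exact: cf|exact: cg]. Qed.

Lemma continuous_const c : continuous (fun _ : R => c).
Proof. by move=> x; exact: cvg_cst. Qed.

Lemma continuous_idfun : continuous (fun x : R => x).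
Proof. by move=> x; exact: cvg_id. Qed.

Lemma ltr_of_derive f df x y : x < y -> (forall t : R, is_derive t 1 f (df t)) ->
  (forall t, x < t < y -> 0 < df t) -> f x < f y.
Proof.
move=> xy fdf df0.
have cf : continuous f by move=> t; exact: is_derive1_continuous (fdf t).
have [c] := MVT xy (fun t _ => fdf t) (continuous_segment cf).
rewrite in_itv/= => /df0 dfc fyx.
by rewrite -subr_gt0 fyx mulr_gt0// subr_gt0.
Qed.

Lemma IVT_root f x y : x <= y -> continuous f -> f x < 0 -> 0 < f y ->
  exists2 t, x < t < y & f t = 0.
Proof.
move=> xy cf fx fy.
have [] := @IVT R f x y 0 xy (continuous_segment cf).
  by rewrite ge_min le_max (ltW fx) (ltW fy) orbT.
move=> t; rewrite in_itv/= => /andP[xt ty] ft; exists t => //.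
rewrite !lt_neqAle xt ty !andbT; apply/andP; split; apply/eqP => e.
  by move: fx; rewrite e ft ltxx.
by move: fy; rewrite -e ft ltxx.
Qed.

(* Sturm comparison: the Wronskian of two positive solutions is monotone. *)
Lemma sturm_comparison (v dv w dw : R -> R) (l m : R) :
  (forall x : R, is_derive x 1 v (dv x)) -> (forall x : R, is_derive x 1 dv (- l * v x)) ->
  (forall x : R, is_derive x 1 w (dw x)) -> (forall x : R, is_derive x 1 dw (- m * w x)) ->
  (forall x, 0 < x < 1 -> 0 < v x) -> (forall x, 0 < x < 1 -> 0 < w x) ->
  l < m -> dv 0 * w 0 = v 0 * dw 0 -> v 1 * dw 1 < dv 1 * w 1.
Proof.
move=> v1 v2 w1 w2 v0 w0 lm e0.
have := @ltr_of_derive (fun x => dv x * w x - v x * dw x)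
  (fun x => (m - l) * (v x * w x)) 0 1 ltr01.
rewrite e0 subrr subr_gt0; apply.
- move=> t.
  apply: is_derive_eq (is_derive1B (is_derive1M (v2 t) (w1 t))
    (is_derive1M (v1 t) (w2 t))) _.
  by ring.
- by move=> t t01; rewrite !mulr_gt0 ?v0 ?w0 ?subr_gt0.
Qed.

End RealCalculus.

(** * Hyperbolic functions *)

Section Hyperbolic.
Context {R : realType}.
Implicit Types x y z : R.

Definition ch x := (expR x + expR (- x)) / 2.
Definition sh x := (expR x - expR (- x)) / 2.

Let is_derive_expN x : is_derive x 1 (fun y : R => expR (- y)) (- expR (- x)).
Proof.
have := @is_derive1_linear R (@expR R) x (expR (- x)) (-1) 0.
rewrite mulN1r addr0 => /(_ (is_derive_expR _)).
rewrite mulN1r (_ : (fun y => _) = (fun y => expR (- y)))//.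
by apply/funext => y; rewrite mulN1r addr0.
Qed.

Lemma is_derive_ch x : is_derive x 1 ch (sh x).
Proof.
have -> : ch = fun y => 2^-1 * (expR y + expR (- y)).
  by apply/funext => y; rewrite /ch mulrC.
rewrite /sh mulrC.
by apply/is_derive1Zl/is_derive1D.
Qed.

Lemma is_derive_sh x : is_derive x 1 sh (ch x).
Proof.
have -> : sh = fun y => 2^-1 * (expR y - expR (- y)).
  by apply/funext => y; rewrite /sh mulrC.
rewrite /ch mulrC -[expR (- x)]opprK.
by apply/is_derive1Zl/is_derive1B.
Qed.

Lemma continuous_ch : continuous ch.
Proof. by move=> x; exact: is_derive1_continuous (is_derive_ch x). Qed.
Lemma continuous_sh : continuous sh.
Proof. by move=> x; exact: is_derive1_continuous (is_derive_sh x). Qed.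

Lemma ch0 : ch 0 = 1.
Proof. by rewrite /ch oppr0 expR0 -[1 + 1]/(2%:R) divff. Qed.

Lemma sh0 : sh 0 = 0.
Proof. by rewrite /sh oppr0 subrr mul0r. Qed.

Lemma chN x : ch (- x) = ch x.
Proof. by rewrite /ch opprK addrC. Qed.

Lemma shN x : sh (- x) = - sh x.
Proof. by rewrite /sh opprK -mulNr opprB. Qed.

Lemma ch_gt0 x : 0 < ch x.
Proof. by rewrite divr_gt0// addr_gt0 ?expR_gt0. Qed.

Lemma sh_gt0 x : 0 < x -> 0 < sh x.
Proof.
by move=> x0; rewrite divr_gt0// subr_gt0 ltr_expR; lra.
Qed.

Lemma sh_lt_ch x : sh x < ch x.
Proof. by have := expR_gt0 (- x); rewrite /sh /ch; lra. Qed.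

Lemma shB x y : sh (x - y) = sh x * ch y - ch x * sh y.
Proof. by rewrite /sh /ch opprB !expRD; field. Qed.

Lemma sh_gt_id x : 0 < x -> x < sh x.
Proof.
move=> x0.
have /= := @ltr_of_derive R (fun y => sh y - y) (fun y => ch y - 1) 0 x x0.
rewrite sh0 subr0 subr_gt0; apply.
  by move=> t; exact: is_derive1B (is_derive_sh t) (is_derive1_id t).
move=> t /andP[t0 _]; have := @ltr_of_derive R ch sh 0 t t0 is_derive_ch.
by rewrite ch0 subr_gt0; apply=> u /andP[u0 _]; exact: sh_gt0.
Qed.

End Hyperbolic.

(** * Robin eigenvalues on an interval *)

Section RobinLevels.
Context {R : realType}.
Implicit Types (k : nat) (s l z t : R).

Local Notation h := (pi / 2 : R).

(* [robin_level k s l] says that [l] is the eigenvalue of index [k] of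
   [- v'' = l v] on [-1, 1] with [v'(1) = s v(1)] and [v'(-1) = - s v(-1)]. *)
Definition robin_level k s l : Prop :=
  match k with
  | 0 => exists2 z, 0 < z & l = - z ^+ 2 /\ z * sh z = s * ch z
  | 1 => [\/ exists2 z, 0 < z < h & l = z ^+ 2 /\ z * cos z = s * sin z,
             l = 0 /\ s = 1 |
             exists2 z, 0 < z & l = - z ^+ 2 /\ z * ch z = s * sh z]
  | _ => exists2 t, 0 < t < h &
           l = (k%:R * h - t) ^+ 2 /\ (k%:R * h - t) * sin t = s * cos t
  end.

Let h_gt0 : 0 < h.
Proof. by have /andP[] := @pihalf_02 R. Qed.

Let sin_h t : 0 < t < h -> 0 < sin t.
Proof. exact: sin_gt0_pihalf. Qed.

Let cos_h t : 0 < t < h -> 0 < cos t.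
Proof.
by move=> /andP[t0 th]; apply: cos_gt0_pihalf; rewrite th andbT; have := h_gt0; lra.
Qed.

Lemma sin_lt_id t : 0 < t < h -> sin t < t.
Proof.
move=> /andP[t0 th].
have := @ltr_of_derive R (fun y => y - sin y) (fun y => 1 - cos y) 0 t t0.
rewrite sin0 subrr subr_gt0; apply.
move=> u /andP[u0 ut].
have uh : 0 < u < h by rewrite u0 (lt_trans ut).
have := sin_h uh; have := cos_h uh; have := cos2Dsin2 u.
set c := cos u; set d := sin u => e c0 d0.
suff : c < 1 by lra.
by nra.
Qed.

(** Each boundary equation has a root by the intermediate value theorem; the work lies in the
    brackets. For index 1 the level is positive, zero or negative according as [s] is below, at or
    above 1; at [s = 1] the eigenfunction is [x]. *)
Lemma robin_level_exists k s : 0 < s -> exists l, robin_level k s l.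
Proof.
move=> s0; case: k => [|[|k]].
- have cf : continuous (fun z : R => z * sh z - s * ch z).
    by apply: continuous_sub; apply: continuous_mul;
      [exact: continuous_idfun|exact: continuous_sh|exact: continuous_const|exact: continuous_ch].
  have [||z /andP[z0 _] ez] := IVT_root (ltW (addr_gt0 s0 ltr01)) cf.
  + by rewrite /= ch0 mul0r mulr1 sub0r oppr_lt0.
  (* At [z = s + 1] the function equals [sh (s + 1) - s * expR (- (s + 1))], which is positive since
     [sh (s + 1) > s + 1]. *)
  + have s1 : 0 < s + 1 by lra.
    rewrite (_ : _ - _ = sh (s + 1) - s * (ch (s + 1) - sh (s + 1))); last by ring.
    rewrite subr_gt0.
    have -> : ch (s + 1) - sh (s + 1) = expR (- (s + 1)) by rewrite /ch /sh; field.
    have e1 : expR (- (s + 1)) < 1 by rewrite -[ltRHS]expR0 ltr_expR; lra.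
    have := sh_gt_id s1; have := expR_gt0 (- (s + 1)).
    by nra.
  by exists (- z ^+ 2), z => //; split=> //; apply/eqP; rewrite -subr_eq0 ez.
- have [s1|s1|s1] := ltgtP s 1.
  (* At the left end [acos s] the function [s * sin z - z * cos z] becomes [s * (sin z - z) < 0]; at
     the right end [h] it equals [s]. *)
  + have sN : -1 <= s <= 1 by apply/andP; split; lra.
    have a0 : 0 < acos s by apply: acos_gt0; apply/andP; split; lra.
    have ah : acos s < h.
      rewrite -(@ltr_cos R) ?acosK ?in_itv/= ?cos_pihalf//.
        by rewrite ltW//= acos_lepi.
      by move: h_gt0 (@pi_gt0 R) => ? ?; apply/andP; split; lra.
    have cf : continuous (fun z : R => s * sin z - z * cos z).
      by apply: continuous_sub; apply: continuous_mul;
        [exact: continuous_const|exact: continuous_sin|exact: continuous_idfun|exact: continuous_cos].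
    have [||z /andP[z0 zh] ez] := IVT_root (ltW ah) cf.
    * rewrite acosK ?in_itv// mulrC -mulrBl mulrC pmulr_rlt0//.
      by rewrite subr_lt0 sin_lt_id// a0.
    * by rewrite sin_pihalf cos_pihalf mulr0 subr0 mulr1.
    exists (z ^+ 2); apply: Or31; exists z; first by rewrite zh (lt_trans a0).
    by split=> //; apply/esym/eqP; rewrite -subr_eq0 ez.
  (* The left end is the [y] with [ch y = s]: there [z * ch z - s * sh z] becomes
     [s * (y - sh y) < 0]. The right end is [z = s]. *)
  + have cc : continuous (fun z : R => ch z - s).
      by apply: continuous_sub; [exact: continuous_ch|exact: continuous_const].
    have [||y /andP[y0 ys] ey] := IVT_root (ltW s0) cc.
    * by rewrite ch0 subr_lt0.
    * by rewrite subr_gt0 (lt_trans (sh_gt_id s0))// sh_lt_ch.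
    have cf : continuous (fun z : R => z * ch z - s * sh z).
      by apply: continuous_sub; apply: continuous_mul;
        [exact: continuous_idfun|exact: continuous_ch|exact: continuous_const|exact: continuous_sh].
    have [||z /andP[z0 zh] ez] := IVT_root (ltW ys) cf.
    * move/eqP: ey; rewrite subr_eq0 => /eqP ->.
      by rewrite mulrC -mulrBr pmulr_rlt0// subr_lt0 sh_gt_id.
    * by rewrite -mulrBr mulr_gt0// subr_gt0 sh_lt_ch.
    exists (- z ^+ 2); apply: Or33; exists z; first by rewrite (lt_trans y0).
    by split=> //; apply/eqP; rewrite -subr_eq0 ez.
  + by exists 0; apply: Or32.
- have cf : continuous (fun t : R => (k.+2%:R * h - t) * sin t - s * cos t).
    apply: continuous_sub; apply: continuous_mul.
    - by apply: continuous_sub; [exact: continuous_const|exact: continuous_idfun].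
    - exact: continuous_sin.
    - exact: continuous_const.
    - exact: continuous_cos.
  have [||t th et] := IVT_root (ltW h_gt0) cf.
  + by rewrite sin0 cos0 mulr0 mulr1 sub0r oppr_lt0.
  + rewrite sin_pihalf cos_pihalf mulr0 subr0 mulr1 subr_gt0.
    by rewrite ltr_pMl// ltr1n.
  exists ((k.+2%:R * h - t) ^+ 2), t => //.
  by split=> //; apply/eqP; rewrite -subr_eq0 et.
Qed.


Lemma robin_level_gt0 k s l : robin_level k s l -> 0 < s.
Proof.
case: k => [|[|k]] /=.
- move=> [z z0 [_ e]]; have := ch_gt0 z; have := mulr_gt0 z0 (sh_gt0 z0).
  by rewrite e => ? ?; rewrite -(pmulr_lgt0 _ (ch_gt0 z)).
- move=> [[z zh [_ e]]|[_ ->]|[z z0 [_ e]]] //.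
    have /andP[z0 _] := zh; rewrite -(pmulr_lgt0 _ (sin_h zh)) -e.
    by rewrite mulr_gt0// cos_h.
  by rewrite -(pmulr_lgt0 _ (sh_gt0 z0)) -e mulr_gt0// ch_gt0.
- move=> [t th [_ e]]; rewrite -(pmulr_lgt0 _ (cos_h th)) -e.
  rewrite mulr_gt0// ?sin_h// subr_gt0; have /andP[_ /lt_le_trans] := th; apply.
  by rewrite ler_pMl// ler1n.
Qed.

Let sqr_pos_inj (y z : R) : 0 < y -> 0 < z -> y ^+ 2 = z ^+ 2 -> y = z.
Proof. by move=> y0 z0 /eqP; rewrite eqrXn2// ?ltW// => /eqP. Qed.

Let kh_gt k t : 0 < t < h -> k.+1%:R * h < k.+2%:R * h - t.
Proof. by move=> /andP[t0 th]; rewrite -(natr1 k.+1); lra. Qed.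

Let kh_gt0 k t : 0 < t < h -> 0 < k.+2%:R * h - t.
Proof.
by move=> th; apply: lt_trans (kh_gt k th); rewrite mulr_gt0.
Qed.

(** The sign of [l] selects the branch and its size fixes [z] or [t]; the boundary equation can then
    be solved for [s]. *)
Lemma robin_level_inj k s s' l : robin_level k s l -> robin_level k s' l -> s = s'.
Proof.
case: k => [|[|k]] /=.
- move=> [z z0 [-> e]] [y y0 [/oppr_inj zy e']].
  move: e'; rewrite -(sqr_pos_inj z0 y0 zy) e.
  by move/(mulIf (lt0r_neq0 (ch_gt0 z))).
- move=> [[z zh [-> e]]|[-> ->]|[z z0 [-> e]]] [[y yh [zy e']]|[zy e']|[y y0 [zy e']]].
  + have /andP[z0 _] := zh; have /andP[y0 _] := yh.
    move: e'; rewrite -(sqr_pos_inj z0 y0 zy) e.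
    by move/(mulIf (lt0r_neq0 (sin_h zh))).
  + by have /andP[z0 _] := zh; nra.
  + by have /andP[z0 _] := zh; nra.
  + by have /andP[y0 _] := yh; nra.
  + by rewrite e'.
  + by nra.
  + by have /andP[y0 _] := yh; nra.
  + by nra.
  + move: e'; rewrite -(sqr_pos_inj z0 y0 (oppr_inj zy)) e.
    by move/(mulIf (lt0r_neq0 (sh_gt0 z0))).
- move=> [t th [-> e]] [u uh [tu e']].
  have /addrI/oppr_inj tu' := sqr_pos_inj (kh_gt0 _ th) (kh_gt0 _ uh) tu.
  by move: e'; rewrite -tu' e => /(mulIf (lt0r_neq0 (cos_h th))).
Qed.

Lemma robin_ground_state s l : robin_level 0 s l ->
  exists v dv : R -> R, [/\ forall x : R, is_derive x 1 v (dv x),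
    forall x : R, is_derive x 1 dv (- l * v x), dv 0 = 0,
    forall x, v (- x) = v x & (forall x, 0 < v x) /\ dv 1 = s * v 1].
Proof.
move=> [z z0 [-> e]]; exists (fun x => ch (z * x + 0)), (fun x => z * sh (z * x + 0)).
split=> [x|x||x|]; last split=> [x|].
- exact: (is_derive1_linear (is_derive_ch _)).
- rewrite opprK expr2 -mulrA.
  exact: (is_derive1Zl _ (is_derive1_linear (is_derive_sh _))).
- by rewrite mulr0 addr0 sh0 mulr0.
- by rewrite !addr0 mulrN chN.
- exact: ch_gt0.
- by rewrite mulr1 addr0.
Qed.

Lemma robin_first_odd s l : robin_level 1 s l ->
  exists v dv : R -> R, [/\ forall x : R, is_derive x 1 v (dv x),
    forall x : R, is_derive x 1 dv (- l * v x), v 0 = 0,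
    forall x, v (- x) = - v x &
    (forall x, 0 < x <= 1 -> 0 < v x) /\ dv 1 = s * v 1].
Proof.
move=> [[z zh [-> e]]|[-> ->]|[z z0 [-> e]]].
- exists (fun x => sin (z * x + 0)), (fun x => z * cos (z * x + 0)).
  have /andP[z0 z1] := zh; split=> [x|x||x|]; last split=> [x|].
  + exact: (is_derive1_linear (is_derive_sin _)).
  + rewrite mulNr -mulrN expr2 -mulrA.
    exact: (is_derive1Zl _ (is_derive1_linear (is_derive_cos _))).
  + by rewrite mulr0 addr0 sin0.
  + by rewrite !addr0 mulrN sinN.
  + move=> /andP[x0 x1]; apply: sin_h; rewrite addr0 mulr_gt0//=.
    by rewrite (le_lt_trans _ z1)// ler_piMr// ltW.
  + by rewrite mulr1 addr0.
- exists id, (fun=> 1); split=> [x|x||x|]; last split=> [x|]; rewrite //.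
  + exact: is_derive1_id.
  + by rewrite oppr0 mul0r; exact: is_derive_cst.
  + by move=> /andP[].
  + by rewrite mulr1.
- exists (fun x => sh (z * x + 0)), (fun x => z * ch (z * x + 0)).
  split=> [x|x||x|]; last split=> [x|].
  + exact: (is_derive1_linear (is_derive_sh _)).
  + rewrite opprK expr2 -mulrA.
    exact: (is_derive1Zl _ (is_derive1_linear (is_derive_ch _))).
  + by rewrite mulr0 addr0 sh0.
  + by rewrite !addr0 mulrN shN.
  + by move=> /andP[x0 x1]; apply: sh_gt0; rewrite addr0 mulr_gt0.
  + by rewrite mulr1 addr0.
Qed.

Let phase_decr (c t u : R) : h < c - t -> 0 < u < t -> t < h ->
  (c - u) * sin u * cos t < (c - t) * sin t * cos u.
Proof.
move=> hc /andP[u0 ut] th.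
pose w := t - u.
have wh : 0 < w < h by rewrite /w; apply/andP; split; lra.
have th' : 0 < t < h by rewrite th andbT; lra.
have uh' : 0 < u < h by rewrite u0 (lt_trans ut).
have sw := sin_h wh; have su := sin_h uh'; have st := sin_h th'.
have cw := cos_h wh; have cu := cos_h uh'; have ct := cos_h th'.
have sut : sin u < sin t.
  by rewrite ltr_sin// in_itv/=; apply/andP; split; lra.
have sct : sin u * cos t < 1 / 2.
  have := cos2Dsin2 t; move: (sin u) (sin t) (cos t) su st ct sut => a b d a0 b0 d0 ab e.
  have abd : a * d < b * d by rewrite ltr_pM2r.
  by have := sqr_ge0 (b - d); nra.
have key : w / 2 < (c - t) * sin w.
  have h1 : 1 <= h by exact: pihalf_ge1.
  have [c2|c2] := lerP (1 / 2) (cos w).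
    have wc : w * cos w < sin w.
      have dd (y : R) : is_derive y 1 (fun y : R => sin y - y * cos y) (y * sin y).
        apply: is_derive_eq (is_derive1B (is_derive_sin y)
          (is_derive1M (is_derive1_id y) (is_derive_cos y))) _.
        by ring.
      have dp (y : R) : 0 < y < w -> 0 < y * sin y.
        move=> /andP[y0 yw]; rewrite mulr_gt0// sin_h// y0 (lt_trans yw)//.
        by case/andP: wh.
      have /andP[w0 _] := wh.
      by have := ltr_of_derive w0 dd dp; rewrite sin0 mul0r subrr subr_gt0.
    have /andP[w0 _] := wh.
    have hs : sin w <= (c - t) * sin w by rewrite ler_peMl//; lra.
    by nra.
  have s2 : 1 / 2 < sin w by have := cos2Dsin2 w; nra.
  have /andP[w0 wh1] := wh.
  by nra.
have E : (c - t) * sin t * cos u - (c - u) * sin u * cos t =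
    (c - t) * sin w - w * (sin u * cos t).
  by rewrite /w sinB; ring.
rewrite -subr_gt0 E subr_gt0; apply: lt_trans key.
by have /andP[w0 _] := wh; nra.
Qed.

(** For indices 0 and 1 the eigenfunctions of equal parity are positive on (0, 1) and satisfy the
    same condition at 0, so Sturm comparison orders the parameters at the end 1. Higher
    eigenfunctions change sign; there a larger level means a smaller phase [t]. The strictness also
    shows that [s] determines the level. *)
Lemma robin_level_decr k s s' l l' :
  robin_level k s l -> robin_level k s' l' -> l < l' -> s' < s.
Proof.
case: k => [|[|k]] H H' ll.
- have [v [dv [v1 v2 v3 _ [v4 v5]]]] := robin_ground_state H.
  have [w [dw [w1 w2 w3 _ [w4 w5]]]] := robin_ground_state H'.
  have := @sturm_comparison R v dv w dw l l' v1 v2 w1 w2 (fun x _ => v4 x)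
    (fun x _ => w4 x) ll.
  rewrite v3 w3 mul0r mulr0 v5 w5 => /(_ erefl).
  rewrite mulrCA -mulrA ltr_pM2r// mulr_gt0//.
- have [v [dv [v1 v2 v3 _ [v4 v5]]]] := robin_first_odd H.
  have [w [dw [w1 w2 w3 _ [w4 w5]]]] := robin_first_odd H'.
  have v01 x : 0 < x < 1 -> 0 < v x by move=> /andP[x0 x1]; rewrite v4// x0 ltW.
  have w01 x : 0 < x < 1 -> 0 < w x by move=> /andP[x0 x1]; rewrite w4// x0 ltW.
  have := @sturm_comparison R v dv w dw l l' v1 v2 w1 w2 v01 w01 ll.
  rewrite v3 w3 mul0r mulr0 v5 w5 => /(_ erefl).
  by rewrite mulrCA -mulrA ltr_pM2r// mulr_gt0// ?v4 ?w4// ltr01 lexx.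
- move: H H' => /= [t th [el e]] [u uh [el' e']].
  have ut : u < t.
    move: ll; rewrite el el' ltr_pXn2r// ?nnegrE ?ltW ?kh_gt0//.
    by rewrite ltrD2l ltrN2.
  have /andP[u0 _] := uh; have /andP[_ t1] := th.
  have hc : h < k.+2%:R * h - t.
    by apply: le_lt_trans (kh_gt k th); rewrite ler_pMl// ler1n.
  have := phase_decr hc (introT andP (conj u0 ut)) t1.
  rewrite e e' mulrAC ltr_pM2r ?cos_h//.
  by rewrite ltr_pM2r ?cos_h.
Qed.

(** The levels of index [k] fill an open interval: below 0, below [h ^+ 2], or between consecutive
    squares [((k - 1) * h) ^+ 2] and [(k * h) ^+ 2]. For any [l'] in it, [s'] is read off from the
    boundary equation. Openness of the range is what turns monotonicity into continuity. *)
Lemma robin_level_open k s l : robin_level k s l -> exists2 e, 0 < e &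
  forall l', `|l' - l| < e -> exists2 s', 0 < s' & robin_level k s' l'.
Proof.
have ex k' l' : (exists s, robin_level k' s l') ->
    exists2 s', 0 < s' & robin_level k' s' l'.
  by move=> [s' H]; exists s' => //; exact: robin_level_gt0 H.
case: k => [|[|k]] /=.
- move=> [z z0 [-> _]]; exists (z ^+ 2); first by rewrite exprn_gt0.
  move=> l'; rewrite opprK ltr_norml => /andP[_ l'0].
  have l0 : 0 < - l' by lra.
  apply: (ex 0); exists (Num.sqrt (- l') * sh (Num.sqrt (- l')) / ch (Num.sqrt (- l'))).
  exists (Num.sqrt (- l')); first by rewrite sqrtr_gt0.
  split; first by rewrite sqr_sqrtr ?opprK// ltW.
  by rewrite divfK// gt_eqF// ch_gt0.
- move=> H.
  have lh : l < h ^+ 2.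
    case: H => [[z /andP[z0 zh] [-> _]]|[-> _]|[z z0 [-> _]]].
    + by rewrite ltr_pXn2r// ?nnegrE ltW.
    + by rewrite exprn_gt0.
    + by apply: (@lt_trans _ _ 0); rewrite ?oppr_lt0 exprn_gt0.
  exists (h ^+ 2 - l); first by rewrite subr_gt0.
  move=> l'; rewrite ltr_norml => /andP[_ l'h]; apply: (ex 1%N).
  have [l0|l0|l0] := ltgtP l' 0.
  + have l'0 : 0 < - l' by lra.
    have r0 : 0 < Num.sqrt (- l') by rewrite sqrtr_gt0.
    exists (Num.sqrt (- l') * ch (Num.sqrt (- l')) / sh (Num.sqrt (- l'))).
    apply: Or33; exists (Num.sqrt (- l')) => //.
    split; first by rewrite sqr_sqrtr ?opprK// ltW.
    by rewrite divfK// gt_eqF// sh_gt0.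
  + have rh : 0 < Num.sqrt l' < h.
      rewrite sqrtr_gt0 l0 /= -(ger0_norm (ltW h_gt0)) -sqrtr_sqr ltr_sqrt ?exprn_gt0//.
      by lra.
    exists (Num.sqrt l' * cos (Num.sqrt l') / sin (Num.sqrt l')).
    apply: Or31; exists (Num.sqrt l') => //.
    split; first by rewrite sqr_sqrtr// ltW.
    by rewrite divfK// gt_eqF// sin_h.
  + by exists 1; apply: Or32.
- move=> [t th [le _]].
  have kt := kh_gt k th; have /andP[t0 _] := th.
  have kp : 0 < k.+1%:R * h by rewrite mulr_gt0.
  pose z := k.+2%:R * h - t.
  have z0 : 0 < z by rewrite /z; lra.
  have l1 : (k.+1%:R * h) ^+ 2 < l.
    by rewrite le ltr_pXn2r// ?nnegrE ?ltW// (lt_trans kp).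
  have l2 : l < (k.+2%:R * h) ^+ 2.
    have zk : z < k.+2%:R * h by rewrite /z ltrBlDr ltrDl.
    by rewrite le ltr_pXn2r// nnegrE ltW// (lt_trans z0).
  exists (Num.min (l - (k.+1%:R * h) ^+ 2) ((k.+2%:R * h) ^+ 2 - l)).
    by rewrite lt_min !subr_gt0 l1.
  move=> l'; rewrite lt_min !ltr_norml => /andP[/andP[a1 a2] /andP[b1 b2]].
  have {a1 b2}[a1 b2] : (k.+1%:R * h) ^+ 2 < l' /\ l' < (k.+2%:R * h) ^+ 2 by split; lra.
  have l'0 : 0 < l' by rewrite (le_lt_trans _ a1)// sqr_ge0.
  have r1 : k.+1%:R * h < Num.sqrt l'.
    by rewrite -(ger0_norm (ltW kp)) -sqrtr_sqr ltr_sqrt.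
  have r2 : Num.sqrt l' < k.+2%:R * h.
    have kp2 : 0 < k.+2%:R * h by rewrite mulr_gt0.
    by rewrite -(ger0_norm (ltW kp2)) -sqrtr_sqr ltr_sqrt// exprn_gt0.
  pose u := k.+2%:R * h - Num.sqrt l'.
  have uh : 0 < u < h.
    by rewrite /u; move: r1 r2; rewrite -(natr1 k.+1) => ? ?; apply/andP; split; lra.
  apply: (ex k.+2); exists ((k.+2%:R * h - u) * sin u / cos u); exists u => //.
  split; last by rewrite divfK// gt_eqF// cos_h.
  by rewrite /u opprB addrC subrK sqr_sqrtr// ltW.
Qed.

(** Here [z = s * coth z > s]. If [z > s + 1], then [(z - s) * ch z > ch z > z], against
    [(z - s) * ch z = z * expR (- z)]. *)
Lemma robin_level0_bounds s l : robin_level 0 s l ->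
  - (s + 1) ^+ 2 <= l /\ l < - s ^+ 2.
Proof.
move=> H; have s0 := robin_level_gt0 H; case: H => [z z0 [-> e]].
have e1 : expR (- z) < 1 by rewrite -[ltRHS]expR0 ltr_expR; lra.
have e2 := expR_gt0 (- z).
have E : ch z - sh z = expR (- z) by rewrite /ch /sh; field.
have shz := sh_gt_id z0; have shc := sh_lt_ch z.
rewrite lerN2 ltrN2; split.
  suff : z <= s + 1 by move=> zs; rewrite ler_pXn2r// ?nnegrE ?ltW ?addr_gt0.
  rewrite leNgt; apply/negP => zs.
  have : (z - s) * ch z = z * expR (- z) by rewrite -E mulrBl -e; ring.
  by nra.
rewrite ltr_pXn2r// ?nnegrE ?ltW//.
by rewrite -(ltr_pM2r (ch_gt0 z)) -e ltr_pM2l.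
Qed.

(* With [z tanh z = s], the ratio [z / s = coth z] decreases. *)
Lemma robin_level0_ratio s s' l l' : robin_level 0 s l -> robin_level 0 s' l' ->
  s < s' -> l * s' ^+ 2 < l' * s ^+ 2.
Proof.
move=> H H' ss.
have s0 := robin_level_gt0 H; have s'0 := robin_level_gt0 H'.
have ll : l' < l.
  rewrite ltNge le_eqVlt; apply/negP => /predU1P[E|/(robin_level_decr H H')].
    by move: H H' ss; rewrite E => H /(robin_level_inj H) ->; rewrite ltxx.
  by move/(lt_trans ss); rewrite ltxx.
case: H => z z0 [El e]; case: H' => y y0 [El' e'].
have zy : z < y by move: ll; rewrite El El' ltrN2 ltr_pXn2r// ?nnegrE ltW.
rewrite El El' !mulNr ltrN2 -!exprMn ltr_pXn2r// ?nnegrE ?mulr_ge0 ?ltW//.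
have c0 := ch_gt0 z; have c1 := ch_gt0 y.
have q0 := sh_gt0 z0; have q1 := sh_gt0 y0.
have : 0 < sh (y - z) by rewrite sh_gt0// subr_gt0.
rewrite shB subr_gt0 => K.
rewrite -(ltr_pM2r c0) -(ltr_pM2r c1).
have -> : y * s * ch z * ch y = y * (s * ch z) * ch y by ring.
have -> : z * s' * ch z * ch y = z * (s' * ch y) * ch z by ring.
rewrite -e -e'.
have -> : y * (z * sh z) * ch y = y * z * (ch y * sh z) by ring.
have -> : z * (y * sh y) * ch z = y * z * (sh y * ch z) by ring.
by rewrite ltr_pM2l// mulr_gt0.
Qed.

Lemma robin_level1_bounds s l : robin_level 1 s l -> l < h ^+ 2.
Proof.
case=> [[z /andP[z0 zh] [-> _]]|[-> _]|[z z0 [-> _]]].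
- by rewrite ltr_pXn2r// ?nnegrE ltW.
- by rewrite exprn_gt0.
- by apply: (@lt_trans _ _ 0); rewrite ?oppr_lt0 exprn_gt0.
Qed.

Lemma robin_level_bounds k s l : robin_level k.+2 s l ->
  (k.+1%:R * h) ^+ 2 < l /\ l < (k.+2%:R * h) ^+ 2.
Proof.
move=> [t th [-> _]]; have kt := kh_gt k th; have /andP[t0 _] := th.
have kp : 0 < k.+1%:R * h by rewrite mulr_gt0.
have zk : k.+2%:R * h - t < k.+2%:R * h by rewrite ltrBlDr ltrDl.
have z0 := lt_trans kp kt.
by split; rewrite ltr_pXn2r// nnegrE ltW// (lt_trans z0).
Qed.

Lemma robin_level01 s l l' : robin_level 0 s l -> robin_level 1 s l' -> l < l'.
Proof.
move=> H; have s0 := robin_level_gt0 H; case: H => [z z0 [-> e]].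
have zN : - z ^+ 2 < 0 by rewrite oppr_lt0 exprn_gt0.
case=> [[y /andP[y0 yh] [-> _]]|[-> _]|[y y0 [-> e']]] //.
  by rewrite (lt_trans zN)// exprn_gt0.
rewrite ltrN2 ltr_pXn2r// ?nnegrE ?ltW//; apply: (@lt_trans _ _ s).
  by rewrite -(ltr_pM2r (ch_gt0 y)) e' ltr_pM2l// sh_lt_ch.
by rewrite -(ltr_pM2r (ch_gt0 z)) -e ltr_pM2l// sh_lt_ch.
Qed.

Lemma robin_level_ltS k s l l' :
  robin_level k s l -> robin_level k.+1 s l' -> l < l'.
Proof.
case: k => [|[|k]]; first exact: robin_level01.
  move=> /robin_level1_bounds lh /robin_level_bounds[]; rewrite mul1r => lh' _.
  exact: lt_trans lh'.
move=> /robin_level_bounds[_ lh] /robin_level_bounds[lh' _].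
exact: lt_trans lh'.
Qed.

(** From index 2 on, [cos (k * h - z * x)] covers both parities: its arguments at 1 and -1 are [t]
    and [k * pi - t], so both end conditions reduce to [z * sin t = s * cos t]. For indices 0 and 1
    the condition at -1 follows by parity. *)
Lemma robin_eigenfunction k s l : robin_level k s l ->
  exists v dv : R -> R, [/\ forall x : R, is_derive x 1 v (dv x),
    forall x : R, is_derive x 1 dv (- l * v x), v 1 != 0,
    dv 1 = s * v 1 & dv (- 1) = - s * v (- 1)].
Proof.
have derN (f df : R -> R) : (forall x : R, is_derive x 1 f (df x)) ->
    forall x : R, is_derive x 1 (fun y => f (- y)) (- df (- x)).
  move=> fdf x; have := @is_derive1_linear R f x (df (- x)) (-1) 0.
  rewrite mulN1r addr0 => /(_ (fdf _)); rewrite mulN1r.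
  by under eq_fun do rewrite mulN1r addr0.
case: k => [|[|k]] H.
- have [v [dv [v1 v2 _ vN [v4 v5]]]] := robin_ground_state H.
  exists v, dv; split=> //; first by rewrite gt_eqF.
  have [_ /= E2] := derN _ _ v1 1.
  have : - dv (- 1) = dv 1.
    have e : (fun y => v (- y)) = v by apply/funext.
    by rewrite -E2 e; have [_ ->] := v1 1.
  by rewrite vN v5 mulNr => <-; rewrite opprK.
- have [v [dv [v1 v2 _ vN [v4 v5]]]] := robin_first_odd H.
  exists v, dv; split=> //; first by rewrite gt_eqF// v4// ltr01 lexx.
  have [_ /= E2] := derN _ _ v1 1.
  have : - dv (- 1) = - dv 1.
    have e : (fun y => v (- y)) = (fun y => - v y) by apply/funext.
    by rewrite -E2 e; have [_ ->] := is_derive1N (v1 1).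
  by move/oppr_inj => ->; rewrite vN v5 mulrNN.
- move: H => /= [t th [-> e]].
  set z := _ - t in e *.
  exists (fun x => cos (- z * x + k.+2%:R * h)),
    (fun x => z * sin (- z * x + k.+2%:R * h)).
  have zt : - z * 1 + k.+2%:R * h = t by rewrite /z; ring.
  have zt' : - z * (- 1) + k.+2%:R * h = - t + pi *+ k.+2.
    by rewrite -mulr_natl /z; field.
  split=> [x|x|||].
  + rewrite -[z * _]mulrNN.
    exact: (is_derive1_linear (is_derive_cos _)).
  + rewrite expr2 -mulrN -mulrA.
    exact: (is_derive1Zl _ (is_derive1_linear (is_derive_sin _))).
  + by rewrite zt gt_eqF// cos_h.
  + by rewrite zt.
  + rewrite zt' (alternatingn (@sinDpi R)) (alternatingn (@cosDpi R)).
    by rewrite sinN cosN mulNr !mulrN mulrCA e; ring.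
Qed.

End RobinLevels.

(** * The Robin level as a function of the parameter *)

Section RobinEigenvalue.
Context {R : realType}.
Implicit Types (k : nat) (s l : R).

(** The default 0 is taken exactly for [s <= 0], where no level exists. *)
Definition robin_ev k s : R := xget 0 [set l | robin_level k s l].

Lemma robin_evP k s : 0 < s -> robin_level k s (robin_ev k s).
Proof.
move=> s0; have [l lP] := robin_level_exists k s0.
exact: (@xgetPex _ (0 : R) [set l | robin_level k s l] (ex_intro _ l lP)).
Qed.

Lemma robin_level_mono k s s' l l' :
  robin_level k s l -> robin_level k s' l' -> (l < l') = (s' < s).
Proof.
move=> H H'; apply/idP/idP; first exact: robin_level_decr H H'.
move=> ss; rewrite ltNge le_eqVlt; apply/negP => /predU1P[E|].
  by move: H H' ss; rewrite E => H /(robin_level_inj H) ->; rewrite ltxx.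
by move/(robin_level_decr H' H); rewrite ltNge (ltW ss).
Qed.

Lemma robin_evE k s l : robin_level k s l -> robin_ev k s = l.
Proof.
move=> H; have H' := robin_evP k (robin_level_gt0 H).
by apply/eqP; rewrite eq_le !leNgt (robin_level_mono H H') (robin_level_mono H' H) ltxx.
Qed.

Lemma robin_ev_decr k s s' : 0 < s -> s < s' -> robin_ev k s' < robin_ev k s.
Proof.
move=> s0 ss; have s'0 := lt_trans s0 ss.
by rewrite (robin_level_mono (robin_evP k s'0) (robin_evP k s0)).
Qed.

Lemma robin_ev_lt k k' s : 0 < s -> (k < k')%N -> robin_ev k s < robin_ev k' s.
Proof.
move=> s0; elim: k' => // k' IH; rewrite ltnS leq_eqVlt => /predU1P[->|/IH].
  exact: robin_level_ltS (robin_evP _ s0) (robin_evP _ s0).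
by move/lt_trans; apply; exact: robin_level_ltS (robin_evP _ s0) (robin_evP _ s0).
Qed.

(** Monotonicity traps the values: by [robin_level_open] the levels [robin_ev k s + d] and
    [robin_ev k s - d] are attained at some [s2 < s] and [s1 > s], and between these the level stays
    within [d]. *)
Lemma continuous_robin_ev k s : 0 < s -> {for s, continuous (robin_ev k)}.
Proof.
move=> s0; have H := robin_evP k s0; rewrite /prop_for /continuous_at.
apply/cvgrPdist_lt => e e0.
have [r r0 rP] := robin_level_open H.
pose d := Num.min r e / 2.
have d0 : 0 < d by rewrite divr_gt0// lt_min r0.
have [dr de] : d < r /\ d < e.
  by split; rewrite (@lt_le_trans _ _ (Num.min r e)) ?ge_min ?lexx ?orbT//;
    rewrite ltr_pdivrMr// ltr_pMr ?lt_min ?r0// ltr1n.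
have [|s1 s10 H1] := rP (robin_ev k s - d).
  by rewrite addrAC subrr sub0r normrN gtr0_norm.
have [|s2 s20 H2] := rP (robin_ev k s + d).
  by rewrite addrAC subrr add0r gtr0_norm.
have s1s : s < s1 by rewrite -(robin_level_mono H1 H) ltrBlDr ltrDl.
have s2s : s2 < s by rewrite -(robin_level_mono H H2) ltrDl.
near=> t.
have t2 : s2 < t by near: t; exact: lt_nbhsr.
have t1 : t < s1 by near: t; exact: lt_nbhsl.
have Ht := robin_evP k (lt_trans s20 t2).
have := robin_level_mono H1 Ht; have := robin_level_mono Ht H2.
rewrite t1 t2 ltr_norml => a1 a2.
by apply/andP; split; lra.
Unshelve. all: by end_near.
Qed.

Local Notation h := (pi / 2 : R).

Lemma robin_ev0_lt0 s : 0 < s -> robin_ev 0 s < 0.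
Proof.
move=> s0; have [_ /lt_trans] := robin_level0_bounds (robin_evP 0 s0).
by apply; rewrite oppr_lt0 exprn_gt0.
Qed.

Lemma robin_ev_upper k s : 0 < s -> robin_ev k s <= (k%:R * h) ^+ 2.
Proof.
move=> s0; have := robin_evP k s0; case: k => [|[|k]] H.
- by rewrite mul0r expr0n/= ltW// robin_ev0_lt0.
- by rewrite mul1r ltW// (robin_level1_bounds H).
- by have [_ /ltW] := robin_level_bounds H.
Qed.

Lemma robin_ev_lower k s : 0 < s -> (k.+1%:R * h) ^+ 2 < robin_ev k.+2 s.
Proof. by move=> s0; have [] := robin_level_bounds (robin_evP k.+2 s0). Qed.

(* As [s -> 0] the Robin levels tend to the Neumann ones. *)
Lemma robin_ev0_near0 e : 0 < e ->
  exists2 s0, 0 < s0 & forall s, 0 < s < s0 -> - e < robin_ev 0 s.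
Proof.
move=> e0; have r0 : 0 < Num.sqrt e by rewrite sqrtr_gt0.
have H : robin_level 0 (Num.sqrt e * sh (Num.sqrt e) / ch (Num.sqrt e)) (- e).
  exists (Num.sqrt e) => //; rewrite sqr_sqrtr ?ltW//.
  by rewrite divfK// gt_eqF// ch_gt0.
eexists; first exact: robin_level_gt0 H.
by move=> s /andP[s0 ss]; rewrite (robin_level_mono H (robin_evP 0 s0)).
Qed.

(** The Neumann limit [h ^+ 2] exceeds 1/4. The threshold is the parameter whose level is exactly
    the square of 1/2. *)
Lemma robin_ev1_near0 : exists2 s0, 0 < s0 & forall s, 0 < s < s0 -> 1 / 4 < robin_ev 1 s.
Proof.
have h1 : 1 <= h by exact: pihalf_ge1.
have H : robin_level 1 (1 / 2 * cos (1 / 2) / sin (1 / 2)) (1 / 4 : R).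
  have hh : 0 < (1 / 2 : R) < h by apply/andP; split; lra.
  apply: Or31; exists (1 / 2) => //; split; first by field.
  by rewrite divfK// gt_eqF// sin_gt0_pihalf.
eexists; first exact: robin_level_gt0 H.
by move=> s /andP[s0 ss]; rewrite (robin_level_mono H (robin_evP 1 s0)).
Qed.

Lemma robin_ev1_eq0 : robin_ev 1 1 = 0 :> R.
Proof. by apply: robin_evE; exact: Or32. Qed.

End RobinEigenvalue.

(** * Completeness of the Robin eigenfunctions *)

Section SegmentIntegral.
Context {R : realType}.
Implicit Types (f g F : R -> R) (x y z a : R).
Local Notation mu := (@lebesgue_measure R).

Definition seg x y f : R := \int[mu]_(t in `[x, y]) f t.

Lemma seg_integrable x y f : {within `[x, y], continuous f} ->
  mu.-integrable `[x, y] (EFin \o f).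
Proof.
by move=> cf; apply: continuous_compact_integrable => //; exact: segment_compact.
Qed.

Lemma continuous_seg_integrable x y f : continuous f ->
  mu.-integrable `[x, y] (EFin \o f).
Proof. by move=> cf; exact/seg_integrable/continuous_segment. Qed.

Lemma segD x y f g : continuous f -> continuous g ->
  seg x y (fun t => f t + g t) = seg x y f + seg x y g.
Proof. by move=> cf cg; rewrite /seg RintegralD//; exact: continuous_seg_integrable. Qed.

Lemma segB x y f g : continuous f -> continuous g ->
  seg x y (fun t => f t - g t) = seg x y f - seg x y g.
Proof. by move=> cf cg; rewrite /seg RintegralB//; exact: continuous_seg_integrable. Qed.

Lemma segZ x y f a : continuous f -> seg x y (fun t => a * f t) = a * seg x y f.
Proof. by move=> cf; rewrite /seg RintegralZl//; exact: continuous_seg_integrable. Qed.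

Lemma seg_ge0 x y f : (forall t, x <= t <= y -> 0 <= f t) -> 0 <= seg x y f.
Proof. by move=> f0; apply: Rintegral_ge0 => t; rewrite /= in_itv/= => /f0. Qed.

Lemma le_seg_within x y f g : {within `[x, y], continuous f} ->
  {within `[x, y], continuous g} ->
  (forall t, x <= t <= y -> f t <= g t) -> seg x y f <= seg x y g.
Proof.
move=> cf cg fg; by apply: le_Rintegral => //; exact: seg_integrable.
Qed.

Lemma le_seg x y f g : continuous f -> continuous g ->
  (forall t, x <= t <= y -> f t <= g t) -> seg x y f <= seg x y g.
Proof. by move=> cf cg; apply: le_seg_within; exact: continuous_segment. Qed.

Lemma continuous_bigsum n (F : 'I_n -> R -> R) :
  (forall i, continuous (F i)) -> continuous (fun t => \sum_(i < n) F i t).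
Proof.
elim: n F => [|n IH] F cF.
  by under eq_fun do rewrite big_ord0; exact: continuous_const.
under eq_fun do rewrite big_ord_recr/=.
by apply: continuous_add; [apply: IH => i; exact: cF|exact: cF].
Qed.

Lemma seg_sum x y n (F : 'I_n -> R -> R) : (forall i, continuous (F i)) ->
  seg x y (fun t => \sum_(i < n) F i t) = \sum_(i < n) seg x y (F i).
Proof.
elim: n F => [|n IH] F cF.
  rewrite big_ord0; transitivity (seg x y (fun t => 0 * t)).
    by congr seg; apply/funext => t; rewrite big_ord0 mul0r.
  by rewrite segZ ?mul0r//; exact: continuous_idfun.
rewrite big_ord_recr/= -IH//.
rewrite -segD//; last by apply: continuous_bigsum => i; exact: cF.
by congr seg; apply/funext => t; rewrite big_ord_recr.
Qed.

Lemma seg_cat x y z f : continuous f -> x <= y <= z ->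
  seg x z f = seg x y f + seg y z f.
Proof.
move=> cf /andP[xy yz].
have itf := @continuous_seg_integrable x z f cf.
have := @Rintegral_itvB R f (BLeft x) (BRight z) y itf.
rewrite !bnd_simp => /(_ xy yz)/eqP; rewrite subr_eq addrC => /eqP; rewrite /seg => ->.
congr (_ + _); rewrite Rintegral_itv_obnd_cbnd//.
apply: (integrableS _ _ _ (@continuous_seg_integrable y z f cf)) => //.
by apply: subset_itvr; rewrite bnd_simp.
Qed.

Lemma seg_cat_sum (z : nat -> R) n f : continuous f -> nondecreasing_seq z ->
  seg (z 0) (z n) f = \sum_(i < n) seg (z i) (z i.+1) f.
Proof.
move=> cf nz; elim: n => [|n IH].
  by rewrite big_ord0 /seg set_itv1 Rintegral_set1.
by rewrite big_ord_recr/= -IH -seg_cat// !nz.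
Qed.

Lemma seg_FTC x y f F : x < y ->
  (forall t : R, x <= t <= y -> is_derive t 1 F (f t)) ->
  {within `[x, y], continuous f} -> seg x y f = F y - F x.
Proof.
move=> xy Ff cf; rewrite /seg /Rintegral (@continuous_FTC2 R f F)//.
- split.
  + by move=> t; rewrite in_itv/= => /andP[? ?]; case: (Ff t) => //; rewrite !ltW.
  + apply: cvg_at_right_filter.
    by apply: (@is_derive1_continuous R F x (f x)); apply: Ff; rewrite lexx ltW.
  + apply: cvg_at_left_filter.
    by apply: (@is_derive1_continuous R F y (f y)); apply: Ff; rewrite lexx ltW.
- move=> t; rewrite in_itv/= => /andP[? ?].
  by rewrite derive1E; case: (Ff t) => //; rewrite !ltW.
Qed.

Lemma seg_FTC_continuous x y f F : x < y -> continuous f ->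
  (forall t : R, is_derive t 1 F (f t)) -> seg x y f = F y - F x.
Proof.
by move=> xy cf Ff; apply: seg_FTC => //; exact: continuous_segment.
Qed.

(** Nonvanishing is asked at the right end because that is where the Robin eigenfunctions are known
    to be nonzero; near [y] the square stays above half its end value. *)
Lemma seg_sqr_gt0 x y f : x < y -> continuous f -> f y != 0 ->
  0 < seg x y (fun t => f t * f t).
Proof.
move=> xy cf fy.
have cff := continuous_mul cf cf.
have fy0 : 0 < f y * f y by rewrite -expr2 exprn_even_gt0.
have : \forall t \near y, f y * f y / 2 < f t * f t.
  by apply: (cvgr_gt _ (cff y)); rewrite ltr_pdivrMr// ltr_pMr// ltr1n.
move=> /nbhs_ballP[e /= e0 ye].
pose w := Num.max x (y - e / 2).
have e2 : 0 < e / 2 by rewrite divr_gt0.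
have wy : w < y by rewrite gt_max xy ltrBlDr ltrDl.
have xw : x <= w by rewrite le_max lexx.
rewrite (@seg_cat x w y)//; last by rewrite xw ltW.
apply: ltr_wpDl; first by apply: seg_ge0 => t _; rewrite -expr2 sqr_ge0.
apply: (@lt_le_trans _ _ (seg w y (fun=> f y * f y / 2))).
  have dk (t : R) : is_derive t 1 (fun t => f y * f y / 2 * t) (f y * f y / 2).
    by apply: is_derive_eq (is_derive1Zl _ (is_derive1_id t)) _; rewrite mulr1.
  rewrite (seg_FTC_continuous wy (@continuous_const R _) dk).
  by rewrite -mulrBr mulr_gt0 ?subr_gt0// divr_gt0.
apply: le_seg => //; first exact: continuous_const.
move=> t /andP[wt ty]; apply/ltW/ye.
rewrite /ball/= ger0_norm ?subr_ge0//.
have : y - e / 2 <= t by rewrite (le_trans _ wt)// le_max lexx orbT.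
by lra.
Qed.

Lemma continuous_within_of x y f : (forall t, x <= t <= y -> {for t, continuous f}) ->
  {within `[x, y], continuous f}.
Proof.
move=> cf; apply: continuous_in_subspaceT => t; rewrite inE/= in_itv/=; exact: cf.
Qed.

(* Complete the square in [(f' + T f)^2] with [T = w tan (w (t - c))]. *)
Lemma wirtinger x y f df w : x < y -> 0 < w -> w * (y - x) < pi ->
  (forall t : R, is_derive t 1 f (df t)) -> continuous df -> f x = 0 -> f y = 0 ->
  w ^+ 2 * seg x y (fun t => f t * f t) <= seg x y (fun t => df t * df t).
Proof.
move=> xy w0 wxy fdf cdf fx fy.
have cf : continuous f by move=> t; exact: is_derive1_continuous (fdf t).
(* Centring the phase at the midpoint keeps it inside [(- pi / 2, pi / 2)] on the whole segment, so
   the tangent has no pole there. *)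
pose c := (x + y) / 2; pose p t := w * t + - (w * c).
have cosp t : x <= t <= y -> 0 < cos (p t).
  move=> /andP[xt ty].
  have pE : p t = w * (t - c) by rewrite /p; ring.
  have h1 : w * (t - c) <= w * ((y - x) / 2) by rewrite ler_pM2l// /c; lra.
  have h2 : w * (- ((y - x) / 2)) <= w * (t - c) by rewrite ler_pM2l// /c; lra.
  by apply: cos_gt0_pihalf; rewrite pE; apply/andP; split; nra.
pose T t := w * tan (p t); pose dT t := w ^+ 2 + T t ^+ 2.
have TdT (t : R) : x <= t <= y -> is_derive t 1 T (dT t).
  move=> /cosp ct; have ct0 : cos (p t) != 0 by rewrite gt_eqF.
  apply: is_derive_eq (is_derive1Zl w (is_derive1_linear (is_derive_tan ct0))) _.
  by rewrite cos2_tan2// /dT /T; ring.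
(* [g] is the derivative of [- T * f ^+ 2], so its integral vanishes with [f] at the ends; adding it
   to [w ^+ 2 * f ^+ 2] completes the square. *)
pose g t := - (dT t * (f t * f t) + T t * (df t * f t + f t * df t)).
have Gg (t : R) : x <= t <= y -> is_derive t 1 (fun t => - (T t * (f t * f t))) (g t).
  move=> xty; apply: is_derive1N; apply: is_derive1M; first exact: TdT.
  exact: is_derive1M (fdf t) (fdf t).
have cT t : x <= t <= y -> {for t, continuous T}.
  by move=> /TdT /is_derive1_continuous.
have cg : {within `[x, y], continuous g}.
  apply: continuous_within_of => t /cT Tt; rewrite /prop_for /continuous_at.
  apply: cvgN; apply: cvgD; apply: cvgM.
  - by apply: cvgD; [exact: cvg_cst|apply: cvgM].
  - by apply: cvgM; exact: cf.
  - exact: Tt.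
  - by apply: cvgD; apply: cvgM; [exact: cdf|exact: cf|exact: cf|exact: cdf].
have := seg_FTC xy Gg cg; rewrite fx fy !mulr0 subrr => gE.
have cff := continuous_mul cf cf.
have cdd := continuous_mul cdf cdf.
have -> : w ^+ 2 * seg x y (fun t => f t * f t) =
    seg x y (fun t => w ^+ 2 * (f t * f t) + g t).
  rewrite /seg RintegralD//.
  - rewrite -/(seg x y g) gE addr0 RintegralZl//.
    exact: continuous_seg_integrable.
  - by apply/continuous_seg_integrable/continuous_mul => //; exact: continuous_const.
  - exact: seg_integrable.
apply: le_seg_within.
- apply: continuous_within_of => t xty; apply: cvgD.
    by apply: cvgM; [exact: cvg_cst|exact: cff].
  have /cT Tt := xty; apply: cvgN; apply: cvgD; apply: cvgM.
  - by apply: cvgD; [exact: cvg_cst|apply: cvgM].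
  - by apply: cvgM; exact: cf.
  - exact: Tt.
  - by apply: cvgD; apply: cvgM; [exact: cdf|exact: cf|exact: cf|exact: cdf].
- exact: continuous_segment.
- move=> t _; rewrite -subr_ge0 /g /dT.
  rewrite (_ : _ - _ = (df t + T t * f t) ^+ 2); last by ring.
  exact: sqr_ge0.
Qed.

End SegmentIntegral.

(** A wide enough left kernel. It serves to place zeros at given nodes and, twice, to compare the
    dimension of a solution space with a number of indices. *)
Lemma null_combination (F : fieldType) (p q : nat) (A : 'I_p -> 'I_q -> F) :
  (q < p)%N -> exists v : 'I_p -> F,
    (exists i, v i != 0) /\ forall j, \sum_i v i * A i j = 0.
Proof.
move=> qp; pose M := \matrix_(i, j) A i j.
have : kermx M != 0.
  rewrite -mxrank_eq0 mxrank_ker -lt0n subn_gt0.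
  exact: leq_ltn_trans (rank_leq_col _) qp.
case/rowV0Pn => v /sub_kermxP vM v0; exists (fun i => v ord0 i); split.
  apply/existsP; apply: contraNT v0; rewrite negb_exists => /forallP vi.
  by apply/eqP/rowP => i; rewrite mxE; apply/eqP; have := vi i; rewrite negbK.
move=> j; have /rowP/(_ j) := vM; rewrite !mxE => vMj; rewrite -[RHS]vMj.
by apply: eq_bigr => i _; rewrite mxE.
Qed.

Lemma is_derive1_comb {R : realType} n (F : 'I_n -> R -> R) (c dF : 'I_n -> R) (x : R) :
  (forall i, is_derive x 1 (F i) (dF i)) ->
  is_derive x 1 (fun t => \sum_i c i * F i t) (\sum_i c i * dF i).
Proof.
move=> FdF.
have := @is_derive_sum R R R n (fun i t => c i * F i t) x 1
  (fun i => c i * dF i) (fun i => is_derive1Zl _ (FdF i)).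
by rewrite (_ : \sum_i _ = fun t => \sum_i c i * F i t)//; apply/funext => t; rewrite fct_sumE.
Qed.

(** * The Robin quadratic form and completeness in one variable *)

Section RobinCompleteness.
Context {R : realType}.
Variables (a s : R) (e de : nat -> R -> R) (lam : nat -> R).
Hypothesis a0 : 0 < a.
Hypothesis e1 : forall k (x : R), is_derive x 1 (e k) (de k x).
Hypothesis e2 : forall k (x : R), is_derive x 1 (de k) (- lam k * e k x).
Hypothesis ea : forall k, e k a != 0.
Hypothesis dea : forall k, de k a = s * e k a.
Hypothesis deNa : forall k, de k (- a) = - s * e k (- a).
Hypothesis lam_lt : forall j k, (j < k)%N -> lam j < lam k.
Hypothesis lam_ge : forall k, (k.+1%:R * (pi / 2) / a) ^+ 2 < lam k.+2.
Hypothesis lam_le : forall k, lam k.+2 < (k.+2%:R * (pi / 2) / a) ^+ 2.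

Implicit Types (f g df dg : R -> R) (k n : nat).

Let aa : - a < a.
Proof. by have := a0; lra. Qed.

Let ce k : continuous (e k).
Proof. by move=> x; exact: is_derive1_continuous (e1 k x). Qed.

Let cde k : continuous (de k).
Proof. by move=> x; exact: is_derive1_continuous (e2 k x). Qed.

Let B f g := seg (- a) a (fun t => f t * g t).

(** The form whose Euler equation is the Robin problem. For [s > 0] the boundary term enters with a
    minus sign, so [Q] is not positive and its coercivity off the first eigenfunctions has to be
    proved. *)
Let Q f df g dg := B df dg - s * (f a * g a + f (- a) * g (- a)).

Let BC f g : B f g = B g f.
Proof. by rewrite /B; congr seg; apply/funext => t; rewrite mulrC. Qed.

Let QC f df g dg : Q f df g dg = Q g dg f df.
Proof. by rewrite /Q BC ![f _ * _]mulrC. Qed.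

Let B_sum n (F : 'I_n -> R -> R) (c : 'I_n -> R) g :
  (forall i, continuous (F i)) -> continuous g ->
  B (fun t => \sum_i c i * F i t) g = \sum_i c i * B (F i) g.
Proof.
move=> cF cg; rewrite /B.
transitivity (seg (- a) a (fun t => \sum_i c i * (F i t * g t))).
  by congr seg; apply/funext => t; rewrite mulr_suml; apply: eq_bigr => i _; rewrite mulrA.
rewrite seg_sum; last first.
  by move=> i; apply: continuous_mul; [exact: continuous_const|exact: continuous_mul].
by apply: eq_bigr => i _; rewrite segZ//; exact: continuous_mul.
Qed.

Let Q_sum n (F dF : 'I_n -> R -> R) (c : 'I_n -> R) g dg :
  (forall i, continuous (dF i)) -> continuous dg ->
  Q (fun t => \sum_i c i * F i t) (fun t => \sum_i c i * dF i t) g dg =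
  \sum_i c i * Q (F i) (dF i) g dg.
Proof.
move=> cdF cdg; rewrite /Q B_sum//.
rewrite [in RHS](eq_bigr (fun i => c i * B (dF i) dg -
  s * (c i * F i a * g a + c i * F i (- a) * g (- a)))); last by move=> i _; ring.
by rewrite sumrB -mulr_sumr big_split/= -!mulr_suml.
Qed.

Let B_diag n (F : 'I_n -> R -> R) (c : 'I_n -> R) :
  (forall i, continuous (F i)) -> (forall i j, i != j -> B (F i) (F j) = 0) ->
  let f := fun t => \sum_i c i * F i t in B f f = \sum_i c i ^+ 2 * B (F i) (F i).
Proof.
move=> cF oF f.
have cf : continuous f.
  by apply: continuous_bigsum => i; apply: continuous_mul => //; exact: continuous_const.
rewrite {1}/f B_sum//; apply: eq_bigr => i _.
rewrite BC B_sum// (bigD1 i)//= big1 ?addr0 => [|j ji]; last by rewrite oF ?mulr0.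
by rewrite mulrA expr2.
Qed.

Let Q_diag n (F dF : 'I_n -> R -> R) (c : 'I_n -> R) :
  (forall i, continuous (dF i)) ->
  (forall i j, i != j -> Q (F i) (dF i) (F j) (dF j) = 0) ->
  let f := fun t => \sum_i c i * F i t in
  let df := fun t => \sum_i c i * dF i t in
  Q f df f df = \sum_i c i ^+ 2 * Q (F i) (dF i) (F i) (dF i).
Proof.
move=> cF oF f df.
have cf : continuous df.
  by apply: continuous_bigsum => i; apply: continuous_mul => //; exact: continuous_const.
rewrite {1}/f {1}/df Q_sum//; apply: eq_bigr => i _.
rewrite QC Q_sum// (bigD1 i)//= big1 ?addr0 => [|j ji]; last by rewrite oF ?mulr0.
by rewrite mulrA expr2.
Qed.

(** Integration by parts: the end conditions on [e k] cancel the boundary terms. Applied to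
    [f = e j], with the symmetry of [Q] and distinct [lam], it gives orthogonality. *)
Let Q_e f df k : (forall x : R, is_derive x 1 f (df x)) -> continuous df ->
  Q f df (e k) (de k) = lam k * B f (e k).
Proof.
move=> fdf cdf.
have cf : continuous f by move=> t; exact: is_derive1_continuous (fdf t).
have cfe := continuous_mul cf (@ce k).
have cdfe := continuous_mul cdf (@cde k).
have cl : continuous (fun t => lam k * (f t * e k t)).
  by apply: continuous_mul => //; exact: continuous_const.
have hd (t : R) : is_derive t 1 (fun t => f t * de k t)
    (df t * de k t - lam k * (f t * e k t)).
  by apply: is_derive_eq (is_derive1M (fdf t) (e2 k t)) _; ring.
have := seg_FTC_continuous aa (continuous_sub cdfe cl) hd.
rewrite segB// segZ// dea deNa /Q /B => /eqP.
by rewrite subr_eq => /eqP ->; ring.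
Qed.

Lemma robin_ortho j k : j != k -> seg (- a) a (fun t => e j t * e k t) = 0.
Proof.
move=> jk; rewrite -/(B _ _); have := Q_e k (e1 j) (@cde j).
rewrite QC Q_e// [B (e k) _]BC => /eqP; rewrite -subr_eq0 -mulrBl mulf_eq0.
case/orP => [|/eqP //]; rewrite subr_eq0.
by case: (ltngtP j k) jk => // /lam_lt; case: ltgtP.
Qed.

Lemma robin_norm_gt0 k : 0 < seg (- a) a (fun t => e k t * e k t).
Proof. exact: seg_sqr_gt0. Qed.

Let ortho j k : j != k -> B (e j) (e k) = 0.
Proof. exact: robin_ortho. Qed.

Let norm_gt0 k : 0 < B (e k) (e k).
Proof. exact: robin_norm_gt0. Qed.

Let Q_ortho j k : j != k -> Q (e j) (de j) (e k) (de k) = 0.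
Proof. by move=> jk; rewrite Q_e// /B robin_ortho ?mulr0. Qed.

(* Courant's argument: some combination of [e 0], ..., [e p.+2] and [f] vanishes
   at [p.+3] equally spaced nodes, where Wirtinger's inequality applies. *)
Let coercive p f df w : (forall x : R, is_derive x 1 f (df x)) -> continuous df ->
  (forall k, (k < p.+3)%N -> B f (e k) = 0) ->
  0 < w -> lam p.+2 < w ^+ 2 -> w < p.+2%:R * (pi / 2) / a ->
  w ^+ 2 * B f f <= Q f df f df.
Proof.
move=> fdf cdf fe w0 lw wp.
have cf : continuous f by move=> t; exact: is_derive1_continuous (fdf t).
(* The functions [e 0], ..., [e p.+2] followed by [f]: p + 4 functions against p + 3 nodes. *)
pose F (i : 'I_p.+4) := if (i < p.+3)%N then e i else f.
pose dF (i : 'I_p.+4) := if (i < p.+3)%N then de i else df.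
have FdF i (x : R) : is_derive x 1 (F i) (dF i x) by rewrite /F /dF; case: ifP.
have cdF i : continuous (dF i) by rewrite /dF; case: ifP.
have cF i : continuous (F i) by rewrite /F; case: ifP.
have i_last (i : 'I_p.+4) : (i < p.+3)%N = false -> i = ord_max.
  by move=> /negbT; rewrite -leqNgt => ip; apply/val_inj/eqP; rewrite eqn_leq ip /= -ltnS ltn_ord.
have BF i j : i != j -> B (F i) (F j) = 0.
  rewrite /F; case: ifPn => [ip|/negbTE/i_last ->]; case: ifPn => [jp|/negbTE/i_last ->].
  - by move=> ij; apply: ortho.
  - by rewrite BC fe.
  - by rewrite fe.
  - by rewrite eqxx.
have QF i j : i != j -> Q (F i) (dF i) (F j) (dF j) = 0.
  rewrite /F /dF; case: ifPn => [ip|/negbTE/i_last ->]; case: ifPn => [jp|/negbTE/i_last ->].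
  - by move=> ij; apply: Q_ortho.
  - by rewrite QC Q_e// fe ?mulr0.
  - by rewrite Q_e// fe ?mulr0.
  - by rewrite eqxx.
(* The nodes cut the interval into p + 2 pieces of length [l]; the upper bound on [w] is equivalent
   to [w * l < pi], as Wirtinger's inequality requires. *)
pose l := 2 * a / p.+2%:R.
have l0 : 0 < l by rewrite divr_gt0// mulr_gt0.
pose z (j : nat) := - a + j%:R * l.
have zn : z p.+2 = a by rewrite /z /l mulrC divfK//; ring.
have z0 : z 0 = - a by rewrite /z mul0r addr0.
have zS j : z j < z j.+1 by rewrite /z -natr1 mulrDl mul1r addrA ltrDl.
have zS' j : z j.+1 - z j = l by rewrite /z -natr1; ring.
have wl : w * l < pi.
  have -> : pi = p.+2%:R * (pi / 2) / a * l.
    have : p.+2%:R != 0 :> R by rewrite pnatr_eq0.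
    by rewrite /l; move: (p.+2%:R) => P P0; field; rewrite P0 gt_eqF.
  by rewrite ltr_pM2r.
have [c [[i0 ci0] cz]] := @null_combination R p.+4 p.+3 (fun i j => F i (z j)) (leqnn _).
pose g t := \sum_i c i * F i t; pose dg t := \sum_i c i * dF i t.
have gz j : (j < p.+3)%N -> g (z j) = 0 by move=> jp; exact: (cz (Ordinal jp)).
have gdg (x : R) : is_derive x 1 g (dg x).
  exact: is_derive1_comb.
have cdg : continuous dg.
  by apply: continuous_bigsum => i; apply: continuous_mul => //; exact: continuous_const.
have cg : continuous g.
  by apply: continuous_bigsum => i; apply: continuous_mul => //; exact: continuous_const.
(* Both ends are nodes, so the boundary term of [Q] vanishes for [g] and only the integral of
   [dg ^+ 2] is left. *)
have wg : w ^+ 2 * B g g <= Q g dg g dg.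
  rewrite /Q /B -z0 -zn !gz// !mulr0 addr0 mulr0 subr0.
  have nz : nondecreasing_seq z by apply/nondecreasing_seqP => n; exact: ltW.
  rewrite !seg_cat_sum//; [|exact: continuous_mul..].
  rewrite mulr_sumr; apply: ler_sum => j _.
  have jp : (j.+1 < p.+3)%N by rewrite ltnS ltn_ord.
  by apply: wirtinger => //; rewrite ?zS' ?gz// ltnW.
(* By orthogonality both sides are diagonal. Each [e i] contributes a multiple of
   [lam i - w ^+ 2 < 0], so the term of [f] has to be nonnegative. *)
move: wg; rewrite /g /dg Q_diag// B_diag// mulr_sumr -subr_ge0 -sumrB big_ord_recr/=.
set c1 := c ord_max.
rewrite /F /dF ltnn.
have -> : \sum_(i < p.+3) (c (widen_ord (leqnSn p.+3) i) ^+ 2 *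
     Q (if (i < p.+3)%N then e i else f) (if (i < p.+3)%N then de i else df)
       (if (i < p.+3)%N then e i else f) (if (i < p.+3)%N then de i else df) -
     w ^+ 2 * (c (widen_ord (leqnSn p.+3) i) ^+ 2 *
       B (if (i < p.+3)%N then e i else f) (if (i < p.+3)%N then e i else f))) =
   - \sum_(i < p.+3) (c (widen_ord (leqnSn p.+3) i) ^+ 2 *
        ((w ^+ 2 - lam i) * B (e i) (e i))).
  rewrite -sumrN; apply: eq_bigr => i _.
  by rewrite ltn_ord Q_e//; ring.
set S := \sum_(i < _) _.
have lamw (i : 'I_p.+3) : 0 < (w ^+ 2 - lam i) * B (e i) (e i).
  rewrite mulr_gt0// subr_gt0 (le_lt_trans _ lw)//.
  have := ltn_ord i; rewrite ltnS leq_eqVlt => /predU1P[->//|/lam_lt/ltW//].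
have S0 : 0 <= S by apply: sumr_ge0 => i _; rewrite mulr_ge0 ?sqr_ge0// ltW.
move=> H.
(* If [f] has coefficient 0, the strict signs force every other coefficient to vanish, against the
   choice of [c]. *)
have [c10|c10] := eqVneq c1 0; last first.
  have c1p : 0 < c1 ^+ 2 by rewrite exprn_even_gt0.
  by rewrite -subr_ge0 -(pmulr_rge0 _ c1p); lra.
have /eqP : S = 0 by apply/eqP; rewrite eq_le S0 andbT; move: H; rewrite c10; lra.
rewrite psumr_eq0; last by move=> i _; rewrite mulr_ge0 ?sqr_ge0// ltW.
move=> /allP cS; exfalso; move/negP: ci0; apply; apply/eqP.
have [ip|/negbTE/i_last -> //] := boolP (i0 < p.+3)%N.
have := cS (Ordinal ip) (mem_index_enum _).
rewrite mulf_eq0 (gt_eqF (lamw _)) orbF expf_eq0/= => /eqP <-.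
by congr c; apply/val_inj.
Qed.

(** The remainder [g] of the Fourier expansion is orthogonal to the first p + 3 eigenfunctions, so
    [w ^+ 2 * B g g <= Q g dg g dg] by coercivity. The right side is at most a constant independent
    of [p], while [w] grows with [p]. *)
Lemma robin_completeness f df : (forall x : R, is_derive x 1 f (df x)) ->
  continuous df -> forall eps, 0 < eps -> exists n (c : 'I_n -> R),
    seg (- a) a (fun t => (f t - \sum_(k < n) c k * e k t) ^+ 2) < eps.
Proof.
move=> fdf cdf eps eps0.
have cf : continuous f by move=> t; exact: is_derive1_continuous (fdf t).
pose c k := B f (e k) / B (e k) (e k).
have cB k : c k * B (e k) (e k) = B f (e k) by rewrite /c divfK// gt_eqF.
(* Passing from [f] to [g] subtracts terms [lam k * c k * B f (e k)], which are nonnegative for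
   [k >= 2]; the two that may be negative are absorbed into [C]. *)
pose C := `|Q f df f df| + `|lam 0 * (c 0 * B f (e 0))| + `|lam 1 * (c 1 * B f (e 1))|.
have [p pP] : exists p : nat, C < ((p.+1%:R * (pi / 2) / a) ^+ 2) * eps.
  pose y := (pi / 2) / a.
  have y0 : 0 < y by rewrite divr_gt0// divr_gt0// pi_gt0.
  have C0 : 0 <= C by rewrite !addr_ge0.
  have ye0 : 0 < y ^+ 2 * eps by apply: mulr_gt0 => //; exact: exprn_gt0.
  exists (Num.bound (C / (y ^+ 2 * eps))).
  set p := Num.bound _.
  have : C / (y ^+ 2 * eps) < p%:R.
    by apply: archi_boundP; rewrite divr_ge0// ltW.
  rewrite ltr_pdivrMr// => /lt_le_trans; apply.
  have -> : (p.+1%:R * (pi / 2) / a) ^+ 2 * eps = p.+1%:R ^+ 2 * (y ^+ 2 * eps).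
    by rewrite /y; ring.
  rewrite ler_pM2r// -natrX ler_nat (leq_trans (leqnSn p))//.
  by rewrite -{1}(expn1 p.+1) leq_pexp2l.
pose n := p.+3.
pose g t := f t - \sum_(k < n) c k * e k t.
pose dg t := df t - \sum_(k < n) c k * de k t.
have cS : continuous (fun t => \sum_(k < n) c k * e k t).
  by apply: continuous_bigsum => i; apply: continuous_mul => //; exact: continuous_const.
have cdS : continuous (fun t => \sum_(k < n) c k * de k t).
  by apply: continuous_bigsum => i; apply: continuous_mul => //; exact: continuous_const.
have gdg (x : R) : is_derive x 1 g (dg x).
  exact: is_derive1B (fdf x) (is_derive1_comb _ (fun i : 'I_n => e1 i x)).
have cg : continuous g by exact: continuous_sub.
have cdg : continuous dg by exact: continuous_sub.
have Bg h : continuous h -> B g h = B f h - \sum_(k < n) c k * B (e k) h.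
  move=> ch; rewrite -B_sum// /B -segB; [|exact: continuous_mul..].
  by congr seg; apply/funext => t; rewrite /g mulrBl.
have ge k : (k < n)%N -> B g (e k) = 0.
  move=> kn; rewrite Bg// (bigD1 (Ordinal kn))//= big1 ?addr0 ?cB ?subrr// => i ik.
  by rewrite ortho ?mulr0.
have Qg h dh : continuous dh ->
    Q g dg h dh = Q f df h dh - \sum_(k < n) c k * Q (e k) (de k) h dh.
  move=> cdh; rewrite -Q_sum// /Q.
  have -> : B dg dh = B df dh - B (fun t => \sum_(k < n) c k * de k t) dh.
    rewrite /B -segB; [|exact: continuous_mul..].
    by congr seg; apply/funext => t; rewrite /dg mulrBl.
  by rewrite /g; ring.
have QgC : Q g dg g dg <= C.
  have Z : \sum_(k < n) c k * Q (e k) (de k) g dg = 0.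
    by rewrite big1// => k _; rewrite QC Q_e// ge ?mulr0.
  rewrite Qg// Z subr0 QC Qg// (eq_bigr (fun k : 'I_n => lam k * (c k * B f (e k)))); last first.
    by move=> k _; rewrite QC Q_e//; ring.
  pose G k := lam k * (c k * B f (e k)).
  rewrite -/(G _) (eq_bigr (fun k : 'I_n => G k))// /n.
  have -> : \sum_(k < p.+3) G k = G 0 + (G 1 + \sum_(k < p.+1) G k.+2).
    by rewrite big_ord_recl; congr (_ + _); rewrite big_ord_recl; congr (_ + _).
  have : 0 <= \sum_(k < p.+1) G k.+2.
    apply: sumr_ge0 => i _; rewrite /G mulr_ge0//.
      by apply/ltW/(le_lt_trans _ (lam_ge _)); rewrite sqr_ge0.
    by rewrite -cB mulrA -expr2 mulr_ge0 ?sqr_ge0// ltW.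
  set S := \sum_(i < _) _ => S0; rewrite /C -/(G 0) -/(G 1).
  set q0 := G 0; set q1 := G 1; set q := Q _ _ _ _.
  have := ler_norm q; have := ler_norm (- q0); have := ler_norm (- q1); rewrite !normrN.
  by lra.
pose x := p.+1%:R * (pi / 2) / a; pose y := p.+2%:R * (pi / 2) / a.
have x0 : 0 < x by rewrite divr_gt0// mulr_gt0// divr_gt0// pi_gt0.
have y0 : 0 < y by rewrite divr_gt0// mulr_gt0// divr_gt0// pi_gt0.
have lx : x ^+ 2 < lam p.+2 by exact: lam_ge.
have lam0 : 0 < lam p.+2 by rewrite (lt_trans _ lx)// exprn_gt0.
have ly : Num.sqrt (lam p.+2) < y.
  by rewrite -(ger0_norm (ltW y0)) -sqrtr_sqr ltr_sqrt ?exprn_gt0//; exact: lam_le.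
(* A frequency strictly between the root of [lam p.+2] and the bound [y] set by the node spacing;
   there is room because [lam_le] is strict. *)
pose w := (Num.sqrt (lam p.+2) + y) / 2.
have r0 : 0 < Num.sqrt (lam p.+2) by rewrite sqrtr_gt0.
have lw : lam p.+2 < w ^+ 2.
  rewrite -[ltLHS]sqr_sqrtr ?(ltW lam0)// ltr_pXn2r// ?nnegrE ?(ltW r0)//.
    by rewrite /w; lra.
  by rewrite /w; lra.
have w0 : 0 < w by rewrite /w; lra.
have wy : w < y by rewrite /w; lra.
have := coercive gdg cdg ge w0 lw wy => H.
exists n, (fun k => c k).
have -> : seg (- a) a (fun t => (f t - \sum_(k < n) c k * e k t) ^+ 2) = B g g.
  by congr seg; apply/funext => t; rewrite expr2.
have w2 : x ^+ 2 < w ^+ 2 := lt_trans lx lw.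
have x2 : 0 < x ^+ 2 by rewrite exprn_gt0.
rewrite ltNge; apply/negP => eB.
have : C < C; last by rewrite ltxx.
rewrite (lt_le_trans pP)// -/x (le_trans _ QgC)// (le_trans _ H)//.
by apply: ler_pM => //; [exact: ltW|exact: ltW|exact: ltW].
Qed.

End RobinCompleteness.

(** * Robin eigenvalues on an interval of half-length a *)

Section RobinFamily.
Context {R : realType}.
Implicit Types (a s : R) (k : nat).

(** Rescaling [-a, a] to [-1, 1] multiplies the boundary parameter by [a] and the eigenvalue by
    [a ^+ 2]. *)
Definition robin_lam a s k : R := robin_ev k (a * s) / a ^+ 2.

Lemma robin_lam_lt a s j k : 0 < a -> 0 < s -> (j < k)%N ->
  robin_lam a s j < robin_lam a s k.
Proof.
move=> a0 s0 jk; rewrite /robin_lam ltr_pM2r ?invr_gt0 ?exprn_gt0//.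
by rewrite robin_ev_lt// mulr_gt0.
Qed.

Lemma robin_lam_leq a s j k : 0 < a -> 0 < s -> (j <= k)%N ->
  robin_lam a s j <= robin_lam a s k.
Proof.
by move=> a0 s0; rewrite leq_eqVlt => /predU1P[->//|/(robin_lam_lt a0 s0)/ltW].
Qed.

Lemma robin_lam_decr a s s' k : 0 < a -> 0 < s -> s < s' ->
  robin_lam a s' k < robin_lam a s k.
Proof.
move=> a0 s0 ss; rewrite /robin_lam ltr_pM2r ?invr_gt0 ?exprn_gt0//.
by rewrite robin_ev_decr ?mulr_gt0// ltr_pM2l.
Qed.

Lemma robin_lam_lower a s k : 0 < a -> 0 < s ->
  (k.+1%:R * (pi / 2) / a) ^+ 2 < robin_lam a s k.+2.
Proof.
move=> a0 s0; rewrite /robin_lam expr_div_n ltr_pM2r ?invr_gt0 ?exprn_gt0//.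
by rewrite robin_ev_lower// mulr_gt0.
Qed.

Lemma robin_lam_upper a s k : 0 < a -> 0 < s ->
  robin_lam a s k <= (k%:R * (pi / 2) / a) ^+ 2.
Proof.
move=> a0 s0; rewrite /robin_lam expr_div_n ler_pM2r ?invr_gt0 ?exprn_gt0//.
by rewrite robin_ev_upper// mulr_gt0.
Qed.

Lemma robin_lam_upper2 a s k : 0 < a -> 0 < s ->
  robin_lam a s k.+2 < (k.+2%:R * (pi / 2) / a) ^+ 2.
Proof.
move=> a0 s0; rewrite /robin_lam expr_div_n ltr_pM2r ?invr_gt0 ?exprn_gt0//.
by have [] := robin_level_bounds (robin_evP k.+2 (mulr_gt0 a0 s0)).
Qed.

Lemma robin_lam0_upper a s : 0 < a -> 0 < s -> robin_lam a s 0 < - s ^+ 2.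
Proof.
move=> a0 s0; rewrite /robin_lam ltr_pdivrMr ?exprn_gt0// mulNr -exprMn [s * a]mulrC.
by have [] := robin_level0_bounds (robin_evP 0 (mulr_gt0 a0 s0)).
Qed.

Lemma robin_lam0_lt0 a s : 0 < a -> 0 < s -> robin_lam a s 0 < 0.
Proof.
by move=> a0 s0; rewrite (lt_trans (robin_lam0_upper a0 s0))// oppr_lt0 exprn_gt0.
Qed.

Lemma robin_lam0_lower a s : 0 < a -> 0 < s ->
  - (s + a^-1) ^+ 2 <= robin_lam a s 0.
Proof.
move=> a0 s0; have [+ _] := robin_level0_bounds (robin_evP 0 (mulr_gt0 a0 s0)).
rewrite /robin_lam ler_pdivlMr ?exprn_gt0// mulNr -exprMn mulrDl mulVf ?gt_eqF//.
by rewrite [s * a]mulrC.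
Qed.

Lemma continuous_robin_lam a s k : 0 < a -> 0 < s ->
  {for s, continuous (fun s => robin_lam a s k)}.
Proof.
move=> a0 s0; apply: cvgM; last exact: cvg_cst.
apply: (@continuous_comp _ _ _ ( *%R a) (robin_ev k)).
  by apply: cvgM; [exact: cvg_cst|exact: cvg_id].
by apply: continuous_robin_ev; rewrite mulr_gt0.
Qed.

Lemma robin_family a s : 0 < a -> 0 < s -> exists e de : nat -> R -> R,
  [/\ forall k (x : R), is_derive x 1 (e k) (de k x),
      forall k (x : R), is_derive x 1 (de k) (- robin_lam a s k * e k x),
      forall k, e k a != 0, forall k, de k a = s * e k a &
      forall k, de k (- a) = - s * e k (- a)].
Proof.
move=> a0 s0.
have H k : exists vdv : (R -> R) * (R -> R),
    [/\ forall x : R, is_derive x 1 vdv.1 (vdv.2 x),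
      forall x : R, is_derive x 1 vdv.2 (- robin_lam a s k * vdv.1 x),
      vdv.1 a != 0, vdv.2 a = s * vdv.1 a & vdv.2 (- a) = - s * vdv.1 (- a)].
  have [v [dv [v1 v2 v3 v4 v5]]] := robin_eigenfunction (robin_evP k (mulr_gt0 a0 s0)).
  have aV : a^-1 * a + 0 = 1 by rewrite mulVf ?gt_eqF// addr0.
  have aNV : a^-1 * (- a) + 0 = - 1 by rewrite mulrN mulVf ?gt_eqF// addr0.
  exists (fun x => v (a^-1 * x + 0), fun x => a^-1 * dv (a^-1 * x + 0)); split=> /=.
  - by move=> x; exact: is_derive1_linear (v1 _).
  - move=> x; apply: is_derive_eq (is_derive1Zl _ (is_derive1_linear (v2 _))) _.
    by rewrite /robin_lam; field; rewrite gt_eqF.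
  - by rewrite aV.
  - by rewrite aV v4; field; rewrite gt_eqF.
  - by rewrite aNV v5; field; rewrite gt_eqF.
have [f fP] := choice H.
by exists (fun k => (f k).1), (fun k => (f k).2); split=> k; case: (fP k).
Qed.

End RobinFamily.

(** * Integration on a cuboid and the divergence theorem *)

Section RowMeasure.
Context {R : realType}.
Implicit Types (n : nat).
Local Notation mu := (@lebesgue_measure R).
Local Notation leb := (lebesgue_row R).

Lemma insertE n (i j : 'I_n.+1) (c : R) (y : 'rV[R]_n) :
  insert i c y ord0 j = oapp (y ord0) c (unlift i j).
Proof. by rewrite /insert mxE. Qed.

Lemma insert_id n (i : 'I_n.+1) (c : R) (y : 'rV[R]_n) : insert i c y ord0 i = c.
Proof. by rewrite insertE unlift_none. Qed.

Lemma insert_lift n (i : 'I_n.+1) (j : 'I_n) (c : R) (y : 'rV[R]_n) :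
  insert i c y ord0 (lift i j) = y ord0 j.
Proof. by rewrite insertE liftK. Qed.

Lemma insert_swap n (i : 'I_n.+1) (c e : R) (z : 'rV[R]_n) :
  insert (lift ord0 i) c (insert (ord0 : 'I_n.+1) e z) =
  insert (ord0 : 'I_n.+2) e (insert i c z).
Proof.
apply/rowP => j; case: (unliftP ord0 j) => [k ->|->].
  rewrite insert_lift; case: (unliftP i k) => [l ->|->].
    rewrite insert_lift (_ : lift ord0 (lift i l) = lift (lift ord0 i) (lift ord0 l)).
      by rewrite !insert_lift.
    by apply: val_inj; rewrite /= /bump; lia.
  by rewrite !insert_id.
rewrite insert_id (_ : ord0 = lift (lift ord0 i) ord0) ?insert_lift ?insert_id//.
exact: val_inj.
Qed.

Lemma measurable_insert_pair n (i : 'I_n.+1) :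
  measurable_fun setT (fun p : 'rV[R]_n * measurableTypeR R => insert i (p.2 : R) p.1).
Proof.
apply: measurable_fun_row => j.
under eq_fun do rewrite insertE.
case: unliftP => [k _|_] /=; last exact: measurable_snd.
exact: (measurableT_comp (@measurable_coord R n k) measurable_fst).
Qed.

Local Open Scope ereal_scope.

Lemma measurable_slice_integral n (i : 'I_n.+1) (f : 'rV[R]_n.+1 -> \bar R) :
  measurable_fun setT f -> (forall x, 0 <= f x) ->
  measurable_fun setT (fun y : 'rV[R]_n => \int[mu]_t f (insert i t y)).
Proof.
move=> mf f0.
apply: (@measurable_fun_fubini_tonelli_F _ _ _ _ R mu
  (fun p : 'rV[R]_n * measurableTypeR R => f (insert i (p.2 : R) p.1))) => //.
exact: measurableT_comp (measurable_insert_pair i).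
Qed.

Let tonelli_insert0 n (f : 'rV[R]_n.+1 -> \bar R) :
  measurable_fun setT f -> (forall x, 0 <= f x) ->
  \int[leb n.+1]_x f x = \int[leb n]_y \int[mu]_t f (insert (ord0 : 'I_n.+1) t y).
Proof.
move=> mf f0 /=.
pose g (p : measurableTypeR R * 'rV[R]_n) := insert (ord0 : 'I_n.+1) (p.1 : R) p.2.
have mg : measurable_fun setT g.
  apply: measurable_fun_row => j; rewrite /g.
  under eq_fun do rewrite insertE.
  case: unliftP => [k _|_] /=; last exact: measurable_fst.
  exact: (measurableT_comp (@measurable_coord R n k) measurable_snd).
transitivity (\int[pushforward (mu \x leb n) g]_x f x).
  exact: eq_measure_integral.
rewrite ge0_integral_pushforward//= fubini_tonelli2//.
exact: measurableT_comp.
Qed.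

(** The measure is built by adjoining coordinate 0, so the case of another coordinate needs an
    induction: peel off coordinate 0, use the hypothesis on the rest, and exchange the two
    one-dimensional integrals by [insert_swap]. *)
Lemma tonelli_insert n (i : 'I_n.+1) (f : 'rV[R]_n.+1 -> \bar R) :
  measurable_fun setT f -> (forall x, 0 <= f x) ->
  \int[leb n.+1]_x f x = \int[leb n]_y \int[mu]_t f (insert i t y).
Proof.
elim: n i f => [|n IH] i f mf f0; first by rewrite ord1; exact: tonelli_insert0.
case: (unliftP ord0 i) => [k ->|->]; last exact: tonelli_insert0.
rewrite (tonelli_insert0 mf f0).
rewrite (IH k (fun y => \int[mu]_t f (insert (ord0 : 'I_n.+2) t y))); last 2 first.
- exact: measurable_slice_integral.
- by move=> x; exact: integral_ge0.
rewrite [RHS]tonelli_insert0; last 2 first.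
- exact: measurable_slice_integral.
- by move=> x; exact: integral_ge0.
apply: eq_integral => z _.
pose h (p : measurableTypeR R * measurableTypeR R) :=
  f (insert (ord0 : 'I_n.+2) (p.2 : R) (insert k (p.1 : R) z)).
have mh : measurable_fun setT h.
  apply: measurableT_comp => //.
  apply: measurable_fun_row => j; rewrite /h.
  under eq_fun do rewrite insertE.
  case: unliftP => [l _|_] /=; last exact: measurable_snd.
  under eq_fun do rewrite insertE.
  case: unliftP => [m _|_] /=; first exact: measurable_cst.
  exact: measurable_fst.
have := @fubini_tonelli _ _ _ _ R mu mu h mh (fun=> f0 _).
rewrite /h /= => ->; apply: eq_integral => t _; apply: eq_integral => u _.
by rewrite insert_swap.
Qed.

End RowMeasure.

Section RowContinuity.
Context {R : realType}.
Implicit Types (n : nat).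

Let measurable_row_int_preimage n (h : 'rV[R]_n -> 'rV[int]_n) :
  (forall i z, measurable [set x | h x ord0 i = z]) ->
  forall A : set 'rV[int]_n, measurable [set x | A (h x)].
Proof.
move=> mh A.
rewrite (_ : [set x | A (h x)] =
    \bigcup_(z in A) \bigcap_(i in [set: 'I_n]) [set x | h x ord0 i = z ord0 i]).
  rewrite bigcup_mkcond; apply: countable_bigcupT_measurable => [|z].
    exact: countableP.
  case: ifP => _; last exact: measurable0.
  by apply: fin_bigcap_measurable => [|i _]; [exact: finite_finset|exact: mh].
apply/seteqP; split=> x /=.
  by move=> Ax; exists (h x).
by move=> [z Az] /= hx; rewrite (_ : h x = z)//; apply/rowP => i; exact: hx.
Qed.

(** Rows carry the product sigma-algebra. Rounding down to the lattice of mesh [1 / k.+1] gives maps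
    with countably many values and measurable fibres, and [f] is the pointwise limit of its values
    at the rounded points. *)
Lemma continuous_measurable_row n (f : 'rV[R]_n -> R) :
  continuous f -> measurable_fun [set: 'rV[R]_n] f.
Proof.
move=> cf.
pose h k (x : 'rV[R]_n) : 'rV[int]_n := \row_i Num.floor (k.+1%:R * x ord0 i).
pose q k (z : 'rV[int]_n) : 'rV[R]_n := \row_i ((z ord0 i)%:~R / k.+1%:R).
apply: (@measurable_fun_cvg _ _ _ setT (fun k x => f (q k (h k x)))) => [k|x _].
  move=> _ Y mY; rewrite setTI.
  apply: (@measurable_row_int_preimage n (h k) _ [set z | Y (f (q k z))]) => i z.
  rewrite (_ : [set x | _] = [set: 'rV[R]_n] `&`
      (fun x : 'rV[R]_n => x ord0 i : R) @^-1` `[z%:~R / k.+1%:R, (z + 1)%:~R / k.+1%:R[).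
    exact: measurable_coord.
  apply/seteqP; split=> x /=; rewrite mxE in_itv/= ler_pdivrMr ?ltr_pdivlMr//.
    by move=> <-; split=> //; rewrite ![_ * k.+1%:R]mulrC floor_itv.
  by move=> [_]; rewrite ![_ * k.+1%:R]mulrC => H; exact: floor_def.
apply: (continuous_cvg _ (cf x)).
apply/cvgrPdist_lt => e e0; near=> k.
rewrite [X in X < _]/Num.norm/= mx_normrE.
apply/bigmax_ltP; split=> // -[i j] _ /=; rewrite ord1 !mxE.
have k0 : 0 < k.+1%:R :> R by [].
have /andP[f1 f2] := @floor_itv R (k.+1%:R * x 0 j).
rewrite -(ltr_pM2l k0) -{1}(ger0_norm (ltW k0)) -normrM mulrBr.
rewrite [_ * (_ / _)]mulrC divfK ?gt_eqF//.
have : 1 < k.+1%:R * e.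
  rewrite -ltr_pdivrMr// mul1r -natr1 (@lt_le_trans _ _ k%:R)//; last by rewrite lerDl.
  near: k; exact: nbhs_infty_gtr.
move: f2; rewrite intrD => f2 ke.
by rewrite ltr_norml; apply/andP; split; lra.
Unshelve. all: by end_near.
Qed.

End RowContinuity.

(** * Integrals over cuboids *)

Section CuboidIntegral.
Context {R : realType}.
Implicit Types (n : nat).
Local Notation mu := (@lebesgue_measure R).
Local Notation leb := (lebesgue_row R).

Definition face n (i : 'I_n.+1) (b : 'I_n.+1 -> R) : 'I_n -> R := fun j => b (lift i j).

Lemma cuboid_insert n (b : 'I_n.+1 -> R) (i : 'I_n.+1) (t : R) (y : 'rV[R]_n) :
  cuboid b (insert i t y) <-> (- b i < t < b i) /\ cuboid (face i b) y.
Proof.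
split=> [H|[H1 H2] j].
  split=> [|j]; first by have := H i; rewrite insert_id.
  by have := H (lift i j); rewrite insert_lift.
case: (unliftP i j) => [k ->|->]; first by rewrite insert_lift; exact: H2.
by rewrite insert_id.
Qed.

Lemma cuboid_bounded n (b : 'I_n -> R) (f : 'rV[R]_n -> R) : continuous f ->
  exists M : R, forall x : 'rV[R]_n, (forall i, - b i <= x ord0 i <= b i) -> `|f x| <= M.
Proof.
move=> cf.
have K := @rV_compact R n (fun i => `[- b i, b i]%classic) (fun i => @segment_compact R _ _).
have cfK : {within [set v : 'rV[R]_n | forall i, `[- b i, b i]%classic (v ord0 i)], continuous f}.
  exact: continuous_subspaceT.
have /compact_bounded[M [_ MP]] := continuous_compact cfK K.
exists (M + 1) => x xb; apply: MP; first by rewrite ltrDl.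
by exists x => //= i; rewrite in_itv/=; exact: xb.
Qed.

Local Open Scope ereal_scope.

Lemma lebesgue_row_cuboid_lty n (b : 'I_n -> R) : leb n (cuboid b) < +oo.
Proof.
elim: n b => [|n IH] b; first by rewrite /= /lebesgue_zero diracE ltry.
pose g (p : measurableTypeR R * 'rV[R]_n) := insert (ord0 : 'I_n.+1) (p.1 : R) p.2.
have -> : leb n.+1 (cuboid b) =
    (mu \x leb n) (`](- b ord0)%R, b ord0[ `*` cuboid (face ord0 b)).
  rewrite /= /lebesgue_succ /pushforward; congr (product_measure1 _ _ _).
  apply/seteqP; split=> -[t y].
    by move/cuboid_insert => [H1 H2]; split=> //=; rewrite in_itv.
  by rewrite /= in_itv/= => -[H1 H2]; apply/cuboid_insert.
rewrite product_measure1E//; last exact: measurable_cuboid.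
rewrite lte_mul_pinfty ?IH//.
have E := @lebesgue_measure_itv R `](- b ord0)%R, (b ord0)[.
by rewrite [X in X \is a fin_num]E/=; case: ifP.
Qed.

Lemma continuous_cuboid_integrable n (b : 'I_n -> R) (f : 'rV[R]_n -> R) :
  continuous f -> (leb n).-integrable (cuboid b) (EFin \o f).
Proof.
move=> cf; apply: measurable_bounded_integrable.
- exact: measurable_cuboid.
- exact: lebesgue_row_cuboid_lty.
- by apply: measurable_funTS; exact: continuous_measurable_row.
- have [M MP] := cuboid_bounded b cf; exists M; split; first exact: num_real.
  move=> N MN x /= xb; apply: le_trans (ltW MN); apply: MP => i.
  by have /andP[? ?] := xb i; apply/andP; split; exact: ltW.
Qed.

(** Tonelli for indicators identifies the measure on rows with the image of a product measure under
    insertion at [i]; the signed statement is then Fubini for that product. *)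
Lemma fubini_insert n (i : 'I_n.+1) (f : 'rV[R]_n.+1 -> \bar R) :
  (leb n.+1).-integrable setT f ->
  \int[leb n.+1]_x f x = \int[leb n]_y \int[mu]_t f (insert i t y).
Proof.
move=> /integrableP[mf fi].
pose g (p : 'rV[R]_n * measurableTypeR R) := insert i (p.2 : R) p.1.
have mg : measurable_fun setT g := measurable_insert_pair i.
have E A : measurable A -> leb n.+1 A = pushforward (leb n \x mu) g A.
  move=> mA.
  have mgA : measurable (g @^-1` A) by rewrite -[X in measurable X]setTI; exact: mg.
  have -> : leb n.+1 A = \int[leb n.+1]_x (\1_A x)%:E by rewrite integral_indic// setIT.
  rewrite (tonelli_insert i (f := EFin \o \1_A)); last 2 first.
  - by apply/measurable_EFinP; exact: measurable_indic.
  - by move=> x; rewrite lee_fin.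
  have -> : pushforward (leb n \x mu) g A = \int[leb n \x mu]_x (\1_(g @^-1` A) x)%:E.
    by rewrite integral_indic// setIT.
  rewrite (fubini_tonelli1 (EFin \o \1_(g @^-1` A)))//.
    by apply/measurable_EFinP; exact: measurable_indic.
  by move=> x; rewrite lee_fin.
rewrite (eq_measure_integral (pushforward (leb n \x mu) g)); last first.
  by move=> A mA _; exact: E.
have gi : (leb n \x mu).-integrable (g @^-1` setT) (f \o g).
  rewrite preimage_setT; apply/integrableP; split; first exact: measurableT_comp.
  move: fi; rewrite (eq_measure_integral (pushforward (leb n \x mu) g)).
    by rewrite ge0_integral_pushforward//; exact: measurableT_comp.
  by move=> A mA _; exact: E.
by rewrite integral_pushforward// preimage_setT -integral12_prod_meas1.
Qed.

Local Close Scope ereal_scope.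

Lemma continuous_insert n (i : 'I_n.+1) (y : 'rV[R]_n) :
  continuous (fun t : R => insert i t y).
Proof.
move=> t; apply/cvgrPdist_lt => e e0; near=> s.
rewrite [X in X < _]/Num.norm/= mx_normrE.
apply/bigmax_ltP; split=> // -[k j] _ /=; rewrite ord1 !mxE.
case: unliftP => [l _|_] /=; first by rewrite subrr normr0.
by near: s; exact: cvgr_dist_lt.
Unshelve. all: by end_near.
Qed.

Lemma continuous_insert_row n (i : 'I_n.+1) (t : R) :
  continuous (fun y : 'rV[R]_n => insert i t y).
Proof.
move=> y; apply/(@cvgrPdist_lt R 'rV[R]_n.+1 _ (nbhs y) (nbhs_filter y)) => e e0.
apply: (@filterS _ (nbhs y) (nbhs_filter y) (ball y e)); last exact: nbhsx_ballx.
move=> z; rewrite -ball_normE /= => yz.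
rewrite [X in X < _]/Num.norm/= mx_normrE.
apply/bigmax_ltP; split=> // -[k j] _ /=; rewrite ord1 !mxE.
case: unliftP => [l _|_] /=; last by rewrite subrr normr0.
move: yz; rewrite [X in X < _]/Num.norm/= mx_normrE => /bigmax_ltP[_ /(_ (ord0, l) isT)] /=.
by rewrite !mxE.
Qed.

Lemma Rintegral_oo_seg (x y : R) (f : R -> R) : continuous f ->
  \int[mu]_(t in `]x, y[) f t = seg x y f.
Proof.
move=> cf; have itf := @continuous_seg_integrable R x y f cf.
rewrite Rintegral_itv_obnd_cbnd ?Rintegral_itv_bndo_bndc//.
  by apply: integrableS itf => //; apply: subset_itvl; rewrite bnd_simp.
by apply: integrableS itf => //; apply: subset_itv_oo_cc.
Qed.

Lemma cuboid_fubini n (b : 'I_n.+1 -> R) (i : 'I_n.+1) (f : 'rV[R]_n.+1 -> R) :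
  continuous f ->
  \int[leb n.+1]_(x in cuboid b) f x =
  \int[leb n]_(y in cuboid (face i b)) seg (- b i) (b i) (fun t => f (insert i t y)).
Proof.
move=> cf.
have fi := continuous_cuboid_integrable b cf.
have mc := measurable_cuboid b.
have mc' := measurable_cuboid (face i b).
rewrite /Rintegral; congr fine.
rewrite integral_mkcond (fubini_insert i); last first.
  by rewrite -integrable_mkcond.
rewrite [RHS]integral_mkcond; apply: eq_integral => y _.
rewrite [RHS]patchE; case: ifPn => [/set_mem yb|yb].
  have cs : continuous (fun t => f (insert i t y)).
    by move=> t; apply: (continuous_comp (continuous_insert (i:=i) (y:=y) (x:=t))); exact: cf.
  rewrite -Rintegral_oo_seg// fineK; last first.
    apply: integrable_fin_num => //.
    apply: (integrableS _ _ _ (@continuous_seg_integrable R (- b i) (b i) _ cs)) => //.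
    exact: subset_itv_oo_cc.
  rewrite [RHS]integral_mkcond; apply: eq_integral => t _.
  rewrite !patchE; congr (if _ then _ else _).
  apply/idP/idP => /set_mem.
    by move/cuboid_insert => [H _]; apply/mem_set; rewrite /= in_itv.
  by rewrite /= in_itv/= => H; apply/mem_set/cuboid_insert.
apply: integral0_eq => t _; rewrite patchE; case: ifPn => // /set_mem/cuboid_insert[_ H].
by move/negP : yb; case; exact/mem_set.
Qed.

Lemma continuous_row_prod n (phi : 'I_n -> R -> R) : (forall i, continuous (phi i)) ->
  continuous (fun x : 'rV[R]_n => \prod_i phi i (x ord0 i)).
Proof.
move=> cphi; elim: (index_enum _) => [|i s IH].
  under eq_fun do rewrite big_nil; exact: cst_continuous.
under eq_fun do rewrite big_cons.
move=> x; apply: (continuousM _ (IH x)).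
by apply: (continuous_comp (@coord_continuous R _ _ ord0 i x)); exact: cphi.
Qed.

Lemma cuboid_integral_prod n (b : 'I_n -> R) (phi : 'I_n -> R -> R) :
  (forall i, continuous (phi i)) ->
  \int[leb n]_(x in cuboid b) (\prod_i phi i (x ord0 i)) =
  \prod_i seg (- b i) (b i) (phi i).
Proof.
elim: n b phi => [|n IH] b phi cphi.
  rewrite big_ord0 /=.
  have -> : cuboid b = setT by apply/seteqP; split=> // x _ [].
  rewrite (_ : (fun x => _) = cst (1 : R)); last first.
    by apply/funext => x; rewrite big_ord0.
  rewrite Rintegral_cst// mul1r.
  have E : @lebesgue_zero R setT = 1%E by rewrite /lebesgue_zero diracE mem_setT.
  by rewrite [X in fine X]E.
rewrite (cuboid_fubini _ ord0); last exact: continuous_row_prod.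
rewrite big_ord_recl -(IH (face ord0 b))//.
rewrite -RintegralZl//; last 2 first.
- exact: measurable_cuboid.
- apply: continuous_cuboid_integrable.
  by apply: (@continuous_row_prod n (fun i => phi (lift ord0 i))) => i; exact: cphi.
apply: eq_Rintegral => y _; rewrite [RHS]mulrC -segZ//; congr seg.
apply/funext => t; rewrite big_ord_recl insert_id mulrC; congr (_ * _).
by apply: eq_bigr => i _; rewrite insert_lift.
Qed.

End CuboidIntegral.

(** * Integrals over the boundary *)

Section SurfaceIntegral.
Context {R : realType}.
Local Notation leb := (lebesgue_row R).
Local Open Scope ereal_scope.

Lemma ge0_integral_mrestr d (T : measurableType d) (m : {measure set T -> \bar R})
    (D : set T) (mD : measurable D) (f : T -> \bar R) :
  measurable_fun setT f -> (forall x, 0 <= f x) ->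
  \int[mrestr m mD]_x f x = \int[m]_(x in D) f x.
Proof.
move=> mf f0.
rewrite -(setUv D) ge0_integral_setU//; last 3 first.
- exact: measurableC.
- by rewrite setUv.
- by apply/disj_setPS; rewrite setICr.
rewrite [X in _ + X]null_set_integral ?adde0//.
- by apply: eq_measure_integral => A mA AD; rewrite /= /mrestr setIidl.
- exact: measurableC.
- exact: measurable_funTS.
- by rewrite /= /mrestr setICl measure0.
Qed.

Variables (n : nat) (b : 'I_n.+1 -> R).

Let fm (i : 'I_n.+1) (c : R) : {measure set 'rV[R]_n.+1 -> \bar R} :=
  @measure_function_pushforward__canonical__measure_function_Measure _ _ _ _ R
    (mrestr (leb n) (measurable_cuboid (face i b))) _ (@measurable_insert R n i c).

Let integral_fm i c (f : 'rV[R]_n.+1 -> \bar R) :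
  measurable_fun setT f -> (forall x, 0 <= f x) ->
  \int[fm i c]_x f x = \int[leb n]_(y in cuboid (face i b)) f (insert i c y).
Proof.
move=> mf f0; rewrite ge0_integral_pushforward//; last exact: measurable_insert.
rewrite preimage_setT ge0_integral_mrestr//.
  exact: measurableT_comp (@measurable_insert R n i c).
by move=> x; exact: f0.
Qed.

Lemma ge0_surface_integral (f : 'rV[R]_n.+1 -> \bar R) :
  measurable_fun setT f -> (forall x, 0 <= f x) ->
  \int[cuboid_surface b]_x f x =
  \sum_(i < n.+1) (\int[leb n]_(y in cuboid (face i b)) f (insert i (b i) y) +
                   \int[leb n]_(y in cuboid (face i b)) f (insert i (- b i)%R y)).
Proof.
move=> mf f0.
pose M k : {measure set 'rV[R]_n.+1 -> \bar R} :=
  measure_add (fm (inord k) (b (inord k))) (fm (inord k) (- b (inord k))%R).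
rewrite (eq_measure_integral (msum M n.+1)); last first.
  move=> A mA _; rewrite /msum/= /cuboid_surface; apply: eq_bigr => i _.
  by rewrite /M inord_val; apply/esym; exact: measure_addE.
rewrite ge0_integral_measure_sum//; apply: eq_bigr => i _.
by rewrite /M ge0_integral_measure_add// !integral_fm// inord_val.
Qed.

End SurfaceIntegral.

Section Divergence.
Context {R : realType}.
Local Notation leb := (lebesgue_row R).
Local Notation mu := (@lebesgue_measure R).

(** The surface measure is a finite sum of images of restricted Lebesgue measures, which settles
    nonnegative functions; the signed case splits into positive and negative parts. The boolean [e]
    selects the face of [x_i = (-1) ^+ e * b i]. *)
Lemma surface_integral n (b : 'I_n.+1 -> R) (f : 'rV[R]_n.+1 -> R) :
  measurable_fun setT f ->
  (forall i (e : bool), (leb n).-integrable (cuboid (face i b))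
     (fun y => (f (insert i ((-1) ^+ e * b i) y))%:E)) ->
  (cuboid_surface b).-integrable setT (EFin \o f) /\
  \int[cuboid_surface b]_x f x =
  \sum_(i < n.+1) (\int[leb n]_(y in cuboid (face i b)) f (insert i (b i) y) +
                   \int[leb n]_(y in cuboid (face i b)) f (insert i (- b i) y)).
Proof.
move=> mf fi.
have mef : measurable_fun setT (EFin \o f) by exact/measurable_EFinP.
have mc j := measurable_cuboid (face j b).
have int1 i : (leb n).-integrable (cuboid (face i b)) ((EFin \o f) \o insert i (b i)).
  by have := fi i false; rewrite expr0 mul1r.
have int2 i : (leb n).-integrable (cuboid (face i b)) ((EFin \o f) \o insert i (- b i)).
  by have := fi i true; rewrite expr1 mulN1r.
have fin1 i : (\int[leb n]_(y in cuboid (face i b)) ((EFin \o f)^\+ (insert i (b i) y)) \is a fin_num)%E.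
  by have := integrable_fin_num (mc i) (integrable_funepos (mc i) (int1 i)); rewrite funepos_comp.
have fin2 i : (\int[leb n]_(y in cuboid (face i b)) ((EFin \o f)^\+ (insert i (- b i)%R y)) \is a fin_num)%E.
  by have := integrable_fin_num (mc i) (integrable_funepos (mc i) (int2 i)); rewrite funepos_comp.
have fin3 i : (\int[leb n]_(y in cuboid (face i b)) ((EFin \o f)^\- (insert i (b i) y)) \is a fin_num)%E.
  by have := integrable_fin_num (mc i) (integrable_funeneg (mc i) (int1 i)); rewrite funeneg_comp.
have fin4 i : (\int[leb n]_(y in cuboid (face i b)) ((EFin \o f)^\- (insert i (- b i)%R y)) \is a fin_num)%E.
  by have := integrable_fin_num (mc i) (integrable_funeneg (mc i) (int2 i)); rewrite funeneg_comp.
split.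
  apply/integrableP; split => //.
  rewrite ge0_surface_integral//; last exact: measurableT_comp.
  apply: lte_sum_pinfty => i _; apply: lte_add_pinfty.
    by have /integrableP[] := int1 i.
  by have /integrableP[] := int2 i.
rewrite /Rintegral integralE.
rewrite ge0_surface_integral//; last exact: measurable_funepos.
rewrite ge0_surface_integral//; last exact: measurable_funeneg.
rewrite fineB; last 2 first.
- by apply/sum_fin_numP => i _ _; rewrite fin_numD fin1 fin2.
- by apply/sum_fin_numP => i _ _; rewrite fin_numD fin3 fin4.
rewrite -!sum_fine; last 2 first.
- by move=> i _; rewrite fin_numD fin3 fin4.
- by move=> i _; rewrite fin_numD fin1 fin2.
rewrite -sumrB; apply: eq_bigr => i _.
have E c : (\int[leb n]_(y in cuboid (face i b)) (f (insert i c y))%:E =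
    \int[leb n]_(y in cuboid (face i b)) ((EFin \o f)^\+ (insert i c y)) -
    \int[leb n]_(y in cuboid (face i b)) ((EFin \o f)^\- (insert i c y)))%E.
  rewrite integralE (_ : (fun y => (f (insert i c y))%:E) = (EFin \o f) \o insert i c)//.
  by rewrite funepos_comp funeneg_comp.
rewrite !E (fineB (fin1 i) (fin3 i)) (fineB (fin2 i) (fin4 i)).
rewrite (fineD (fin1 i) (fin2 i)) (fineD (fin3 i) (fin4 i)).
by rewrite opprD addrACA.
Qed.

Lemma is_derive_insert n (i : 'I_n.+1) (F : 'rV[R]_n.+1 -> R) (t : R) (y : 'rV[R]_n) :
  derivable F (insert i t y) (delta_mx ord0 i) ->
  is_derive t 1 (fun t => F (insert i t y)) (partial i F (insert i t y)).
Proof.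
have E (s : R) : insert i (s *: (1 : R) + t) y = s *: delta_mx ord0 i + insert i t y.
  apply/rowP => j; rewrite !mxE eqxx /=; case: unliftP => [k ->|->] /=.
    by rewrite (_ : lift i k == i = false) ?mulr0 ?add0r//; apply/negbTE; rewrite eq_sym neq_lift.
  by rewrite eqxx.
have Ef : (fun s : R => s^-1 *: (F (s *: delta_mx ord0 i + insert i t y) - F (insert i t y))) =
    (fun s : R => s^-1 *: (F (insert i (s *: (1 : R) + t) y) - F (insert i t y))).
  by apply/funext => s; rewrite E.
rewrite /derivable /partial /derive /= Ef => H.
by split.
Qed.

Lemma continuous_slice n (i : 'I_n.+1) (F : 'rV[R]_n.+1 -> R) (y : 'rV[R]_n) :
  continuous F -> continuous (fun t => F (insert i t y)).
Proof.
move=> cF t; apply: (continuous_comp (continuous_insert (i:=i) (y:=y) (x:=t))).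
exact: cF.
Qed.

Lemma continuous_face n (i : 'I_n.+1) (F : 'rV[R]_n.+1 -> R) (t : R) :
  continuous F -> continuous (fun y : 'rV[R]_n => F (insert i t y)).
Proof.
move=> cF y; apply: (continuous_comp (continuous_insert_row (i:=i) (t:=t) (x:=y))).
exact: cF.
Qed.

Variables (n : nat) (b : 'I_n.+1 -> R).
Hypothesis b0 : forall i, 0 < b i.

Lemma measurable_cuboid_normal i :
  measurable_fun setT (fun x : 'rV[R]_n.+1 => normal (cuboid_domain b) x ord0 i).
Proof.
have -> : (fun x : 'rV[R]_n.+1 => normal (cuboid_domain b) x ord0 i) =
    (fun t : R => \1_[set b i] t - \1_[set - b i] t) \o (fun x : 'rV[R]_n.+1 => x ord0 i).
  apply/funext => x /=; rewrite mxE !indicE eqr_norml ltW// andbT.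
  have [->|xb] := eqVneq (x ord0 i) (b i).
    rewrite gtr0_sg// mem_set// memNset ?subr0//= => /eqP.
    by rewrite -addr_eq0 gt_eqF// addr_gt0.
  have [->|xNb] := eqVneq (x ord0 i) (- b i).
    rewrite ltr0_sg ?oppr_lt0// memNset ?mem_set ?sub0r//= => /eqP.
    by rewrite eq_sym -addr_eq0 gt_eqF// addr_gt0.
  by rewrite !memNset ?subr0// => /eqP; rewrite ?(negbTE xb) ?(negbTE xNb).
apply: measurableT_comp (measurable_coord i).
by apply: measurable_funB; apply: measurable_indic.
Qed.

(** On an open face the other coordinates are strictly inside their ranges, so the components of the
    normal along them vanish. *)
Lemma cuboid_normal_face i j (y : 'rV[R]_n) (e : bool) : cuboid (face j b) y ->
  normal (cuboid_domain b) (insert j ((-1) ^+ e * b j) y) ord0 i = (i == j)%:R * (-1) ^+ e.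
Proof.
move=> yb; rewrite mxE; case: (unliftP j i) => [k ->|->].
  rewrite insert_lift (_ : lift j k == j = false) ?mul0r; last first.
    by apply/negbTE; rewrite eq_sym neq_lift.
  have /andP[y1 y2] := yb k.
  by rewrite lt_eqF// ltr_norml y1.
rewrite insert_id eqxx mul1r normrM normr_sign mul1r gtr0_norm// eqxx.
rewrite sgrM [Num.sg (b j)]gtr0_sg// mulr1; case: e {yb};
  by rewrite ?expr0 ?expr1 ?sgr1 ?sgrN1.
Qed.

Lemma divergence_faces (F : 'rV[R]_n.+1 -> R) (i : 'I_n.+1) : class_C 1 setT F ->
  \int[leb n.+1]_(x in cuboid b) partial i F x =
  \int[leb n]_(y in cuboid (face i b)) F (insert i (b i) y) -
  \int[leb n]_(y in cuboid (face i b)) F (insert i (- b i) y).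
Proof.
move=> [cF /(_ i)[dF [cdF _]]].
have {}cF : continuous F by move=> x; exact: cF.
have {}cdF : continuous (partial i F) by move=> x; exact: cdF.
have ci j t := continuous_cuboid_integrable (face j b) (@continuous_face n j F t cF).
rewrite -RintegralB//; last exact: measurable_cuboid.
rewrite (cuboid_fubini b i cdF); apply: eq_Rintegral => y _.
apply: (@seg_FTC_continuous R _ _ _ (fun t => F (insert i t y))).
- by rewrite gtrN.
- exact: continuous_slice.
- by move=> t; apply: is_derive_insert; exact: dF.
Qed.

(** Only the two faces of index [i] carry a normal with nonzero [i]-th component, and its sign is
    the one appearing in [divergence_faces]. *)
Theorem divergence (F : 'rV[R]_n.+1 -> R) (i : 'I_n.+1) : class_C 1 setT F ->
  \int[leb n.+1]_(x in cuboid b) partial i F x =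
  \int[cuboid_surface b]_x (F x * normal (cuboid_domain b) x ord0 i).
Proof.
move=> CF; have cF : continuous F by case: CF => cF _ x; exact: cF.
have mF : measurable_fun setT (fun x => F x * normal (cuboid_domain b) x ord0 i).
  apply: measurable_funM; first exact: continuous_measurable_row.
  exact: measurable_cuboid_normal.
have pM j : b j = (-1) ^+ false * b j by rewrite expr0 mul1r.
have nM j : - b j = (-1) ^+ true * b j by rewrite expr1 mulN1r.
have mc j := measurable_cuboid (face j b).
have ci j t := continuous_cuboid_integrable (face j b) (@continuous_face n j F t cF).
have NF j (e : bool) y : cuboid (face j b) y ->
    F (insert j ((-1) ^+ e * b j) y) *
      normal (cuboid_domain b) (insert j ((-1) ^+ e * b j) y) ord0 i =
    (i == j)%:R * (-1) ^+ e * F (insert j ((-1) ^+ e * b j) y).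
  by move=> yb; rewrite cuboid_normal_face// mulrC.
have Ni j (e : bool) : (leb n).-integrable (cuboid (face j b))
    (fun y => (F (insert j ((-1) ^+ e * b j) y) *
      normal (cuboid_domain b) (insert j ((-1) ^+ e * b j) y) ord0 i)%:E).
  apply: (@eq_integrable _ _ _ _ _ (mc j)
    (EFin \o (fun y => (i == j)%:R * (-1) ^+ e * F (insert j ((-1) ^+ e * b j) y)))).
    by move=> y /set_mem yb /=; rewrite NF.
  apply: continuous_cuboid_integrable => y.
  apply: (continuousM _ (@continuous_face n j F ((-1) ^+ e * b j) cF y)).
  exact: cst_continuous.
have [_ ->] := surface_integral mF Ni.
have IN j (e : bool) : \int[leb n]_(y in cuboid (face j b))
      (F (insert j ((-1) ^+ e * b j) y) *
       normal (cuboid_domain b) (insert j ((-1) ^+ e * b j) y) ord0 i) =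
    (i == j)%:R * (-1) ^+ e *
      \int[leb n]_(y in cuboid (face j b)) F (insert j ((-1) ^+ e * b j) y).
  rewrite -RintegralZl//.
  by apply: eq_Rintegral => y /set_mem yb; rewrite NF.
rewrite (bigD1 i)// big1 ?addr0 => [|j ji]; last first.
  have ij : (i == j) = false by rewrite eq_sym (negbTE ji).
  have := IN j false; have := IN j true; rewrite -pM -nM ij !mul0r => -> ->.
  by rewrite addr0.
have := IN i false; rewrite -pM eqxx !mul1r => ->.
have := IN i true; rewrite -nM eqxx mul1r mulN1r => ->.
by rewrite [RHS]addr0; apply: divergence_faces.
Qed.

End Divergence.

(** * Products of Robin eigenfunctions *)

Section SquareIntegrable.
Context d (T : measurableType d) {R : realType} (m : {measure set T -> \bar R}) (D : set T).
Hypothesis mD : measurable D.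

Lemma square_integrable_mul (f g : T -> R) :
  square_integrable m D f -> square_integrable m D g ->
  m.-integrable D (EFin \o (fun x => f x * g x)).
Proof.
move=> [mf f2] [mg g2].
apply: (le_integrable mD _ _ (integrableD mD f2 g2)).
  by apply/measurable_EFinP; apply: measurable_funM.
move=> x _; rewrite /= lee_fin [leRHS]ger0_norm ?addr_ge0 ?sqr_ge0//.
rewrite normrM -(real_normK (num_real (f x))) -(real_normK (num_real (g x))).
have := sqr_ge0 (`|f x| - `|g x|); have := normr_ge0 (f x); have := normr_ge0 (g x).
by nra.
Qed.

(** A form of Cauchy-Schwarz: integrate [|f g| <= e * f ^+ 2 + e^-1 * g ^+ 2]. The last term is at
    most [e] by the bound on [g], whence the [+ 1]. *)
Lemma square_integrable_pairing (f g : T -> R) (e : R) : 0 < e ->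
  square_integrable m D f -> square_integrable m D g ->
  \int[m]_(x in D) (g x ^+ 2) <= e ^+ 2 ->
  `|\int[m]_(x in D) (f x * g x)| <= e * (\int[m]_(x in D) (f x ^+ 2) + 1).
Proof.
move=> e0 Lf Lg ge; have fg := square_integrable_mul Lf Lg.
case: Lf Lg => mf f2 [mg g2].
apply: (le_trans (le_normr_Rintegral mD fg)).
have f2e : m.-integrable D (EFin \o (fun x => e * f x ^+ 2)).
  by have := integrableZl mD e f2.
have g2e : m.-integrable D (EFin \o (fun x => e^-1 * g x ^+ 2)).
  by have := integrableZl mD e^-1 g2.
apply: (@le_trans _ _ (\int[m]_(x in D) (e * f x ^+ 2 + e^-1 * g x ^+ 2))).
  apply: le_Rintegral => //.
  - exact: (integrable_abse fg).
  - by have := integrableD mD f2e g2e.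
  - move=> x _; rewrite normrM -(real_normK (num_real (f x))) -(real_normK (num_real (g x))).
    have := sqr_ge0 (e * `|f x| - `|g x|).
    have := normr_ge0 (f x); have := normr_ge0 (g x).
    move: (`|f x|) (`|g x|) => u v v0 u0 H.
    rewrite -(ler_pM2l e0) mulrDr !mulrA divff ?gt_eqF// mul1r.
    by nra.
rewrite RintegralD// !RintegralZl// mulrDr mulr1 lerD2l.
by rewrite mulrC ler_pdivrMr// -expr2.
Qed.

End SquareIntegrable.

Section ClassC.
Context {R : realType} (n : nat).
Implicit Types (D : set 'rV[R]_n) (u v : 'rV[R]_n -> R).

Lemma partialM u v (i : 'I_n) x :
  derivable u x (delta_mx ord0 i) -> derivable v x (delta_mx ord0 i) ->
  partial i (fun x => u x * v x) x = partial i u x * v x + u x * partial i v x.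
Proof.
move=> du dv.
have [_ E] := @is_deriveM R 'rV[R]_n u v x _ _ _ (derivableP du) (derivableP dv).
by rewrite /partial; etransitivity; [exact: E|rewrite addrC /GRing.scale/= mulrC].
Qed.

Lemma class_C1M u v : class_C 1 setT u -> class_C 1 setT v ->
  class_C 1 setT (fun x => u x * v x).
Proof.
move=> [cu Du] [cv Dv]; split=> [x _|i].
  by apply: continuousM; [exact: cu|exact: cv].
have [du [cdu _]] := Du i; have [dv [cdv _]] := Dv i.
split=> [x _|]; first by apply: derivableM; [exact: du|exact: dv].
split; last by [].
move=> x _.
have -> : partial i (fun x => u x * v x) =
    (fun x => partial i u x * v x) \+ (fun x => u x * partial i v x).
  by apply/funext => y; rewrite partialM//; [exact: du|exact: dv].
apply: continuousD; apply: continuousM.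
- exact: cdu.
- exact: cv.
- exact: cu.
- exact: cdv.
Qed.

Lemma class_C1_continuous u : class_C 1 setT u -> continuous u.
Proof. by move=> [cu _] x; exact: cu. Qed.

Lemma class_C1_partial u i : class_C 1 setT u ->
  (forall x, derivable u x (delta_mx ord0 i)) /\ continuous (partial i u).
Proof.
by move=> [_ /(_ i)[du [cdu _]]]; split=> x; [exact: du|exact: cdu].
Qed.

End ClassC.

Section ProductFunctions.
Context {R : realType} (n : nat).
Implicit Types (x : 'rV[R]_n.+1) (m : 'I_n.+1 -> nat).

Lemma is_derive_of_slice (i : 'I_n.+1) (F : 'rV[R]_n.+1 -> R) (t l : R) (y : 'rV[R]_n) :
  is_derive t 1 (fun t => F (insert i t y)) l ->
  is_derive (insert i t y) (delta_mx ord0 i) F l.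
Proof.
have E (s : R) : insert i (s *: (1 : R) + t) y = s *: delta_mx ord0 i + insert i t y.
  apply/rowP => j; rewrite !mxE eqxx /=; case: unliftP => [k ->|->] /=.
    by rewrite (_ : lift i k == i = false) ?mulr0 ?add0r//; apply/negbTE; rewrite eq_sym neq_lift.
  by rewrite eqxx.
have Ef : (fun s : R => s^-1 *: (F (s *: delta_mx ord0 i + insert i t y) - F (insert i t y))) =
    (fun s : R => s^-1 *: (F (insert i (s *: (1 : R) + t) y) - F (insert i t y))).
  by apply/funext => s; rewrite E.
case; rewrite /derivable /derive /= -Ef => H1 H2.
by split.
Qed.

Lemma insert_split (i : 'I_n.+1) x : insert i (x ord0 i) (\row_j x ord0 (lift i j)) = x.
Proof.
apply/rowP => j; case: (unliftP i j) => [k ->|->]; last by rewrite insert_id.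
by rewrite insert_lift mxE.
Qed.

Lemma is_derive_row_prod (phi : 'I_n.+1 -> R -> R) (i : 'I_n.+1) (l : R) x :
  is_derive (x ord0 i) 1 (phi i) l ->
  is_derive x (delta_mx ord0 i) (fun x => \prod_j phi j (x ord0 j))
    (l * \prod_(j < n.+1 | j != i) phi j (x ord0 j)).
Proof.
move=> dphi; rewrite -[X in is_derive X](insert_split i).
apply: is_derive_of_slice.
have -> : (fun t => \prod_j phi j (insert i t (\row_j x ord0 (lift i j)) ord0 j)) =
    (fun t => phi i t * \prod_(j < n.+1 | j != i) phi j (x ord0 j)).
  apply/funext => t; rewrite (bigD1 i)//= insert_id; congr (_ * _).
  apply: eq_bigr => j ji; case: (unliftP i j) ji => [k ->|->]; last by rewrite eqxx.
  by rewrite insert_lift mxE.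
by apply: is_derive_eq (is_derive1M dphi (is_derive_cst _ _ _)) _; rewrite mulr0 addr0.
Qed.

(* [J i k] is the [k]-th derivative of a smooth function of the [i]-th coordinate,
   and [jet_prod m] a partial derivative of the product of these functions. *)
Variable J : 'I_n.+1 -> nat -> R -> R.
Hypothesis dJ : forall i k (t : R), is_derive t 1 (J i k) (J i k.+1 t).

Definition jet_prod m x : R := \prod_i J i (m i) (x ord0 i).

Lemma continuous_jet i k : continuous (J i k).
Proof. by move=> t; exact: is_derive1_continuous (dJ i k t). Qed.

Lemma continuous_jet_prod m : continuous (jet_prod m).
Proof.
by apply: (@continuous_row_prod R n.+1 (fun i => J i (m i))) => i; exact: continuous_jet.
Qed.

Lemma is_derive_jet_prod m i x :
  is_derive x (delta_mx ord0 i) (jet_prod m) (jet_prod (fun j => (m j + (j == i))%N) x).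
Proof.
apply: is_derive_eq (@is_derive_row_prod (fun j => J j (m j)) i _ x (dJ i (m i) (x ord0 i))) _.
rewrite /jet_prod [RHS](bigD1 i)//= eqxx addn1; congr (_ * _).
by apply: eq_bigr => j /negbTE ji; rewrite ji addn0.
Qed.

Lemma partial_jet_prod m i :
  partial i (jet_prod m) = jet_prod (fun j => (m j + (j == i))%N).
Proof. by apply/funext => x; case: (is_derive_jet_prod m i x). Qed.

Lemma class_C_jet_prod k D m : class_C k D (jet_prod m).
Proof.
elim: k m => [|k IH] m; split=> //; try by move=> x _; exact: continuous_jet_prod.
move=> i; split; first by move=> x _; case: (is_derive_jet_prod m i x).
by rewrite partial_jet_prod.
Qed.

End ProductFunctions.

Section EigenJet.
Context {R : realType}.
Variables (e de : R -> R) (lam : R).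
Hypothesis e1 : forall t : R, is_derive t 1 e (de t).
Hypothesis e2 : forall t : R, is_derive t 1 de (- lam * e t).

(** The [k]-th derivative of a solution of [e'' = - lam e]: every second derivative brings out a
    factor [- lam]. *)
Definition eigen_jet k (t : R) : R := (- lam) ^+ k./2 * (if odd k then de t else e t).

Lemma is_derive_eigen_jet k (t : R) : is_derive t 1 (eigen_jet k) (eigen_jet k.+1 t).
Proof.
rewrite /eigen_jet /= uphalf_half; case: (odd k) => /=.
  apply: is_derive_eq (is_derive1Zl _ (e2 t)) _.
  by rewrite add1n exprS; ring.
by rewrite add0n; exact: is_derive1Zl.
Qed.

Lemma eigen_jet0 : eigen_jet 0 = e.
Proof. by apply/funext => t; rewrite /eigen_jet expr0 mul1r. Qed.

Lemma eigen_jet1 : eigen_jet 1 = de.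
Proof. by apply/funext => t; rewrite /eigen_jet expr0 mul1r. Qed.

Lemma eigen_jet2 t : eigen_jet 2 t = - lam * e t.
Proof. by rewrite /eigen_jet expr1. Qed.

End EigenJet.

Lemma integrable_bigsum d (T : measurableType d) {R : realType}
    (m : {measure set T -> \bar R}) (D : set T) (mD : measurable D)
    (k : nat) (F : 'I_k -> T -> R) :
  (forall i, m.-integrable D (EFin \o F i)) ->
  m.-integrable D (EFin \o (fun x => \sum_i F i x)) /\
  \int[m]_(x in D) (\sum_i F i x) = \sum_i \int[m]_(x in D) F i x.
Proof.
elim: k F => [|k IH] F Fi.
  rewrite big_ord0; split.
    rewrite (_ : EFin \o _ = cst 0%E); first exact: integrable0.
    by apply/funext => x /=; rewrite big_ord0.
  rewrite /Rintegral (_ : (fun x => _) = cst 0%E) ?integral0//.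
  by apply/funext => x /=; rewrite big_ord0.
have [I1 I2] := IH _ (fun i => Fi (widen_ord (leqnSn k) i)).
have E : (fun x => \sum_i F i x) =
    (fun x => \sum_(i < k) F (widen_ord (leqnSn k) i) x + F ord_max x).
  by apply/funext => x; rewrite big_ord_recr.
rewrite E; split.
  by have := integrableD mD I1 (Fi ord_max).
by rewrite RintegralD// big_ord_recr/= I2.
Qed.

Section ContinuousL2.
Context {R : realType} (n : nat) (b : 'I_n.+1 -> R).
Implicit Types (f : 'rV[R]_n.+1 -> R).

Lemma continuous_surface_integral f : continuous f ->
  (cuboid_surface b).-integrable setT (EFin \o f) /\
  \int[cuboid_surface b]_x f x =
  \sum_(i < n.+1)
    (\int[lebesgue_row R n]_(y in cuboid (face i b)) f (insert i (b i) y) +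
     \int[lebesgue_row R n]_(y in cuboid (face i b)) f (insert i (- b i) y)).
Proof.
move=> cf; apply: surface_integral; first exact: continuous_measurable_row.
by move=> i e; apply: continuous_cuboid_integrable; exact: continuous_face.
Qed.

Lemma continuous_scale (c : R) f : continuous f -> continuous (fun x => c * f x).
Proof.
move=> cf x.
exact: (@continuousM R 'rV[R]_n.+1 (fun=> c) f x (@cst_continuous _ _ c x) (cf x)).
Qed.

Lemma continuous_sqr f : continuous f -> continuous (fun x => f x ^+ 2).
Proof. by move=> cf x; apply: (continuousM (cf x) (cf x)). Qed.

Lemma continuous_cuboid_L2 f : continuous f ->
  square_integrable (lebesgue_row R n.+1) (cuboid b) f.
Proof.
move=> cf; split.
  by apply: measurable_funTS; exact: continuous_measurable_row.
exact: continuous_cuboid_integrable (continuous_sqr cf).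
Qed.

Lemma continuous_surface_L2 f : continuous f ->
  square_integrable (cuboid_surface b) setT f.
Proof.
move=> cf; split; first exact: continuous_measurable_row.
by have [] := continuous_surface_integral (continuous_sqr cf).
Qed.

End ContinuousL2.

Section ProductSolution.
Context {R : realType} (n : nat) (b : 'I_n.+1 -> R).
Hypothesis b0 : forall i, 0 < b i.
Variables (sigma : R) (J : 'I_n.+1 -> nat -> R -> R) (lam : 'I_n.+1 -> R).
Hypothesis dJ : forall i k (t : R), is_derive t 1 (J i k) (J i k.+1 t).
Hypothesis J2 : forall i t, J i 2 t = - lam i * J i 0 t.
Hypothesis Jb : forall i, J i 1 (b i) = sigma * J i 0 (b i).
Hypothesis JNb : forall i, J i 1 (- b i) = - sigma * J i 0 (- b i).

Local Notation u := (jet_prod J (fun=> 0%N)).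

Lemma laplacian_jet_prod x :
  \sum_i partial i (partial i u) x = - (\sum_i lam i) * u x.
Proof.
rewrite -sumrN mulr_suml; apply: eq_bigr => i _.
rewrite !partial_jet_prod// /jet_prod (bigD1 i)//= [in RHS](bigD1 i)//= eqxx J2.
rewrite -mulrA; congr (_ * (_ * _)); apply: eq_bigr => j /negbTE ji.
by rewrite ji.
Qed.

Lemma partial_jet_face i y : partial i u (insert i (b i) y) = sigma * u (insert i (b i) y).
Proof.
rewrite partial_jet_prod// /jet_prod (bigD1 i)//= [in RHS](bigD1 i)//= eqxx insert_id Jb.
rewrite -mulrA; congr (_ * (_ * _)); apply: eq_bigr => j /negbTE ji.
by rewrite ji.
Qed.

Lemma partial_jet_faceN i y :
  partial i u (insert i (- b i) y) = - sigma * u (insert i (- b i) y).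
Proof.
rewrite partial_jet_prod// /jet_prod (bigD1 i)//= [in RHS](bigD1 i)//= eqxx insert_id JNb.
rewrite -mulrA; congr (_ * (_ * _)); apply: eq_bigr => j /negbTE ji.
by rewrite ji.
Qed.

Let cu : continuous u.
Proof. exact: continuous_jet_prod. Qed.

Lemma product_is_trace : is_trace (cuboid_domain b) u u.
Proof.
split; first exact: continuous_surface_L2.
move=> v Cv i.
have Cu : class_C 1 setT u by exact: class_C_jet_prod.
rewrite -(divergence b0 i (class_C1M Cu Cv)); apply: eq_Rintegral => x _.
rewrite partialM//; last by have [H _] := class_C1_partial i Cv; exact: H.
by case: (is_derive_jet_prod dJ (fun=> 0%N) i x).
Qed.

(** Sum the divergence formulas for the fields [partial i u * v]. The Laplacian term drops out
    because the [lam i] add up to 0, and on each face the outward derivative is [sigma * u] by the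
    Robin condition. *)
Lemma product_is_normal_derivative : \sum_i lam i = 0 ->
  is_normal_derivative (cuboid_domain b) u (fun x => sigma * u x).
Proof.
move=> lam0.
have csu : continuous (fun x => sigma * u x).
  exact: continuous_scale.
split; first exact: continuous_surface_L2.
move=> v Cv; have cv := class_C1_continuous Cv.
have Cdu i : class_C 1 setT (partial i u).
  by rewrite (partial_jet_prod dJ); exact: class_C_jet_prod.
have cF i : continuous (partial i (fun x => partial i u x * v x)).
  by have [] := class_C1_partial i (class_C1M (Cdu i) Cv).
have mc := measurable_cuboid b.
have cuv : continuous (fun x => sigma * u x * v x).
  by move=> x; exact: (continuousM (csu x) (cv x)).
have [_ ->] := continuous_surface_integral b cuv.
have [_] := integrable_bigsum mc (fun i => continuous_cuboid_integrable b (cF i)).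
have -> : \int[lebesgue_row R n.+1]_(x in cuboid b)
      (\sum_i partial i (fun x => partial i u x * v x) x) =
    \int[lebesgue_row R n.+1]_(x in cuboid b) (\sum_i partial i u x * partial i v x).
  apply: eq_Rintegral => x _.
  transitivity (\sum_i (partial i (partial i u) x * v x + partial i u x * partial i v x)).
    apply: eq_bigr => i _; rewrite partialM//.
      by have [H _] := class_C1_partial i (Cdu i); exact: H.
    by have [H _] := class_C1_partial i Cv; exact: H.
  by rewrite big_split/= -mulr_suml laplacian_jet_prod lam0 oppr0 !mul0r add0r.
move=> ->; apply: eq_bigr => i _.
rewrite (divergence_faces b0 i (class_C1M (Cdu i) Cv)).
have mf := measurable_cuboid (face i b).
have cPv := class_C1_continuous (class_C1M (Cdu i) Cv).
rewrite -[X in _ - X]mul1r -mulNr -RintegralZl//; last first.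
  exact: continuous_cuboid_integrable (@continuous_face R n i _ (- b i) cPv).
congr (_ + _); apply: eq_Rintegral => y _.
  by rewrite partial_jet_face.
by rewrite partial_jet_faceN; ring.
Qed.

Lemma product_steklov_solution : \sum_i lam i = 0 ->
  steklov_solution (cuboid_domain b) sigma u.
Proof.
move=> lam0; split.
- split; first exact: class_C_jet_prod.
  by move=> x _; rewrite laplacian_jet_prod lam0 oppr0 mul0r.
- split; first exact: continuous_cuboid_L2.
  move=> i; apply: continuous_cuboid_L2; rewrite partial_jet_prod//.
  exact: continuous_jet_prod.
- exists u, (fun x => sigma * u x); split.
  + exact: product_is_trace.
  + exact: product_is_normal_derivative.
  + exact: aeW.
Qed.

End ProductSolution.

(** * Orthogonality, density and multiplicities *)

Lemma eq_Rintegral_ae d (T : measurableType d) {R : realType}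
    (m : {measure set T -> \bar R}) (f g : T -> R) :
  measurable_fun setT f -> measurable_fun setT g ->
  {ae m, forall x, f x = g x} -> \int[m]_x f x = \int[m]_x g x.
Proof.
move=> mf mg fg; rewrite /Rintegral; congr fine.
apply: ae_eq_integral => //; try exact/measurable_EFinP.
by apply: filterS fg => x /= -> _.
Qed.

Section Orthogonality.
Context {R : realType} (n : nat) (b : 'I_n.+1 -> R).
Hypothesis b0 : forall i, 0 < b i.

Lemma surface_null (A : set 'rV[R]_n.+1) :
  (forall i (e : bool) y, cuboid (face i b) y -> ~ A (insert i ((-1) ^+ e * b i) y)) ->
  cuboid_surface b A = 0%E.
Proof.
move=> NA; rewrite /cuboid_surface big1// => i _.
have F0 (e : bool) : face_measure b i ((-1) ^+ e * b i) A = 0%E.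
  rewrite /face_measure /pushforward /mrestr.
  rewrite (_ : _ `&` _ = set0) ?measure0//; apply/seteqP; split=> // y [Ay yb].
  by have := NA i e y yb; apply.
by have := F0 false; have := F0 true; rewrite expr0 expr1 mul1r mulN1r => -> ->; rewrite adde0.
Qed.

Variables (sigma : R) (J : 'I_n.+1 -> nat -> R -> R) (lam : 'I_n.+1 -> R).
Hypothesis dJ : forall i k (t : R), is_derive t 1 (J i k) (J i k.+1 t).
Hypothesis J2 : forall i t, J i 2 t = - lam i * J i 0 t.
Hypothesis Jb : forall i, J i 1 (b i) = sigma * J i 0 (b i).
Hypothesis JNb : forall i, J i 1 (- b i) = - sigma * J i 0 (- b i).

Local Notation u := (jet_prod J (fun=> 0%N)).
Local Notation N x i := (normal (cuboid_domain b) x ord0 i).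

Let cu : continuous u.
Proof. exact: continuous_jet_prod. Qed.

Let Cdu i : class_C 1 setT (partial i u).
Proof. by rewrite (partial_jet_prod dJ); exact: class_C_jet_prod. Qed.

Let cdu i : continuous (partial i u).
Proof. exact: class_C1_continuous (Cdu i). Qed.

Let cddu i : continuous (partial i (partial i u)).
Proof. by have [] := class_C1_partial i (Cdu i). Qed.

Let mduN i : measurable_fun setT (fun x => partial i u x * N x i).
Proof.
apply: measurable_funM; first exact: continuous_measurable_row.
exact: measurable_cuboid_normal.
Qed.

Let msum : measurable_fun setT (fun x => \sum_i partial i u x * N x i).
Proof. by apply: measurable_sum => i; exact: mduN. Qed.

(** On an open face one term of the sum survives and the Robin condition applies. On the edges the
    sum may take another value, but they are null by [surface_null]. *)
Let normal_derivative_ae :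
  {ae cuboid_surface b, forall x, \sum_i partial i u x * N x i = sigma * u x}.
Proof.
have mh : measurable_fun setT (fun x => \sum_i partial i u x * N x i - sigma * u x).
  apply: measurable_funB => //.
  by apply: continuous_measurable_row; exact: continuous_scale.
exists ((fun x => \sum_i partial i u x * N x i - sigma * u x) @^-1` ~` [set 0]); split.
- by rewrite -[X in measurable X]setTI; apply: mh => //; exact: measurableC.
- apply: surface_null => i e y yb /=; apply.
  rewrite (bigD1 i)//= big1 => [|j ji].
    have := cuboid_normal_face b0 i e yb; rewrite /= eqxx mul1r => ->.
    rewrite addr0; case: e; rewrite ?expr0 ?expr1 ?mul1r ?mulN1r.
      by rewrite (partial_jet_faceN dJ JNb); ring.
    by rewrite (partial_jet_face dJ Jb); ring.
  have := cuboid_normal_face b0 j e yb; rewrite /= (negbTE ji) mul0r => ->.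
  by rewrite mulr0.
- by move=> x /=; apply: contra_not => /eqP; rewrite subr_eq0 => /eqP.
Qed.

(** The trace formula of [w] tested with the [partial i u] and summed gives [sigma] times the
    boundary integral of [f * u]; the normal derivative formula tested with [u] gives the same
    number. Subtracting leaves the integral of [w] times the Laplacian of [u], which is
    [- \sum_i lam i] times [u]. *)
Lemma steklov_orthogonal w : steklov_solution (cuboid_domain b) sigma w ->
  (\sum_i lam i) * \int[lebesgue_row R n.+1]_(x in cuboid b) (w x * u x) = 0.
Proof.
move=> [_ [Lw Ldw] [f [g [[Lf ftr] [Lg gnd] gf]]]].
have mc := measurable_cuboid b.
have Cu : class_C 1 setT u by exact: class_C_jet_prod.
have iS h k : square_integrable (cuboid_surface b) setT h -> continuous k ->
    (cuboid_surface b).-integrable setT (EFin \o (fun x => h x * k x)).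
  by move=> Lh ck; apply: square_integrable_mul => //; exact: continuous_surface_L2.
have iD h k : square_integrable (lebesgue_row R n.+1) (cuboid b) h -> continuous k ->
    (lebesgue_row R n.+1).-integrable (cuboid b) (EFin \o (fun x => h x * k x)).
  by move=> Lh ck; apply: square_integrable_mul => //; exact: continuous_cuboid_L2.
have mf : measurable_fun setT f by case: Lf.
have mg : measurable_fun setT g by case: Lg.
have mu' : measurable_fun setT u by exact: continuous_measurable_row.
have Eg : \int[cuboid_surface b]_x (g x * u x) =
    \int[cuboid_surface b]_x (sigma * f x * u x).
  apply: eq_Rintegral_ae; [exact: measurable_funM|by do 2?apply: measurable_funM|].
  by apply: filterS gf => x ->.
have Ef : \int[cuboid_surface b]_x (f x * \sum_i partial i u x * N x i) =
    \int[cuboid_surface b]_x (sigma * f x * u x).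
  apply: eq_Rintegral_ae; [exact: measurable_funM|by do 2?apply: measurable_funM|].
  by apply: filterS normal_derivative_ae => x ->; rewrite mulrA [f x * _]mulrC.
have iN i : (cuboid_surface b).-integrable setT
    (EFin \o (fun x => f x * partial i u x * N x i)).
  apply: (le_integrable measurableT _ _ (iS f (partial i u) Lf (@cdu i))).
    apply/measurable_EFinP; apply: measurable_funM; last exact: measurable_cuboid_normal.
    by apply: measurable_funM => //; exact: continuous_measurable_row.
  move=> x _; rewrite /= lee_fin normrM ler_piMr// mxE.
  by case: ifP => _; rewrite ?normr0 ?ler01// normr_sg; case: (_ != 0); rewrite ?ler01 ?lexx.
have [_ SN] := integrable_bigsum measurableT iN.
have iB i : (lebesgue_row R n.+1).-integrable (cuboid b)
    (EFin \o (fun x => partial i w x * partial i u x + w x * partial i (partial i u) x)).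
  by have := integrableD mc (iD _ _ (Ldw i) (@cdu i)) (iD _ _ Lw (@cddu i)).
have [_ SB] := integrable_bigsum mc iB.
have : \int[lebesgue_row R n.+1]_(x in cuboid b)
    (\sum_i (partial i w x * partial i u x + w x * partial i (partial i u) x)) =
    \int[cuboid_surface b]_x (f x * \sum_i partial i u x * N x i).
  transitivity (\int[cuboid_surface b]_x (\sum_i f x * partial i u x * N x i)).
    by rewrite SB SN; apply: eq_bigr => i _; exact: (ftr _ (Cdu i) i).
  by apply: eq_Rintegral => x _; rewrite mulr_sumr; apply: eq_bigr => i _; rewrite mulrA.
rewrite Ef -Eg -(gnd u Cu).
have iA i : (lebesgue_row R n.+1).-integrable (cuboid b)
    (EFin \o (fun x => partial i w x * partial i u x)) := iD _ _ (Ldw i) (@cdu i).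
have [IA _] := integrable_bigsum mc iA.
have iwu := iD _ _ Lw cu.
have iL : (lebesgue_row R n.+1).-integrable (cuboid b)
    (EFin \o (fun x => - (\sum_i lam i) * (w x * u x))).
  by have := integrableZl mc (- (\sum_i lam i)) iwu.
have -> : \int[lebesgue_row R n.+1]_(x in cuboid b)
    (\sum_i (partial i w x * partial i u x + w x * partial i (partial i u) x)) =
  \int[lebesgue_row R n.+1]_(x in cuboid b)
    ((\sum_i partial i w x * partial i u x) + - (\sum_i lam i) * (w x * u x)).
  apply: eq_Rintegral => x _; rewrite big_split/=; congr (_ + _).
  by rewrite -mulr_sumr (laplacian_jet_prod dJ J2); ring.
rewrite RintegralD// RintegralZl// => /eqP; rewrite addrC -subr_eq0 addrK.
by rewrite mulNr oppr_eq0 => /eqP.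
Qed.

End Orthogonality.

(** * Bump functions of class C^1 *)

Section Bump.
Context {R : realType}.

(** The squared tent is half of [q * |q| + q * q] for a quadratic polynomial [q], so the C^1
    regularity of the bump rests on that of [t * |t|]. *)
Let is_derive_mul_norm (x : R) : is_derive x 1 (fun t : R => t * `|t|) (2 * `|x|).
Proof.
have [->|x0] := eqVneq x 0.
  rewrite normr0 mulr0; apply/is_derive1_caratheodory; exists (fun t => `|t|); split.
  - by move=> z; rewrite mul0r !subr0 mulrC.
  - by rewrite /continuous_at; exact: norm_continuous.
  - by rewrite normr0.
have [xp|xn|] := ltrgtP x 0; last by move/eqP; rewrite (negbTE x0).
- apply: (@near_eq_is_derive R R R (fun t => - (t * t))).
    near=> t; have t0 : t < 0 by near: t; exact: lt_nbhsl.
    by rewrite ltr0_norm// mulrN.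
  apply: is_derive_eq (is_derive1N (is_derive1M (is_derive1_id x) (is_derive1_id x))) _.
  by rewrite ltr0_norm//; ring.
- apply: (@near_eq_is_derive R R R (fun t => t * t)).
    near=> t; have t0 : 0 < t by near: t; exact: lt_nbhsr.
    by rewrite gtr0_norm.
  apply: is_derive_eq (is_derive1M (is_derive1_id x) (is_derive1_id x)) _.
  by rewrite gtr0_norm//; ring.
Unshelve. all: by end_near.
Qed.

Variables c r : R.

(* [tent ^+ 2] is the C^1 bump function used to test the vanishing of a function. *)
Definition tent (t : R) : R := Num.max 0 (r ^+ 2 - (t - c) ^+ 2).

Lemma tent_gt0 t : 0 < r -> tent t != 0 -> `|c - t| < r.
Proof.
move=> r0; rewrite /tent; have [q0 _|q0] := ltP 0 (r ^+ 2 - (t - c) ^+ 2); last by rewrite eqxx.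
rewrite -(ger0_norm (ltW r0)) -ltr_sqr ?nnegrE// !real_normK ?num_real//.
by rewrite -subr_gt0 -(sqrrN (c - t)) opprB.
Qed.

Let q (t : R) := r ^+ 2 - (t - c) ^+ 2.

Let tent_sqrE t : tent t * tent t = 2^-1 * (q t * `|q t| + q t * q t).
Proof.
rewrite /tent -/(q t); case: ltP => [q0|q0]; first by rewrite gtr0_norm//; field.
by rewrite ler0_norm//; ring.
Qed.

Lemma continuous_tent : continuous tent.
Proof.
have -> : tent = fun t => 2^-1 * (q t + `|q t|).
  apply/funext => t; rewrite /tent -/(q t); case: ltP => [q0|q0].
    by rewrite gtr0_norm//; field.
  by rewrite ler0_norm//; ring.
have cq : continuous q.
  apply: continuous_sub; first exact: continuous_const.
  apply: continuous_mul; (apply: continuous_sub; [exact: continuous_idfun|exact: continuous_const]).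
apply: continuous_mul; first exact: continuous_const.
apply: continuous_add => // t.
by apply: (continuous_comp (cq t)); exact: norm_continuous.
Qed.

Lemma bump_C1 : exists db : R -> R,
  (forall t : R, is_derive t 1 (fun t => tent t * tent t) (db t)) /\ continuous db.
Proof.
have dq (t : R) : is_derive t 1 q (- (2 * (t - c))).
  have h := is_derive1B (is_derive1_id t) (is_derive_cst c t (1 : R)).
  apply: is_derive_eq (is_derive1B (is_derive_cst (r ^+ 2) t (1 : R)) (is_derive1M h h)) _.
  by rewrite /cst; ring.
have cq : continuous q by move=> t; exact: is_derive1_continuous (dq t).
have caq : continuous (fun t => `|q t|).
  by move=> t; apply: (continuous_comp (cq t)); exact: norm_continuous.
exists (fun t => 2^-1 *
  (2 * `|q t| * - (2 * (t - c)) + (- (2 * (t - c)) * q t + q t * - (2 * (t - c))))).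
split=> [t|].
  have -> : (fun t => tent t * tent t) = (fun t => 2^-1 * (q t * `|q t| + q t * q t)).
    by apply/funext => s; exact: tent_sqrE.
  apply: is_derive1Zl; apply: is_derive1D; last exact: is_derive1M.
  exact: (@is_derive1_comp R (fun t => t * `|t|) q t _ _ (is_derive_mul_norm (q t)) (dq t)).
have cl : continuous (fun t => - (2 * (t - c))).
  move=> t; apply: cvgN; apply: cvgM; first exact: cvg_cst.
  by apply: cvgB; [exact: cvg_id|exact: cvg_cst].
apply: continuous_mul; first exact: continuous_const.
apply: continuous_add.
  by apply: continuous_mul => //; apply: continuous_mul => //; exact: continuous_const.
by apply: continuous_add; exact: continuous_mul.
Qed.

End Bump.

(** * From one variable to several *)

Section Density.
Context {R : realType} (n : nat) (b : 'I_n.+1 -> R) (sigma : R).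
Hypotheses (b0 : forall i, 0 < b i) (sigma0 : 0 < sigma).
Variables (e de : 'I_n.+1 -> nat -> R -> R).
Hypothesis e1 : forall i k (t : R), is_derive t 1 (e i k) (de i k t).
Hypothesis e2 : forall i k (t : R),
  is_derive t 1 (de i k) (- robin_lam (b i) sigma k * e i k t).
Hypothesis eb : forall i k, e i k (b i) != 0.
Hypothesis deb : forall i k, de i k (b i) = sigma * e i k (b i).
Hypothesis deNb : forall i k, de i k (- b i) = - sigma * e i k (- b i).

Lemma robin_lam_completeness i (f df : R -> R) :
  (forall t : R, is_derive t 1 f (df t)) -> continuous df ->
  forall eps, 0 < eps -> exists p (c : 'I_p -> R),
    seg (- b i) (b i) (fun t => (f t - \sum_(k < p) c k * e i k t) ^+ 2) < eps.
Proof.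
apply: (@robin_completeness R (b i) sigma (e i) (de i) (robin_lam (b i) sigma)) => //.
- by move=> j k jk; exact: robin_lam_lt.
- by move=> k; exact: robin_lam_lower.
- by move=> k; exact: robin_lam_upper2.
Qed.

Lemma robin_lam_ortho i j k : j != k ->
  seg (- b i) (b i) (fun t => e i j t * e i k t) = 0.
Proof.
apply: (@robin_ortho R (b i) sigma (e i) (de i) (robin_lam (b i) sigma)) => //.
by move=> p q pq; exact: robin_lam_lt.
Qed.

Lemma robin_lam_norm_gt0 i k : 0 < seg (- b i) (b i) (fun t => e i k t * e i k t).
Proof. exact: (@robin_norm_gt0 R (b i) (e i) (de i)). Qed.

Let ce i k : continuous (e i k).
Proof. by move=> t; exact: is_derive1_continuous (e1 i k t). Qed.

Variable w : 'rV[R]_n.+1 -> R.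
Hypothesis Lw : square_integrable (lebesgue_row R n.+1) (cuboid b) w.
Hypothesis w_e : forall k : 'I_n.+1 -> nat,
  \int[lebesgue_row R n.+1]_(x in cuboid b) (w x * \prod_i e i (k i) (x ord0 i)) = 0.

Let I (h : 'I_n.+1 -> R -> R) : R :=
  \int[lebesgue_row R n.+1]_(x in cuboid b) (w x * \prod_i h i (x ord0 i)).

Let upd (h : 'I_n.+1 -> R -> R) i0 g i := if i == i0 then g else h i.

Let updE h i0 g x :
  \prod_i upd h i0 g i (x i) = g (x i0) * \prod_(i < n.+1 | i != i0) h i (x i).
Proof.
rewrite (bigD1 i0)//= /upd eqxx; congr (_ * _).
by apply: eq_bigr => i /negbTE ->.
Qed.

Implicit Types (h : 'I_n.+1 -> R -> R).

Let wI h : (forall i, continuous (h i)) ->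
  (lebesgue_row R n.+1).-integrable (cuboid b)
    (EFin \o (fun x => w x * \prod_i h i (x ord0 i))).
Proof.
move=> ch; apply: square_integrable_mul => //; first exact: measurable_cuboid.
by apply: continuous_cuboid_L2; exact: continuous_row_prod.
Qed.

(** By linearity in one factor: if the expansion terms [f k] in coordinate [i0] integrate to 0
    against [w], that factor may be replaced by the remainder [g]. *)
Let replace_coord h i0 (g : R -> R) p (c : 'I_p -> R) (f : 'I_p -> R -> R) :
  (forall i, continuous (h i)) -> continuous g -> (forall k, continuous (f k)) ->
  (forall k, I (upd h i0 (f k)) = 0) ->
  h i0 = (fun t => g t + \sum_(k < p) c k * f k t) -> I h = I (upd h i0 g).
Proof.
move=> ch cg cf If hE.
have cu g' : continuous g' -> forall i, continuous (upd h i0 g' i).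
  by move=> cg' i; rewrite /upd; case: ifP.
have mc := measurable_cuboid b.
have iF k : (lebesgue_row R n.+1).-integrable (cuboid b)
    (EFin \o (fun x => c k * (w x * \prod_i upd h i0 (f k) i (x ord0 i)))).
  by have := integrableZl mc (c k) (wI (cu _ (cf k))).
have [iS IS] := integrable_bigsum mc iF.
transitivity (\int[lebesgue_row R n.+1]_(x in cuboid b)
   (w x * \prod_i upd h i0 g i (x ord0 i) +
    \sum_k c k * (w x * \prod_i upd h i0 (f k) i (x ord0 i)))).
  apply: eq_Rintegral => x _; rewrite (updE h i0 g (x ord0)).
  rewrite (bigD1 i0)//= hE.
  set P := \prod_(_ < _ | _) _.
  rewrite mulrDl mulrDr; congr (_ + _); rewrite mulr_suml mulr_sumr.
  by apply: eq_bigr => k _; rewrite (updE h i0 (f k) (x ord0)) -/P; ring.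
rewrite RintegralD//; last exact: wI (cu _ cg).
rewrite IS big1 ?addr0// => k _.
rewrite RintegralZl//; last exact: wI (cu _ (cf k)).
by have := If k; rewrite /I => ->; rewrite mulr0.
Qed.

(** In one coordinate an arbitrary C^1 factor is a combination of eigenfunctions up to a small
    remainder in L^2. The eigenfunctions contribute nothing by induction, and the remainder makes
    the integral arbitrarily small. *)
Lemma orthogonal_C1 (h dh : 'I_n.+1 -> R -> R) :
  (forall i (t : R), is_derive t 1 (h i) (dh i t)) -> (forall i, continuous (dh i)) ->
  \int[lebesgue_row R n.+1]_(x in cuboid b) (w x * \prod_i h i (x ord0 i)) = 0.
Proof.
move=> hdh cdh; rewrite -/(I h).
(* The factors [e i (k i)] are replaced by the [h i] one coordinate at a time. *)
suff H s : forall h dh, (forall i (t : R), is_derive t 1 (h i) (dh i t)) ->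
    (forall i, continuous (dh i)) ->
    (forall i : 'I_n.+1, (s <= i)%N -> exists k, h i = e i k) -> I h = 0.
  by apply: (H n.+1 h dh) => // i; rewrite leqNgt ltn_ord.
elim: s => [|s IH] {hdh cdh}h {}dh hdh cdh he.
  have /choice[k hk] : forall i, exists k, h i = e i k by move=> i; exact: he.
  by rewrite -[RHS](w_e k) /I; apply: eq_Rintegral => x _; under eq_bigr do rewrite hk.
have [ns|sn] := leqP n.+1 s.
  by apply: (IH h dh) => // i si; have := ltn_ord i; rewrite ltnNge (leq_trans ns si).
pose i0 := Ordinal sn.
have ch i : continuous (h i) by move=> t; exact: is_derive1_continuous (hdh i t).
have Ie k : I (upd h i0 (e i0 k)) = 0.
  apply: (IH _ (upd dh i0 (de i0 k))).
  - by move=> i t; rewrite /upd; case: eqP => [_|_].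
  - move=> i; rewrite /upd; case: eqP => [_|_] //.
    by move=> t; exact: is_derive1_continuous (e2 i0 k t).
  - move=> i si; rewrite /upd; case: eqP => [->|/eqP ii]; first by exists k.
    by apply: he; rewrite ltn_neqAle si andbT eq_sym.
(* [C] is the product of the squared norms of the other factors. A remainder of squared norm below
   [d ^+ 2 / (C + 1)] makes the whole product have squared norm at most [d ^+ 2], and the pairing
   bound then gives [d * W = eps]. *)
pose C := \prod_(i < n.+1 | i != i0) seg (- b i) (b i) (fun t => h i t ^+ 2).
have C0 : 0 <= C by apply: prodr_ge0 => i _; apply: seg_ge0 => t _; exact: sqr_ge0.
pose W := \int[lebesgue_row R n.+1]_(x in cuboid b) (w x ^+ 2) + 1.
have W0 : 0 < W.
  by rewrite ltr_wpDl// Rintegral_ge0// => x _; exact: sqr_ge0.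
apply/eqP; rewrite -normr_le0; apply/ler_addgt0Pr => eps eps0; rewrite add0r.
pose d := eps / W; have d0 : 0 < d by rewrite divr_gt0.
have D0 : 0 < d ^+ 2 / (C + 1) by rewrite divr_gt0 ?exprn_gt0// ltr_wpDl.
have [p [c pc]] := robin_lam_completeness i0 (hdh i0) (cdh i0) D0.
pose g t := h i0 t - \sum_(k < p) c k * e i0 k t.
have cg : continuous g.
  apply: continuous_sub => //; apply: continuous_bigsum => k.
  by apply: continuous_mul => //; exact: continuous_const.
rewrite (@replace_coord h i0 g p c (fun k => e i0 k))//; last first.
  by apply/funext => t; rewrite /g subrK.
have cu i : continuous (upd h i0 g i) by rewrite /upd; case: ifP.
have -> : eps = d * W by rewrite divfK// gt_eqF.
apply: square_integrable_pairing => //; first exact: measurable_cuboid.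
  by apply: continuous_cuboid_L2; exact: continuous_row_prod.
have -> : \int[lebesgue_row R n.+1]_(x in cuboid b)
    ((\prod_i upd h i0 g i (x ord0 i)) ^+ 2) =
    \int[lebesgue_row R n.+1]_(x in cuboid b)
    (\prod_i (fun t => upd h i0 g i t ^+ 2) (x ord0 i)).
  by apply: eq_Rintegral => x _; rewrite -prodrXl.
rewrite (@cuboid_integral_prod R n.+1 b (fun i t => upd h i0 g i t ^+ 2)); last first.
  by move=> i; exact: continuous_mul.
rewrite (bigD1 i0)//= /upd eqxx.
have -> : \prod_(i < n.+1 | i != i0) seg (- b i) (b i)
    (fun t => (if i == i0 then g else h i) t ^+ 2) = C.
  by apply: eq_bigr => i /negbTE ->.
apply: (@le_trans _ _ (d ^+ 2 / (C + 1) * C)).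
  by rewrite ler_wpM2r// ltW.
rewrite mulrAC ler_pdivrMr ?ltr_wpDl// ler_wpM2l ?sqr_ge0//; lra.
Qed.

End Density.

(** If [w x] were nonzero, take a product of bumps supported where [w] differs from [w x] by less
    than half of [|w x|]. There [w x * w y >= w x ^+ 2 / 2], so the vanishing integral of [w]
    against the bump would bound a positive number from above. *)
Lemma orthogonal_eq0 {R : realType} (n : nat) (b : 'I_n.+1 -> R) (w : 'rV[R]_n.+1 -> R) :
  square_integrable (lebesgue_row R n.+1) (cuboid b) w ->
  (forall x, cuboid b x -> {for x, continuous w}) ->
  (forall h dh : 'I_n.+1 -> R -> R,
    (forall i (t : R), is_derive t 1 (h i) (dh i t)) -> (forall i, continuous (dh i)) ->
    \int[lebesgue_row R n.+1]_(x in cuboid b) (w x * \prod_i h i (x ord0 i)) = 0) ->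
  forall x, cuboid b x -> w x = 0.
Proof.
move=> Lw cw wh x xb; apply/eqP/negPn/negP => wx0.
have mc := measurable_cuboid b.
have eps0 : 0 < `|w x| / 2 by rewrite divr_gt0 ?normr_gt0.
have /nbhs_ballP[r /= r0 xr] : nbhs x [set y | `|w x - w y| < `|w x| / 2].
  exact: (proj1 (@cvgrPdist_lt R R _ (nbhs x) (nbhs_filter x) w (w x)) (cw x xb)).
have /choice[dh hdh] : forall i, exists db : R -> R,
    (forall t : R, is_derive t 1 (fun t => tent (x ord0 i) r t * tent (x ord0 i) r t) (db t)) /\
    continuous db by move=> i; exact: bump_C1.
pose h i t := tent (x ord0 i) r t * tent (x ord0 i) r t.
have h1 i (t : R) : is_derive t 1 (h i) (dh i t) by have [+ _] := hdh i; apply.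
have h2 i : continuous (dh i) by have [] := hdh i.
have ch i : continuous (h i) by move=> t; exact: is_derive1_continuous (h1 i t).
have h0 i t : 0 <= h i t by rewrite /h -expr2 sqr_ge0.
have cP : continuous (fun x : 'rV[R]_n.+1 => \prod_i h i (x ord0 i)) by exact: continuous_row_prod.
have iw : (lebesgue_row R n.+1).-integrable (cuboid b)
    (EFin \o (fun x => w x * \prod_i h i (x ord0 i))).
  by apply: square_integrable_mul => //; exact: continuous_cuboid_L2.
have ih : (lebesgue_row R n.+1).-integrable (cuboid b)
    (EFin \o (fun x => \prod_i h i (x ord0 i))).
  exact: continuous_cuboid_integrable.
have : \int[lebesgue_row R n.+1]_(y in cuboid b)
      (w x ^+ 2 / 2 * \prod_i h i (y ord0 i)) <=
    \int[lebesgue_row R n.+1]_(y in cuboid b) (w x * (w y * \prod_i h i (y ord0 i))).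
  apply: le_Rintegral => //.
  - by have := integrableZl mc (w x ^+ 2 / 2) ih.
  - by have := integrableZl mc (w x) iw.
  - move=> y _; rewrite mulrA.
    have [->|] := eqVneq (\prod_i h i (y ord0 i)) 0; first by rewrite !mulr0.
    move=> /prodf_neq0 hy; rewrite ler_wpM2r ?prodr_ge0//.
    have : `|w x - w y| < `|w x| / 2.
      apply: xr; split=> // i j; rewrite (ord1 i); apply: tent_gt0 => //.
      by have := hy j isT; rewrite /h mulf_eq0 orbb.
    move=> /ltW wxy; have : (w x - w y) * w x <= `|w x| / 2 * `|w x|.
      by rewrite (le_trans (ler_norm _))// normrM ler_wpM2r.
    have := real_normK (num_real (w x)); rewrite !expr2; lra.
rewrite RintegralZl// RintegralZl// (wh _ _ h1 h2) mulr0.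
rewrite (@cuboid_integral_prod R n.+1 b h)// leNgt => /negP; apply.
rewrite mulr_gt0 ?divr_gt0 ?exprn_even_gt0// prodr_gt0// => i _.
have /andP[x1 x2] := xb i.
(* The segment is cut at the centre of the bump, since [seg_sqr_gt0] wants a nonzero value at the
   right end. *)
rewrite (@seg_cat R _ (x ord0 i)) ?(ltW x1) ?(ltW x2)// ltr_wpDr ?seg_ge0//.
apply: seg_sqr_gt0 => //; first exact: continuous_tent.
by rewrite /tent subrr expr0n/= subr0 maxElt exprn_gt0// gt_eqF ?exprn_gt0.
Qed.

Lemma square_integrable_comb disp (T : measurableType disp) {R : realType}
    (m : {measure set T -> \bar R}) (D : set T) (mD : measurable D)
    p (u : 'I_p -> T -> R) (c : 'I_p -> R) :
  (forall i, square_integrable m D (u i)) ->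
  square_integrable m D (fun x => \sum_i c i * u i x).
Proof.
move=> Lu; split.
  apply: measurable_sum => i; apply: measurable_funM => //.
  by have [] := Lu i.
have iU i j : m.-integrable D (EFin \o (fun x => c i * c j * (u i x * u j x))).
  by have := integrableZl mD (c i * c j) (square_integrable_mul mD (Lu i) (Lu j)).
have [+ _] := integrable_bigsum mD (fun i => (integrable_bigsum mD (iU i)).1).
apply: eq_integrable => // x _ /=; rewrite expr2 mulr_suml; congr EFin.
by apply: eq_bigr => i _; rewrite mulr_sumr; apply: eq_bigr => j _; ring.
Qed.

Lemma continuous_at_comb (T : topologicalType) {R : realType} p (u : 'I_p -> T -> R)
    (c : 'I_p -> R) (x : T) :
  (forall i, {for x, continuous (u i)}) ->
  {for x, continuous (fun y => \sum_i c i * u i y)}.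
Proof.
elim: p u c => [|p IH] u c cu.
  have -> : (fun y => \sum_(i < 0) c i * u i y) = (fun=> 0).
    by apply/funext => y; rewrite big_ord0.
  exact: cst_continuous.
have -> : (fun y => \sum_i c i * u i y) = (fun y =>
    \sum_(i < p) c (widen_ord (leqnSn p) i) * u (widen_ord (leqnSn p) i) y +
    c ord_max * u ord_max y).
  by apply/funext => y; rewrite big_ord_recr.
apply: (@continuousD R R T).
  exact: (IH (fun i => u (widen_ord (leqnSn p) i)) (fun i => c (widen_ord (leqnSn p) i))).
exact: (@continuousM R T (fun=> c ord_max) _ x (@cst_continuous _ _ _ x)).
Qed.

(** The product of Robin eigenfunctions indexed by [k] has Laplacian [- robin_sum] times itself. *)
Definition robin_sum {R : realType} (d : nat) (b : 'I_d -> R) (sigma : R) (k : 'I_d -> nat) : R :=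
  \sum_i robin_lam (b i) sigma (k i).

(** * Multiplicities as numbers of indices *)

Section Multiplicity.
Context {R : realType} (n : nat) (b : 'I_n.+1 -> R) (sigma : R).
Hypotheses (b0 : forall i, 0 < b i) (sigma0 : 0 < sigma).
Variables (e de : 'I_n.+1 -> nat -> R -> R).
Hypothesis e1 : forall i k (t : R), is_derive t 1 (e i k) (de i k t).
Hypothesis e2 : forall i k (t : R),
  is_derive t 1 (de i k) (- robin_lam (b i) sigma k * e i k t).
Hypothesis eb : forall i k, e i k (b i) != 0.
Hypothesis deb : forall i k, de i k (b i) = sigma * e i k (b i).
Hypothesis deNb : forall i k, de i k (- b i) = - sigma * e i k (- b i).

Local Notation leb := (lebesgue_row R n.+1).
Implicit Types k : 'I_n.+1 -> nat.

Let ef k (x : 'rV[R]_n.+1) : R := \prod_i e i (k i) (x ord0 i).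

Let ce i (k : nat) : continuous (e i k).
Proof. by move=> t; exact: is_derive1_continuous (e1 i k t). Qed.

Let cef k : continuous (ef k).
Proof. by apply: (@continuous_row_prod R n.+1 (fun i => e i (k i))) => i; exact: ce. Qed.

Let Lef k : square_integrable leb (cuboid b) (ef k).
Proof. exact: continuous_cuboid_L2. Qed.

Let J k i := eigen_jet (e i (k i)) (de i (k i)) (robin_lam (b i) sigma (k i)).

Let dJ k i l (t : R) : is_derive t 1 (J k i l) (J k i l.+1 t).
Proof. exact: is_derive_eigen_jet. Qed.

Let JE k : jet_prod (J k) (fun=> 0%N) = ef k.
Proof.
apply/funext => x; apply: eq_bigr => i _.
by rewrite /J eigen_jet0.
Qed.

Let product_solution k : robin_sum b sigma k = 0 ->
  steklov_solution (cuboid_domain b) sigma (ef k).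
Proof.
move=> k0; rewrite -JE.
apply: (@product_steklov_solution R n b b0 sigma (J k)
  (fun i => robin_lam (b i) sigma (k i))) => //.
- by move=> i t; rewrite /J eigen_jet2 eigen_jet0.
- by move=> i; rewrite /J eigen_jet1 eigen_jet0.
- by move=> i; rewrite /J eigen_jet1 eigen_jet0.
Qed.

Let solution_ortho w k : steklov_solution (cuboid_domain b) sigma w ->
  robin_sum b sigma k != 0 -> \int[leb]_(x in cuboid b) (w x * ef k x) = 0.
Proof.
move=> Sw k0; rewrite -JE.
have := @steklov_orthogonal R n b b0 sigma (J k)
  (fun i => robin_lam (b i) sigma (k i)).
have H2 i t : J k i 2 t = - robin_lam (b i) sigma (k i) * J k i 0 t.
  by rewrite /J eigen_jet2 eigen_jet0.
have H3 i : J k i 1 (b i) = sigma * J k i 0 (b i) by rewrite /J eigen_jet1 eigen_jet0.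
have H4 i : J k i 1 (- b i) = - sigma * J k i 0 (- b i) by rewrite /J eigen_jet1 eigen_jet0.
move=> /(_ (dJ k) H2 H3 H4 w Sw) /eqP; rewrite mulf_eq0 => /orP[|/eqP //].
by rewrite -/(robin_sum b sigma k) (negbTE k0).
Qed.

Let comb_ef p (u : 'I_p -> 'rV[R]_n.+1 -> R) (c : 'I_p -> R) k :
  (forall i, square_integrable leb (cuboid b) (u i)) ->
  \int[leb]_(x in cuboid b) ((\sum_i c i * u i x) * ef k x) =
  \sum_i c i * \int[leb]_(x in cuboid b) (u i x * ef k x).
Proof.
move=> Lu; have mc := measurable_cuboid b.
have iu i : leb.-integrable (cuboid b) (EFin \o (fun x => u i x * ef k x)).
  exact: square_integrable_mul.
have [_] := integrable_bigsum mc (fun i => integrableZl mc (c i) (iu i)).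
have -> : \sum_i c i * \int[leb]_(x in cuboid b) (u i x * ef k x) =
    \sum_i \int[leb]_(x in cuboid b) (c i * (u i x * ef k x)).
  by apply: eq_bigr => i _; rewrite RintegralZl.
move=> <-; apply: eq_Rintegral => x _.
by rewrite mulr_suml; apply: eq_bigr => i _; rewrite mulrA.
Qed.

Let ef_norm k : 0 < \int[leb]_(x in cuboid b) (ef k x * ef k x).
Proof.
have -> : \int[leb]_(x in cuboid b) (ef k x * ef k x) =
    \int[leb]_(x in cuboid b) (\prod_i (fun t => e i (k i) t * e i (k i) t) (x ord0 i)).
  by apply: eq_Rintegral => x _; rewrite -big_split.
rewrite (@cuboid_integral_prod R n.+1 b (fun i t => e i (k i) t * e i (k i) t)).
  by apply: prodr_gt0 => i _; exact: (@robin_lam_norm_gt0 R n b b0 e de).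
by move=> i; exact: continuous_mul.
Qed.

Let ef_ortho k l : k <> l -> \int[leb]_(x in cuboid b) (ef k x * ef l x) = 0.
Proof.
move=> kl; have -> : \int[leb]_(x in cuboid b) (ef k x * ef l x) =
    \int[leb]_(x in cuboid b) (\prod_i (fun t => e i (k i) t * e i (l i) t) (x ord0 i)).
  by apply: eq_Rintegral => x _; rewrite -big_split.
rewrite (@cuboid_integral_prod R n.+1 b (fun i t => e i (k i) t * e i (l i) t)); last first.
  by move=> i; exact: continuous_mul.
have [i kli] : exists i, k i != l i.
  apply: contra_notP kl => /forallNP H; apply/funext => i.
  by have /negP := H i; rewrite negbK => /eqP.
by rewrite (bigD1 i)//= (@robin_lam_ortho R n b sigma b0 sigma0 e de)// mul0r.
Qed.

(** With more than [#|A|] independent solutions, some nontrivial combination is orthogonal to the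
    products indexed by [A]. It is orthogonal to all the others as a solution, so it vanishes by
    totality. The finite set [A] with its map [K] only has to cover the zeros of [robin_sum]. *)
Lemma product_multiplicity_le p (X : finType) (A : {set X}) (K : X -> 'I_n.+1 -> nat) :
  steklov_multiplicity (cuboid_domain b) sigma p ->
  (forall k, robin_sum b sigma k = 0 -> exists2 x, x \in A & k = K x) -> (p <= #|A|)%N.
Proof.
move=> [u [Su u_free _]] KA; rewrite leqNgt; apply/negP => Ap.
have Lu i : square_integrable leb (cuboid b) (u i) by have [_ [] ] := Su i.
have [v [[i0 vi0] vA]] := null_combination
  (fun i (j : 'I_#|A|) => \int[leb]_(x in cuboid b) (u i x * ef (K (enum_val j)) x)) Ap.
have /u_free/(_ i0)/eqP : forall x, cuboid b x -> \sum_j v j * u j x = 0.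
  apply: orthogonal_eq0.
  - by apply: square_integrable_comb => //; exact: measurable_cuboid.
  - move=> x xb; apply: continuous_at_comb => i.
    by have [[[cu _] _] _ _] := Su i; exact: cu.
  - apply: (@orthogonal_C1 R n b sigma b0 sigma0 e de) => //.
      by apply: square_integrable_comb => //; exact: measurable_cuboid.
    move=> k; rewrite -/(ef k) comb_ef//.
    have [k0|k0] := eqVneq (robin_sum b sigma k) 0; last first.
      by apply: big1 => i _; rewrite solution_ortho ?mulr0.
    have [x xA ->] := KA k k0.
    have := vA (enum_rank_in xA x); rewrite enum_rankK_in//.
by rewrite (negbTE vi0).
Qed.

(** If [p < #|A|], the products expand in too few solutions and satisfy a linear relation; pairing
    it with one of them contradicts orthogonality and positivity of the norms. *)
Lemma product_multiplicity_ge p (X : finType) (A : {set X}) (K : X -> 'I_n.+1 -> nat) :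
  steklov_multiplicity (cuboid_domain b) sigma p ->
  {in A &, injective K} -> {in A, forall x, robin_sum b sigma (K x) = 0} -> (#|A| <= p)%N.
Proof.
move=> [u [_ _ u_span]] Kinj KA; rewrite leqNgt; apply/negP => Ap.
have /choice[c cu] : forall j : 'I_#|A|, exists c : 'I_p -> R,
    forall x, cuboid b x -> ef (K (enum_val j)) x = \sum_i c i * u i x.
  by move=> j; apply: u_span; apply: product_solution; apply: KA; exact: enum_valP.
have [v [[j0 vj0] vc]] := null_combination c Ap.
have v0 x : cuboid b x -> \sum_j v j * ef (K (enum_val j)) x = 0.
  move=> xb; under eq_bigr => j _ do rewrite (cu j x xb) mulr_sumr.
  rewrite exchange_big/= big1// => i _.
  under eq_bigr do rewrite mulrA.
  by rewrite -mulr_suml vc mul0r.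
have := comb_ef v (K (enum_val j0)) (fun j => Lef (K (enum_val j))).
have -> : \int[leb]_(x in cuboid b)
    ((\sum_j v j * ef (K (enum_val j)) x) * ef (K (enum_val j0)) x) = 0.
  by rewrite /Rintegral integral0_eq// => x /v0 ->; rewrite mul0r.
rewrite (bigD1 j0)//= big1 ?addr0 => [/esym/eqP|j jj0].
  by rewrite mulf_eq0 (negbTE vj0) (gt_eqF (ef_norm _)).
rewrite ef_ortho ?mulr0// => Kj; move/eqP: jj0; apply.
by apply: enum_val_inj; apply: Kinj => //; exact: enum_valP.
Qed.

End Multiplicity.

Section SteklovMultiplicity.
Context {R : realType} (n : nat) (b : 'I_n.+1 -> R) (sigma : R).
Hypotheses (b0 : forall i, 0 < b i) (sigma0 : 0 < sigma).
Variables (p : nat) (X : finType) (A : {set X}) (K : X -> 'I_n.+1 -> nat).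
Hypothesis mult_p : steklov_multiplicity (cuboid_domain b) sigma p.

Lemma steklov_multiplicity_le :
  (forall k, robin_sum b sigma k = 0 -> exists2 x, x \in A & k = K x) -> (p <= #|A|)%N.
Proof.
have /choice[e /choice[de H]] i := robin_family (b0 i) sigma0.
by apply: (@product_multiplicity_le R n b sigma b0 sigma0 e de) => // i; have [] := H i.
Qed.

Lemma steklov_multiplicity_ge :
  {in A &, injective K} -> {in A, forall x, robin_sum b sigma (K x) = 0} -> (#|A| <= p)%N.
Proof.
have /choice[e /choice[de H]] i := robin_family (b0 i) sigma0.
by apply: (@product_multiplicity_ge R n b sigma b0 sigma0 e de) => // i; have [] := H i.
Qed.

End SteklovMultiplicity.

(** * Counting and rigidity *)

Lemma common_threshold {R : realType} (I : finType) (P : I -> R -> Prop) :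
  (forall i, exists2 s0 : R, 0 < s0 & forall s, 0 < s < s0 -> P i s) ->
  exists2 s0 : R, 0 < s0 & forall s, 0 < s < s0 -> forall i, P i s.
Proof.
move=> H; have /choice[f fP] i : exists s0, 0 < s0 /\ forall s, 0 < s < s0 -> P i s.
  by have [s0] := H i; exists s0.
have f0 i : 0 < f i by have [] := fP i.
exists (\big[Num.min/1]_i f i); first by apply: lt_bigmin => // i _; exact: f0.
move=> s /andP[s0 sm] i; have [_] := fP i; apply; rewrite s0/=.
by apply: (lt_le_trans sm); rewrite (bigD1 i)//= ge_min lexx.
Qed.

(** * Dependence of the Robin sums on sigma *)

Section RobinSum.
Context {R : realType} (n : nat) (b : 'I_n.+1 -> R).
Hypothesis b0 : forall i, 0 < b i.
Implicit Types (s : R) (k : 'I_n.+1 -> nat).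

Lemma robin_sum_decr s s' k : 0 < s -> s < s' -> robin_sum b s' k < robin_sum b s k.
Proof.
move=> s0 ss; rewrite /robin_sum !big_ord_recl/= ltr_leD//.
  exact: robin_lam_decr.
by apply: ler_sum => i _; apply/ltW/robin_lam_decr.
Qed.

Lemma robin_sum_le s k l : 0 < s -> (forall i, (k i <= l i)%N) ->
  robin_sum b s k <= robin_sum b s l.
Proof. by move=> s0 kl; apply: ler_sum => i _; exact: robin_lam_leq. Qed.

Lemma continuous_robin_sum s k : 0 < s -> {for s, continuous (fun s => robin_sum b s k)}.
Proof.
move=> s0; have -> : (fun s => robin_sum b s k) =
    (fun s => \sum_i 1 * robin_lam (b i) s (k i)).
  by apply/funext => t; apply: eq_bigr => i _; rewrite mul1r.
by apply: (@continuous_at_comb R) => i; exact: continuous_robin_lam.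
Qed.

(** As [s] tends to 0 the lowest levels tend to 0, whereas coordinate [i0] stays above a fixed
    positive number. *)
Lemma robin_sum_near0 k i0 : (0 < k i0)%N ->
  exists2 s0, 0 < s0 & forall s, 0 < s < s0 -> 0 < robin_sum b s k.
Proof.
(* [d] comes from the bound 1/4 of [robin_ev1_near0]. Each of the n + 1 coordinates may lose
   [e = d / n.+2], which leaves a positive total. *)
move=> k0; pose d := 1 / 4 / b i0 ^+ 2; pose e := d / n.+2%:R.
have d0 : 0 < d by rewrite divr_gt0 ?exprn_gt0//; lra.
have e0 : 0 < e by rewrite divr_gt0.
have H i : exists2 s0, 0 < s0 & forall s, 0 < s < s0 ->
    d *+ (i == i0) - e <= robin_lam (b i) s (k i).
  have [->|_] := eqVneq i i0.
    have [s0 s00 sP] := @robin_ev1_near0 R.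
    exists (s0 / b i0); first by rewrite divr_gt0.
    move=> s /andP[s1 ss]; apply: (@le_trans _ _ (robin_lam (b i0) s 1)).
      rewrite mulr1n (@le_trans _ _ d) ?gerBl ?(ltW e0)// /d /robin_lam.
      rewrite ler_pM2r ?invr_gt0 ?exprn_gt0// ltW// sP// mulr_gt0//=.
      by rewrite mulrC -ltr_pdivlMr.
    exact: robin_lam_leq.
  have e1 : 0 < e * b i ^+ 2 by rewrite mulr_gt0 ?exprn_gt0.
  have [s0 s00 sP] := @robin_ev0_near0 R _ e1.
  exists (s0 / b i); first by rewrite divr_gt0.
  move=> s /andP[s1 ss]; apply: (@le_trans _ _ (robin_lam (b i) s 0)).
    rewrite mulr0n add0r /robin_lam ler_pdivlMr ?exprn_gt0// mulNr ltW// sP// mulr_gt0//=.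
    by rewrite mulrC -ltr_pdivlMr.
  exact: robin_lam_leq.
have [s0 s00 sP] := common_threshold H.
exists s0 => // s ss; apply: (@lt_le_trans _ _ (\sum_i (d *+ (i == i0) - e))); last first.
  by apply: ler_sum => i _; exact: sP.
rewrite sumrB sumr_const card_ord (bigD1 i0)//= eqxx big1 => [|i /negbTE -> //].
rewrite addr0 mulr1n subr_gt0 -mulr_natr /e mulrAC ltr_pdivrMr// ltr_pM2l// ltr_nat.
exact: ltnSn.
Qed.

(** The sum is positive for small [s] and nonpositive at [s1], so it vanishes in between; this turns
    an index into a Steklov eigenvalue not exceeding [s1]. *)
Lemma robin_sum_root k i0 s1 : (0 < k i0)%N -> 0 < s1 -> robin_sum b s1 k <= 0 ->
  exists2 s, 0 < s <= s1 & robin_sum b s k = 0.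
Proof.
move=> k0 s10 Ts1; have [s0 s00 sP] := robin_sum_near0 k0.
pose t := Num.min s0 s1 / 2.
have t0 : 0 < t by rewrite divr_gt0// lt_min s00.
have ts0 : t < s0 by rewrite /t ltr_pdivrMr// gt_min; apply/orP; left; lra.
have ts1 : t < s1 by rewrite /t ltr_pdivrMr// gt_min; apply/orP; right; lra.
have Tt : 0 < robin_sum b t k by rewrite sP// t0.
have [] := @IVT R (fun s => robin_sum b s k) t s1 0 (ltW ts1).
- apply: continuous_within_of => s /andP[ts _].
  by apply: continuous_robin_sum; exact: lt_le_trans ts.
- by rewrite ge_min Ts1 orbT/= le_max (ltW Tt).
- move=> s; rewrite in_itv/= => /andP[ts ss1] Ts; exists s => //.
  by rewrite ss1 (lt_le_trans t0).
Qed.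

End RobinSum.

Section UnitIndex.
Context {R : realType} (n : nat).
Implicit Types (b : 'I_n.+1 -> R) (s : R) (k : 'I_n.+1 -> nat) (j : 'I_n.+1).

Definition unit_index j : 'I_n.+1 -> nat := fun i => i == j.

Lemma unit_index_inj : injective unit_index.
Proof. by move=> i j /(congr1 (@^~ i)); rewrite /unit_index eqxx; case: eqP. Qed.

Lemma robin_sum_unit b s j : robin_sum b s (unit_index j) =
  robin_lam (b j) s 1 + \sum_(i < n.+1 | i != j) robin_lam (b i) s 0.
Proof.
rewrite /robin_sum (bigD1 j)//= /unit_index eqxx; congr (_ + _).
by apply: eq_bigr => i /negbTE ->.
Qed.

Lemma robin_sum_cube_unit a s j : robin_sum (fun=> a) s (unit_index j) =
  robin_lam a s 1 + robin_lam a s 0 *+ n.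
Proof.
rewrite robin_sum_unit; congr (_ + _).
by rewrite sumr_const cardC1 card_ord.
Qed.

(** The zero index has a negative sum, so a vanishing sum needs a positive coordinate. *)
Lemma robin_sum_eq0_unit b s k : (forall i, 0 < b i) -> 0 < s -> robin_sum b s k = 0 ->
  exists j, forall i, (unit_index j i <= k i)%N.
Proof.
move=> b0 s0 ks; have [j kj] : exists j, (0 < k j)%N.
  apply: contra_eqP ks => /forallNP k0; rewrite lt_eqF// /robin_sum big_ord_recl ltr_wnDr//.
    by apply: sumr_le0 => i _; have /negP := k0 (lift ord0 i); rewrite -eqn0Ngt => /eqP ->;
      exact/ltW/robin_lam0_lt0.
  by have /negP := k0 ord0; rewrite -eqn0Ngt => /eqP ->; exact: robin_lam0_lt0.
by exists j => i; rewrite /unit_index; case: eqP => // ->.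
Qed.

End UnitIndex.

(** The upper level decreases in the half-length: its numerator decreases, and being positive at
    [b'] it also shrinks under the larger denominator. The lower level increases, by
    [robin_level0_ratio] at [b * s] and [b' * s]. *)
Lemma robin_gap_decr {R : realType} (b b' s : R) : 0 < b -> b < b' -> 0 < s ->
  0 < robin_lam b' s 1 ->
  robin_lam b' s 1 - robin_lam b' s 0 < robin_lam b s 1 - robin_lam b s 0.
Proof.
move=> b0 bb s0 l1; have b'0 := lt_trans b0 bb.
have bs : 0 < b * s by rewrite mulr_gt0.
have bbs : b * s < b' * s by rewrite ltr_pM2r.
apply: ltrB.
  move: l1; rewrite /robin_lam pmulr_lgt0 ?invr_gt0 ?exprn_gt0// => l1.
  apply: (@lt_trans _ _ (robin_ev 1 (b' * s) / b ^+ 2)).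
    by rewrite ltr_pM2l// ltf_pV2 ?posrE ?exprn_gt0// ltr_pXn2r// nnegrE ltW.
  by rewrite ltr_pM2r ?invr_gt0 ?exprn_gt0// robin_ev_decr.
rewrite /robin_lam ltr_pdivrMr ?exprn_gt0// mulrAC ltr_pdivlMr ?exprn_gt0//.
have := robin_level0_ratio (robin_evP 0 bs) (robin_evP 0 (lt_trans bs bbs)) bbs.
by rewrite !exprMn (mulrA _ (b' ^+ 2)) (mulrA _ (b ^+ 2)) ltr_pM2r// exprn_gt0.
Qed.

(** * A cuboid with the multiplicities of a cube *)

Section CubeRigidity.
Context {R : realType} (n : nat) (b : 'I_n.+1 -> R) (a : R).
Hypotheses (n0 : (0 < n)%N) (b0 : forall i, 0 < b i) (a0 : 0 < a).
Hypothesis same_multiplicity : forall sigma, 0 < sigma -> exists p,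
  steklov_multiplicity (cuboid_domain b) sigma p /\
  steklov_multiplicity (cuboid_domain (fun _ : 'I_n.+1 => a)) sigma p.

(** At [s = a^-1] the level of index 1 is 0 and the lowest level is negative, so the sum of a unit
    index is nonpositive and has a root. By symmetry of the cube the root is the same for all unit
    indices. *)
Let cube_root : exists2 s, 0 < s & forall j : 'I_n.+1, robin_sum (fun=> a) s (unit_index j) = 0.
Proof.
have s0 : 0 < a^-1 by rewrite invr_gt0.
have [|||s /andP[s1 _] sr] := @robin_sum_root R n (fun=> a) (fun=> a0) (unit_index ord0) ord0 a^-1.
- by [].
- by [].
- rewrite robin_sum_cube_unit {1}/robin_lam mulfV ?gt_eqF// robin_ev1_eq0 mul0r add0r.
  by rewrite mulrn_wle0// ltW// robin_lam0_lt0.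
by exists s => // j; rewrite robin_sum_cube_unit -(robin_sum_cube_unit a s ord0).
Qed.

(** Below [s] every unit index of the cube has positive sum, hence so does every index above one.
    The multiplicity 0 then passes to the cuboid. *)
Let cube_gap s s' : (forall j : 'I_n.+1, robin_sum (fun=> a) s (unit_index j) = 0) ->
  0 < s' < s -> steklov_multiplicity (cuboid_domain b) s' 0.
Proof.
move=> sr /andP[s'0 ss]; have [p [Mb Ma]] := same_multiplicity s'0.
suff: (p <= #|@finset.set0 unit|)%N by rewrite cards0 leqn0 => /eqP <-.
apply: (@steklov_multiplicity_le R n (fun=> a) s' (fun=> a0) s'0 p unit finset.set0
  (fun=> fun=> 0%N)) => //.
move=> k kr; have [j jk] := robin_sum_eq0_unit (fun=> a0) s'0 kr.
have := robin_sum_le (fun=> a0) s'0 jk; rewrite kr leNgt -(sr j).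
by rewrite robin_sum_decr.
Qed.

Lemma cuboid_is_cube i : b i = a.
Proof.
have [s s0 sr] := cube_root; have [p [Mb Ma]] := same_multiplicity s0.
have pn : (n.+1 <= p)%N.
  have := @steklov_multiplicity_ge R n (fun=> a) s (fun=> a0) s0 p _ [set: 'I_n.+1]%SET
    (@unit_index n) Ma.
  rewrite cardsT card_ord; apply => [j l _ _|j _]; first exact: unit_index_inj.
  exact: sr.
(* A negative sum would have a root below [s], giving the cuboid an eigenvalue in the gap. *)
have T0 j : 0 <= robin_sum b s (unit_index j).
  rewrite leNgt; apply/negP => Tj.
  have uj : (0 < unit_index j j)%N by rewrite /unit_index eqxx.
  have [s' /andP[s'0 ss] Tj'] := robin_sum_root b0 uj s0 (ltW Tj).
  have ss' : 0 < s' < s.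
    rewrite s'0 lt_neqAle ss andbT/=; apply: contraTneq Tj => <-.
    by rewrite Tj' ltxx.
  have := @steklov_multiplicity_ge R n b s' b0 s'0 0 _ [set: unit]%SET
    (fun=> unit_index j) (cube_gap sr ss').
  by rewrite cardsT card_unit => H; suff: (1 <= 0)%N by []; apply: H => // [[] []].
have Tu j : robin_sum b s (unit_index j) = 0.
  pose A := finset.finset (fun j => robin_sum b s (unit_index j) == 0).
  have pA : (p <= #|A|)%N.
    apply: (@steklov_multiplicity_le R n b s b0 s0 p _ _ (@unit_index n)) => // k kr.
    have [l lk] := robin_sum_eq0_unit b0 s0 kr.
    (* An index strictly above [unit_index l] with sum 0 would make the sum of [unit_index l]
       negative, against [T0]. *)
    have kE : k = unit_index l.
      apply/funext => m; apply/eqP; rewrite eqn_leq lk andbT leqNgt; apply/negP => ml.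
      have := T0 l; rewrite leNgt => /negP; apply; rewrite -[ltRHS]kr /robin_sum.
      rewrite (bigD1 m)//= [ltRHS](bigD1 m)//= ltr_leD//; first exact: robin_lam_lt.
      by apply: ler_sum => q _; exact: robin_lam_leq.
    by exists l; rewrite // inE -kE kr.
  have : A = [set: 'I_n.+1]%SET.
    apply/eqP; rewrite finset.eqEcard finset.subsetT cardsT card_ord.
    exact: leq_trans pn pA.
  by move/setP/(_ j); rewrite !inE => /eqP.
(* This level is minus the sum of the lowest levels of the other sides; at least one other side
   exists since the dimension exceeds 1. Its positivity is what [robin_gap_decr] requires. *)
have lam1 j : 0 < robin_lam (b j) s 1.
  have := Tu j; rewrite robin_sum_unit => /eqP; rewrite addrC addr_eq0 => /eqP/esym.
  move=> H; rewrite -oppr_lt0 H.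
  have [l lj] : exists l, l != j.
    by exists (lift j (Ordinal n0)); rewrite eq_sym neq_lift.
  rewrite (bigD1 l)//= ltr_wnDr ?robin_lam0_lt0//.
  by apply: sumr_le0 => q _; exact/ltW/robin_lam0_lt0.
have gap j : robin_lam (b j) s 1 - robin_lam (b j) s 0 =
    - \sum_i robin_lam (b i) s 0.
  rewrite (bigD1 j)//=; have := Tu j; rewrite robin_sum_unit; lra.
have bE j : b j = b i.
  apply/eqP; rewrite eq_le !leNgt; apply/andP; split; apply/negP => bb.
    by have := robin_gap_decr (b0 i) bb s0 (lam1 j); rewrite !gap ltxx.
  by have := robin_gap_decr (b0 j) bb s0 (lam1 i); rewrite !gap ltxx.
have : robin_sum (fun _ : 'I_n.+1 => b i) s (unit_index ord0) = 0.
  by rewrite -[RHS](Tu ord0); congr robin_sum; apply/funext => j.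
have := sr ord0; rewrite !robin_sum_cube_unit /robin_lam.
rewrite -!mulrnAl -!mulrDl => /eqP; rewrite mulf_eq0 invr_eq0 expf_eq0 (gt_eqF a0) orbF => /eqP Ea.
move=> /eqP; rewrite mulf_eq0 invr_eq0 expf_eq0 (gt_eqF (b0 i)) orbF => /eqP Eb.
(* Both cubes satisfy the same equation in their half-length at this [s]; after clearing the factor
   [1 / x ^+ 2] its left side is strictly decreasing, so the half-lengths agree. *)
have mono (x y : R) : 0 < x -> x < y ->
    robin_ev 1 (y * s) + robin_ev 0 (y * s) *+ n < robin_ev 1 (x * s) + robin_ev 0 (x * s) *+ n.
  move=> x0 xy; have xs : 0 < x * s by rewrite mulr_gt0.
  have xys : x * s < y * s by rewrite ltr_pM2r.
  by rewrite ltr_leD ?robin_ev_decr// lerMn2r ltW ?orbT// robin_ev_decr.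
by case: (ltgtP (b i) a) => // [/(mono _ _ (b0 i))|/(mono _ _ a0)]; rewrite Ea Eb ltxx.
Qed.

End CubeRigidity.

(** Comparing multiplicities eigenvalue by eigenvalue compares the total counts. Inside the fibre of
    [rho y], the element of rank r goes to the element of rank r in [F (rho y)]; distinct values of
    [rho] have disjoint targets. [x0] is the default of [nth]. *)
Lemma leq_card_fibers (X Y : finType) (T : eqType) (rho : Y -> T) (F : T -> {set X}) (x0 : X) :
  (forall y, (#|finset.finset (fun z => rho z == rho y)| <= #|F (rho y)|)%N) ->
  (forall y z x, x \in F (rho y) -> x \in F (rho z) -> rho y = rho z) ->
  (#|Y| <= #|X|)%N.
Proof.
move=> YF Finj; pose A t := finset.finset (fun z => rho z == t).
have yA y : y \in A (rho y) by rewrite inE.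
pose f y := nth x0 (enum (F (rho y))) (index y (enum (A (rho y)))).
have lt_index y : (index y (enum (A (rho y))) < size (enum (F (rho y))))%N.
  rewrite -cardE; apply: leq_trans (YF y).
  by rewrite cardE index_mem mem_enum.
have fF y : f y \in F (rho y) by rewrite -mem_enum mem_nth.
apply: (@leq_card _ _ f) => y z yz.
have rE : rho y = rho z by apply: (Finj y z (f y)); rewrite ?fF// yz fF.
move/eqP: yz; rewrite /f rE nth_uniq ?enum_uniq//; last by rewrite -rE.
have yAz : y \in enum (A (rho z)) by rewrite mem_enum -rE.
have zAz : z \in enum (A (rho z)) by rewrite mem_enum.
by move=> /eqP yz; rewrite -(nth_index y yAz) yz nth_index.
Qed.

Lemma sum_sqr_le {R : realType} (I : finType) (x : I -> R) : (forall i, 0 <= x i) ->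
  \sum_i x i ^+ 2 <= (\sum_i x i) ^+ 2.
Proof.
move=> x0; rewrite [leRHS]expr2 mulr_suml; apply: ler_sum => i _.
rewrite expr2 ler_wpM2l// (bigD1 i)//= lerDl.
by apply: sumr_ge0 => j _.
Qed.

(** * Counting indices and the dimension *)

Section DimensionBound.
Context {R : realType}.

(** Serves both sides of the count. With [c = 0] and shift 1 it lists indices whose remaining
    coordinates are positive, so that [robin_sum_root] applies; with [c] at most 1 and shift 0 it
    covers all indices that can have sum 0. *)
Definition extend_index n (i : 'I_n.+1) (c : nat) N (y : {ffun 'I_n -> 'I_N}) (s : nat) :
    'I_n.+1 -> nat :=
  fun j => oapp (fun l => (y l + s)%N) c (unlift i j).

(** At this parameter the lowest level lies below minus the square of a sum, hence below minus the
    sum of the squares [(N * (pi / 2) / b i) ^+ 2], and these bound the remaining levels because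
    each coordinate is at most [N]. *)
Lemma robin_sum_extend_le0 n (b : 'I_n.+1 -> R) N (y : {ffun 'I_n -> 'I_N}) :
  (forall i, 0 < b i) -> (0 < N)%N ->
  robin_sum b (\sum_i (pi / 2 / b i) * N%:R) (extend_index ord0 0 y 1) <= 0.
Proof.
move=> b0 N0; set s := \sum_i _.
have p0 i : 0 < pi / 2 / b i * N%:R by rewrite mulr_gt0 ?ltr0n// divr_gt0// divr_gt0// pi_gt0.
have s0 : 0 < s.
  by rewrite /s big_ord_recl ltr_wpDr// sumr_ge0// => i _; exact/ltW.
rewrite /robin_sum big_ord_recl.
apply: (@le_trans _ _ (- s ^+ 2 + \sum_(i < n) (pi / 2 / b (lift ord0 i) * N%:R) ^+ 2)).
  apply: lerD.
    by rewrite /extend_index unlift_none /= ltW// robin_lam0_upper.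
  apply: ler_sum => i _; rewrite /extend_index liftK /= addn1.
  apply: le_trans (robin_lam_upper _ _ _) _ => //.
  rewrite ler_sqr ?nnegrE ?(ltW (p0 _))//; last first.
    by rewrite mulr_ge0// ?invr_ge0 ?(ltW (b0 _))// mulr_ge0// divr_ge0// pi_ge0.
  have -> : pi / 2 / b (lift ord0 i) * N%:R = N%:R * (pi / 2) / b (lift ord0 i).
    by ring.
  rewrite ler_wpM2r ?invr_ge0 ?(ltW (b0 _))// ler_wpM2r ?divr_ge0 ?pi_ge0//.
  by rewrite ler_nat ltn_ord.
rewrite addrC subr_le0.
have := @sum_sqr_le R 'I_n.+1 _ (fun i => ltW (p0 i)).
rewrite -/s; apply: le_trans; rewrite [leRHS]big_ord_recl/= lerDr.
exact: sqr_ge0.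
Qed.

Lemma robin_sum_eq0_le1 n (b : 'I_n.+1 -> R) s (k : 'I_n.+1 -> nat) :
  (forall i, 0 < b i) -> 0 < s -> robin_sum b s k = 0 -> exists i, (k i <= 1)%N.
Proof.
move=> b0 s0; apply: contra_eqP => /forallNP k2; rewrite gt_eqF//.
have lam0 i : 0 < robin_lam (b i) s (k i).
  have /negP := k2 i; rewrite -ltnNge; case: (k i) => [|[|l]] // _.
  by apply: le_lt_trans (robin_lam_lower _ _ _) => //; exact: sqr_ge0.
by rewrite /robin_sum big_ord_recl ltr_wpDr// sumr_ge0// => i _; exact/ltW.
Qed.

(** A positive level has to be balanced by the other ones, each at least [- (s + (b j)^-1) ^+ 2];
    the total is at most [(E * N) ^+ 2]. As the level of index l + 2 exceeds
    [(l.+1 * (pi / 2) / b i) ^+ 2] and [pi / 2 >= 1], this gives [l.+1 < E * B * N]. *)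
Lemma robin_sum_eq0_bound n (b : 'I_n.+1 -> R) (C : R) : (forall i, 0 < b i) -> 0 < C ->
  exists D : nat, forall N s (k : 'I_n.+1 -> nat), (0 < N)%N -> 0 < s <= C * N%:R ->
    robin_sum b s k = 0 -> forall i, (k i < D.+1 * N)%N.
Proof.
move=> b0 C0; pose E := \sum_(i < n.+1) (C + (b i)^-1); pose B := \sum_i b i.
have B0 : 0 <= B by apply: sumr_ge0 => i _; exact/ltW.
have E0 : 0 <= E by apply: sumr_ge0 => i _; rewrite addr_ge0 ?invr_ge0 ?ltW.
exists (Num.bound (E * B)).+1 => N s k N0 /andP[s0 sC] kr i.
case ki : (k i) => [|[|l]]; [by rewrite muln_gt0|by move: N0; nia|].
have lamS : robin_lam (b i) s (k i) <= (\sum_i (s + (b i)^-1)) ^+ 2.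
  have := kr; rewrite /robin_sum (bigD1 i)//= => /eqP; rewrite addr_eq0 => /eqP ->.
  apply: le_trans (@sum_sqr_le R 'I_n.+1 _ _); last first.
    by move=> j; rewrite addr_ge0 ?invr_ge0 ?ltW.
  rewrite [leRHS](bigD1 i)//= -sumrN ler_wpDl ?sqr_ge0//; apply: ler_sum => j _.
  rewrite lerNl; apply: le_trans (robin_lam_leq _ _ (leq0n _)) => //.
  exact: robin_lam0_lower.
have SE : \sum_i (s + (b i)^-1) <= E * N%:R.
  rewrite mulr_suml; apply: ler_sum => j _; rewrite mulrDl lerD//.
  by rewrite ler_peMr ?ler1n ?invr_ge0// ltW.
have := lt_le_trans (robin_lam_lower l (b0 i) s0) _; rewrite -ki => /(_ _ lamS).
rewrite ltr_sqr ?nnegrE; last 2 first.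
  by rewrite mulr_ge0 ?invr_ge0 ?(ltW (b0 _))// mulr_ge0// divr_ge0// pi_ge0.
  by apply: sumr_ge0 => j _; rewrite addr_ge0 ?invr_ge0 ?ltW.
move=> /lt_le_trans/(_ SE); rewrite ltr_pdivrMr// => lE.
have lEB : l.+1%:R < E * B * N%:R.
  apply: le_lt_trans (lt_le_trans lE _).
    by rewrite ler_peMr// pihalf_ge1.
  rewrite mulrAC ler_wpM2r// ler_wpM2l// /B (bigD1 i)//= lerDl sumr_ge0// => j _.
  exact/ltW.
rewrite -(ltr_nat R).
have EB := archi_boundP (mulr_ge0 E0 B0).
have : l.+1%:R < (Num.bound (E * B))%:R * N%:R :> R.
  by apply: lt_le_trans lEB _; rewrite ler_wpM2r// ltW.
rewrite -natrM !ltr_nat; nia.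
Qed.

(** If [n > m], the [N ^ n] indices of [Y] all have their roots below [C * N], while the indices
    that can vanish on the other side within this range number at most a constant times [N ^ m]. *)
Lemma dimension_le n m (b : 'I_n.+1 -> R) (a : 'I_m.+1 -> R) :
  (forall i, 0 < b i) -> (forall i, 0 < a i) ->
  (forall sigma, 0 < sigma -> exists p,
    steklov_multiplicity (cuboid_domain b) sigma p /\
    steklov_multiplicity (cuboid_domain a) sigma p) ->
  (n <= m)%N.
Proof.
move=> b0 a0 same_multiplicity; rewrite leqNgt; apply/negP => mn.
pose C := \sum_i (pi / 2 / b i).
have C0 : 0 < C.
  have p0 i : 0 < pi / 2 / b i by rewrite divr_gt0// divr_gt0// pi_gt0.
  by rewrite /C big_ord_recl ltr_wpDr// sumr_ge0// => i _; exact/ltW.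
have [D DP] := robin_sum_eq0_bound a0 C0.
(* [X] below has [m.+1 * 2 * (D.+1 * N) ^ m] elements; one more than the coefficient of [N ^ m]
   makes this smaller than [N ^ m.+1]. *)
pose N := (m.+1 * 2 * D.+1 ^ m).+1; have N0 : (0 < N)%N by [].
pose Y := {ffun 'I_n -> 'I_N}.
have /choice[rho rhoP] (y : Y) : exists s, 0 < s <= C * N%:R /\
    robin_sum b s (extend_index ord0 0 y 1) = 0.
  have n0 : (0 < n)%N by exact: leq_ltn_trans mn.
  have y1 : (0 < extend_index ord0 0 y 1 (lift ord0 (Ordinal n0)))%N.
    by rewrite /extend_index liftK /= addn1.
  have CN : 0 < C * N%:R by rewrite mulr_gt0// ltr0n.
  have [|s] := @robin_sum_root R n b b0 _ _ _ y1 CN; last by exists s.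
  by rewrite /C mulr_suml; exact: robin_sum_extend_le0.
(* The place of a coordinate at most 1, its value read as a boolean, and the other coordinates,
   which are below [D.+1 * N]. An index may be encoded several times; this only enlarges the
   bound. *)
pose X := ('I_m.+1 * bool * {ffun 'I_m -> 'I_(D.+1 * N)})%type.
pose K (x : X) := extend_index x.1.1 x.1.2 x.2 0.
pose F s := finset.finset (fun x : X => robin_sum a s (K x) == 0).
have YX : (#|{: Y}| <= #|{: X}|)%N.
  have DN : (0 < D.+1 * N)%N by rewrite muln_gt0.
  apply: (@leq_card_fibers X Y R rho F (ord0, false, [ffun=> Ordinal DN])).
    move=> y; have [/andP[s0 sC] sr] := rhoP y.
    have [p [Mb Ma]] := same_multiplicity _ s0.
    apply: (@leq_trans p).
      apply: (@steklov_multiplicity_ge R n b (rho y) b0 s0 p _ _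
        (fun y : Y => extend_index ord0 0 y 1)) => //.
        move=> u v _ _ uv; apply/ffunP => i; apply/val_inj.
        have := congr1 (@^~ (lift ord0 i)) uv; rewrite /extend_index liftK /=.
        by rewrite !addn1 => -[].
      by move=> u; rewrite inE => /eqP <-; have [] := rhoP u.
    apply: (@steklov_multiplicity_le R m a (rho y) a0 s0 p X _ K) => // k kr.
    have [i ki] := robin_sum_eq0_le1 a0 s0 kr.
    have kD : forall i, (k i < D.+1 * N)%N.
      by apply: (DP N (rho y)) => //; rewrite s0.
    have kE : k = K (i, k i == 1%N, [ffun j => Ordinal (kD (lift i j))]).
      apply/funext => j; rewrite /K /extend_index /=.
      case: unliftP => [l ->|->] /=; first by rewrite ffunE addn0.
      by case: (k i) ki => [|[]].
    by eexists; [|exact: kE]; rewrite inE -kE kr.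
  move=> y z x; rewrite !inE => /eqP Ey /eqP Ez.
  have [/andP[y0 _] _] := rhoP y; have [/andP[z0 _] _] := rhoP z.
  case: (ltgtP (rho y) (rho z)) => // [yz|zy].
    by have := robin_sum_decr a0 (K x) y0 yz; rewrite Ey Ez ltxx.
  by have := robin_sum_decr a0 (K x) z0 zy; rewrite Ey Ez ltxx.
move: YX; rewrite card_ffun !card_prod card_ffun !card_ord card_bool expnMn.
rewrite leqNgt => /negP; apply; apply: (@leq_trans (N ^ m.+1)); last by rewrite leq_pexp2l.
by rewrite expnS mulnA ltn_pmul2r// expn_gt0.
Qed.

End DimensionBound.

Theorem corollary1p7 (R : realType) (d m : nat) (hd : (2 <= d)%N)
    (hm : (2 <= m)%N) (b : 'I_d -> R) (hb : forall i, 0 < b i)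
    (a : R) (ha : 0 < a)
    (hiso : steklov_isospectral (cuboid_domain b)
              (cuboid_domain (fun _ : 'I_m => a))) :
  d = m /\ cuboid b = cuboid (fun _ : 'I_d => a).
Proof.
case: d hd b hb hiso => // n n0 b b0 [s [[_ _ Sb] [_ _ Sa]]].
case: m hm Sa => // p p0 Sa.
have same_multiplicity sigma : exists k,
    steklov_multiplicity (cuboid_domain b) sigma k /\
    steklov_multiplicity (cuboid_domain (fun _ : 'I_p.+1 => a)) sigma k.
  have [k [ck Mk]] := Sb sigma; have [l [cl Ml]] := Sa sigma.
  (* Both multiplicities are the cardinality of the same level set of the common sequence [s]. *)
  have kl : k = l.
    by apply/card_eq_II; apply: card_eq_trans cl; rewrite card_eq_sym.
  by exists k; split=> //; rewrite kl.
have np : n = p.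
  apply/eqP; rewrite eqn_leq; apply/andP; split.
    by apply: (dimension_le b0 (fun=> ha)) => sigma _; exact: same_multiplicity.
  apply: (@dimension_le R p n (fun=> a) b (fun=> ha) b0) => sigma _.
  by have [k [Mb Ma]] := same_multiplicity sigma; exists k.
subst p; split=> //; congr cuboid; apply/funext => i.
by apply: (@cuboid_is_cube R n b a n0 b0 ha) => sigma _; exact: same_multiplicity.
Qed.
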